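(* Let $(\mathcal{E},\mathcal{F})$ be the Dirichlet form associated with a regular harmonic structure on a connected post-critically finite self-similar set $K$ (see context), and suppose that the index of $(\mathcal{E},\mathcal{F})$ is one. Let $g\in\mathcal{F}_{\mathrm{dom}}$, and let $\{n(k)\}_{k\ge1}$ be an increasing sequence of nonnegative integers with $n(k)\uparrow\infty$ and $\sum_{k=1}^\infty\sqrt{\mathcal{E}(g-H_{n(k)}(g))}<\infty$. Then for every $f\in\mathcal{F}$, for $\nu_g$-a.e. $x$, there exists a unique real number $\frac{df}{dg}(x)$ such that $$f(y)-f(x)=\frac{df}{dg}(x)\,(g(y)-g(x))+R_x(y),\quad y\in K,$$ where $R_x(y)$ is negligible in the sense that $$\lim_{k\to\infty}\frac{\sup_{y\in K_{[x]_{n(k)}}}|R_x(y)|}{\operatorname{Osc}_{y\in K_{[x]_{n(k)}}}g(y)}=0 .$$ In particular, $$\liminf_{n\to\infty}\frac{\sup_{y\in K_{[x]_{n}}}|R_x(y)|}{\operatorname{Osc}_{y\in K_{[x]_{n}}}g(y)}=0 .$$ Moreover, $$\mathcal{E}(f)=\frac12\int_K\Big(\frac{df}{dg}(x)\Big)^2\,\nu_g(dx),$$ and the map $\mathcal{F}\ni f\mapsto\frac{df}{dg}\in L^2(K,\nu_g)$ is a bounded linear map. If $g$ belongs to $\mathcal{H}_*$, the limit along $\{n(k)\}$ can be replaced by the stronger claim $$\lim_{n\to\infty}\frac{\sup_{y\in K_{[x]_n}}|R_x(y)|}{\operatorname{Osc}_{y\in K_{[x]_n}}g(y)}=0 .$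$
   Context: **Self-similar structure.** $K$ is a compact metrizable space, $S=\{1,\dots,N\}$ with $N\ge2$, $\psi_i:K\to K$ ($i\in S$) continuous injective maps, $\Sigma=S^{\mathbb{N}}$, $\sigma_i(\omega_1\omega_2\cdots)=i\omega_1\omega_2\cdots$, and there is a continuous surjection $\pi:\Sigma\to K$ with $\psi_i\circ\pi=\pi\circ\sigma_i$ for all $i$. $W_0=\{\emptyset\}$, $W_m=S^m$, $W_*=\bigcup_{m\ge0}W_m$; for $w=w_1\cdots w_m$, $\psi_w=\psi_{w_1}\circ\cdots\circ\psi_{w_m}$ ($\psi_\emptyset=\mathrm{id}$), $K_w=\psi_w(K)$. With the shift $\sigma^m(\omega_1\omega_2\cdots)=\omega_{m+1}\omega_{m+2}\cdots$, put $\mathcal{P}=\bigcup_{m\ge1}\sigma^m\big(\pi^{-1}(\bigcup_{i\ne j}(K_i\cap K_j))\big)$, $V_0=\pi(\mathcal{P})$. Assume $K$ is connected and $\mathcal{P}$ is finite (post-critically finite). $V_m=\bigcup_{w\in W_m}\psi_w(V_0)$, $V_*=\bigcup_m V_m$. For $x\in K\setminus V_*$ there is a unique $\omega\in\Sigma$ with $\pi(\omega)=x$; $[x]_m=\omega_1\cdots\omega_m$, $[x]_0=\emptyset$. (One has $\nu_f(V_* )=0$ for every energy measure $\nu_f$ below, so a.e. statements concern $x\in K\setminus V_*$.) **Harmonic structure and Dirichlet form.** For a finite set $V$, $l(V)$ is the space of real functions on $V$ with inner product $(u,v)_{l(V)}=\sum_{q\in V}u(q)v(q)$. $D=(D_{qq'})_{q,q'\in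 V_0}$ is a symmetric linear operator on $l(V_0)$, nonpositive definite, with $Du=0$ iff $u$ is constant, and $D_{qq'}\ge0$ for $q\ne q'$. $\mathcal{E}^{(0)}(u,v)=(-Du,v)_{l(V_0)}$. For $\boldsymbol{r}=\{r_i\}_{i\in S}$, $r_i>0$, set $r_w=r_{w_1}\cdots r_{w_m}$, $r_\emptyset=1$, and $\mathcal{E}^{(m)}(u,v)=\sum_{w\in W_m}r_w^{-1}\mathcal{E}^{(0)}(u\circ\psi_w|_{V_0},v\circ\psi_w|_{V_0})$ on $l(V_m)$. $(D,\boldsymbol{r})$ is a harmonic structure if $\mathcal{E}^{(0)}(v,v)=\inf\{\mathcal{E}^{(1)}(u,u):u\in l(V_1),u|_{V_0}=v\}$ for all $v\in l(V_0)$; it is regular if $0<r_i<1$ for all $i$. Fix a regular harmonic structure and a Borel probability measure $\mu$ on $K$ with full support. Then $\mathcal{F}=\{u\in C(K):\lim_m\mathcal{E}^{(m)}(u|_{V_m},u|_{V_m})<\infty\}$, $\mathcal{E}(u,v)=\lim_m\mathcal{E}^{(m)}(u|_{V_m},v|_{V_m})$ is a strong local regular Dirichlet form on $L^2(K,\mu)$; $\mathcal{E}(f)=\mathcal{E}(f,f)$ and $\mathcal{F}$ has norm $\|f\|_{\mathcal{F}}=(\mathcal{E}(f)+\int_K f^2d\mu)^{1/2}$. **Energy measures and index.** For $f\in\mathcal{F}$, $\nu_f$ is the finite positive Borel measure with $\int_K\varphi\,d\nu_f=2\mathcal{E}(f\varphi,f)-\mathcal{E}(\varphi,f^2)$ for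 all $\varphi\in\mathcal{F}$; $\nu_{f,g}=\frac12(\nu_{f+g}-\nu_f-\nu_g)$. A $\sigma$-finite Borel measure $\nu$ is a minimal energy-dominant measure if (i) $\nu_f\ll\nu$ for all $f\in\mathcal{F}$ and (ii) any $\sigma$-finite Borel $\nu'$ satisfying (i) in place of $\nu$ has $\nu\ll\nu'$. $\mathcal{F}_{\mathrm{dom}}$ is the set of $f\in\mathcal{F}$ for which $\nu_f$ is a minimal energy-dominant measure. The index of $(\mathcal{E},\mathcal{F})$ is the smallest $p\in\mathbb{Z}_+\cup\{+\infty\}$ such that for any $M\in\mathbb{N}$ and $f_1,\dots,f_M\in\mathcal{F}$, $\operatorname{rank}\big(\frac{d\nu_{f_i,f_j}}{d\nu}(x)\big)_{i,j=1}^M\le p$ for $\nu$-a.e. $x$, where $\nu$ is any minimal energy-dominant measure. **Harmonic functions.** For $u\in l(V_0)$ the harmonic function with boundary value $u$ is the unique $h\in\mathcal{F}$ with $h|_{V_0}=u$ minimizing $\mathcal{E}$ among such functions; $\mathcal{H}$ is the space of harmonic functions. $\mathcal{H}_m=\{f\in\mathcal{F}: f\circ\psi_w\in\mathcal{H}\text{ for all }w\in W_m\}$, $\mathcal{H}_*=\bigcup_{m\ge0}\mathcal{H}_m$. $H_n:\mathcal{F}\to\mathcal{H}_n$ sends $f$ to the unique element of $\mathcal{H}_n$ equal to $f$ on $V_n$. $\operatorname{Osc}_{y\in B}f(y)=\sup_Bf-\inf_Bf$. *)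

(* Defs.v *)
From HB Require Import structures.
From mathcomp Require Import all_boot all_order all_algebra.
From mathcomp Require Import all_classical all_reals all_analysis.

Set Implicit Arguments.
Unset Strict Implicit.
Unset Printing Implicit Defensive.

Import Order.TTheory GRing.Theory Num.Theory.
Import numFieldNormedType.Exports.

Local Open Scope classical_set_scope.
Local Open Scope ring_scope.

Notation borel K := (g_sigma_algebraType (@open K)).

Definition metrizable (R : realType) (K : topologicalType) : Prop :=
  exists dist : K -> K -> R,
    [/\ forall x y, dist x y = 0 <-> x = y,
        forall x y, dist x y = dist y x,
        forall x y z, dist x z <= dist x y + dist y z &
        forall x (A : set K), nbhs x A <->
          exists2 e : R, 0 < e & [set y | dist x y < e] `<=` A].

Definition full_support (R : realType) (K : ptopologicalType)
    (mu : {measure set (borel K) -> \bar R}) : Prop :=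
  forall U : set K, open U -> U !=set0 -> (0 < mu U)%E.

Definition osc (R : realType) (T : Type) (f : T -> R) (B : set T) : R :=
  sup (f @` B) - inf (f @` B).

(** ** Self-similar structures *)

(* One-sided infinite words over the alphabet 'I_N, with the product of the
   discrete topologies; letters and positions are numbered from 0. *)
Definition shift_space (N : nat) : topologicalType :=
  prod_topology (fun _ : nat => discrete_topology 'I_N).

Definition shift_cons (N : nat) (i : 'I_N) (omega : shift_space N) :
  shift_space N := fun k => if k is k'.+1 then omega k' else i.

Definition shift (N m : nat) (omega : shift_space N) : shift_space N :=
  fun k => omega (m + k)%N.

Record selfSimilar (K : topologicalType) (N : nat) := SelfSimilar {
  psi : 'I_N -> K -> K;
  coding : shift_space N -> K;
  psi_continuous : forall i, continuous (psi i);
  psi_injective : forall i, injective (psi i);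
  coding_continuous : continuous coding;
  coding_surjective : forall x, exists omega, coding omega = x;
  psi_coding : forall i omega, psi i (coding omega) = coding (shift_cons i omega)
}.

Section SelfSimilarSets.
Variables (K : topologicalType) (N : nat) (L : selfSimilar K N).

Definition psi_word (w : seq 'I_N) : K -> K :=
  foldr (fun i f => psi L i \o f) id w.

Definition cell (w : seq 'I_N) : set K := range (psi_word w).

Definition overlap : set K :=
  [set x | exists i j : 'I_N, [/\ i != j, cell [:: i] x & cell [:: j] x]].

Definition post_critical : set (shift_space N) :=
  \bigcup_(m in [set m | (1 <= m)%N]) (@shift N m @` (coding L @^-1` overlap)).

Definition post_critically_finite : Prop := finite_set post_critical.

Definition V0 : set K := coding L @` post_critical.

Definition V (m : nat) : set K :=
  \bigcup_(w in [set w : seq 'I_N | size w = m]) (psi_word w @` V0).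

(* The code of [x] is unique when [x] lies in no [V m]; at the remaining points
   (a countable set, null for every energy measure) one code is selected. *)
Definition code (x : K) : shift_space N := sval (cid (coding_surjective L x)).

Definition code_prefix (x : K) (n : nat) : seq 'I_N := mkseq (code x) n.

End SelfSimilarSets.

(** ** Harmonic structures *)

(* An element of l(V), for V a finite subset of K, is represented by any
   function K -> R extending it, and a linear operator on l(V_0) by a matrix
   K -> K -> R of which only the entries indexed by V_0 are used. *)
Section DiscreteEnergies.
Variables (R : realType) (K : topologicalType) (N : nat) (L : selfSimilar K N).
Variables (D : K -> K -> R) (r : 'I_N -> R).

Definition laplacian (u : K -> R) (q : K) : R :=
  \sum_(q' \in V0 L) D q q' * u q'.

Definition energy0 (u v : K -> R) : R :=
  \sum_(q \in V0 L) - laplacian u q * v q.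

Definition energym (m : nat) (u v : K -> R) : R :=
  \sum_(w : m.-tuple 'I_N)
    (\prod_(i <- w) r i)^-1 * energy0 (u \o psi_word L w) (v \o psi_word L w).

End DiscreteEnergies.

Record harmonicStructure (R : realType) (K : topologicalType) (N : nat)
    (L : selfSimilar K N) := HarmonicStructure {
  hD : K -> K -> R;
  hr : 'I_N -> R;
  hD_sym : forall q q', V0 L q -> V0 L q' -> hD q q' = hD q' q;
  hD_nonpos : forall u : K -> R,
    \sum_(q \in V0 L) laplacian L hD u q * u q <= 0;
  hD_ker : forall u : K -> R,
    (forall q, V0 L q -> laplacian L hD u q = 0) <->
    (exists c, forall q, V0 L q -> u q = c);
  hD_offdiag : forall q q', V0 L q -> V0 L q' -> q <> q' -> 0 <= hD q q';
  hr_gt0 : forall i, 0 < hr i;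
  energy0_inf : forall v : K -> R,
    energy0 L hD v v =
    inf [set energym L hD hr 1 u u | u in
           [set u : K -> R | forall q, V0 L q -> u q = v q]]
}.

Definition regular_harmonic (R : realType) (K : topologicalType) (N : nat)
    (L : selfSimilar K N) (HS : harmonicStructure R L) : Prop :=
  forall i, 0 < hr HS i < 1.

(** ** The Dirichlet form and harmonic functions *)

Section DirichletForm.
Variables (R : realType) (K : ptopologicalType) (N : nat) (L : selfSimilar K N).
Variable HS : harmonicStructure R L.

Local Notation Em := (energym L (hD HS) (hr HS)).

Definition domF : set (K -> R) :=
  [set u | continuous u /\ cvgn (fun m => Em m u u)].

Definition energy (u v : K -> R) : R := limn (fun m => Em m u v).

Definition normF (mu : {measure set (borel K) -> \bar R}) (f : K -> R) : R :=
  Num.sqrt (energy f f + \int[mu]_x f x ^+ 2).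

Definition harmonic_extension (u h : K -> R) : Prop :=
  [/\ domF h, forall q, V0 L q -> h q = u q &
      forall f, domF f -> (forall q, V0 L q -> f q = u q) ->
        energy h h <= energy f f].

Definition harmonic : set (K -> R) :=
  [set h | exists u : K -> R, harmonic_extension u h].

Definition harmonicm (m : nat) : set (K -> R) :=
  [set f | domF f /\
           forall w : seq 'I_N, size w = m -> harmonic (f \o psi_word L w)].

Definition harmonic_star : set (K -> R) := \bigcup_m harmonicm m.

(* The unique element of H_n that agrees with f on V_n, for f in the domain;
   the default value of [xget] is not used there. *)
Definition harmonic_interp (n : nat) (f : K -> R) : K -> R :=
  xget f [set h | harmonicm n h /\ forall q, V L n q -> h q = f q].

(** ** Energy measures and index *)

Variable nu : (K -> R) -> {finite_measure set (borel K) -> \bar R}.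

(* nu f is the energy measure of f, for every f in the domain *)
Definition energy_measures : Prop :=
  forall f phi, domF f -> domF phi ->
    \int[nu f]_x phi x = 2 * energy (f \* phi) f - energy phi (f \* f).

Definition mutual_energy_measure (f g : K -> R) :
    {charge set (borel K) -> \bar R} :=
  cscale 2^-1
    (cadd (charge_of_finite_measure (nu (f \+ g)))
          (copp (cadd (charge_of_finite_measure (nu f))
                      (charge_of_finite_measure (nu g))))).

Definition energy_dominant
    (lam : {sigma_finite_measure set (borel K) -> \bar R}) : Prop :=
  forall f, domF f -> nu f `<< lam.

Definition minimal_energy_dominant
    (lam : {sigma_finite_measure set (borel K) -> \bar R}) : Prop :=
  energy_dominant lam /\
  forall lam' : {sigma_finite_measure set (borel K) -> \bar R},
    energy_dominant lam' -> lam `<< lam'.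

Definition domF_dom : set (K -> R) :=
  [set f | domF f /\ minimal_energy_dominant (nu f)].

Definition index_bound (p : nat) : Prop :=
  forall lam : {sigma_finite_measure set (borel K) -> \bar R},
  minimal_energy_dominant lam ->
  forall (M : nat) (f : 'I_M -> K -> R), (forall i, domF (f i)) ->
  {ae lam, forall x, (\rank (\matrix_(i < M, j < M)
     fine (Radon_Nikodym (mutual_energy_measure (f i) (f j)) lam x)) <= p)%N}.

(* Infimum of a set of natural numbers in [0, +oo], i.e. its least element, or
   +oo if the set is empty. *)
Definition energy_index : \bar R :=
  ereal_inf [set p%:R%:E | p in [set p : nat | index_bound p]].

End DirichletForm.

(** ** Derivatives *)

Section Derivative.
Variables (R : realType) (K : topologicalType) (N : nat) (L : selfSimilar K N).
Variables (g f : K -> R).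

Definition remainder (x : K) (a : R) (y : K) : R :=
  f y - f x - a * (g y - g x).

Definition remainder_ratio (x : K) (a : R) (n : nat) : R :=
  let B := cell L (code_prefix L x n) in
  sup [set `|remainder x a y| | y in B] / osc g B.

Definition is_derivative_along (n : nat -> nat) (x : K) (a : R) : Prop :=
  remainder_ratio x a (n k) @[k --> \oo] --> (0 : R).

End Derivative.

Definition bounded_linear_L2 (R : realType) (K : ptopologicalType)
    (F : set (K -> R)) (norm : (K -> R) -> R)
    (m : {measure set (borel K) -> \bar R}) (T : (K -> R) -> (K -> R)) : Prop :=
  [/\ forall f, F f -> (T f : borel K -> R) \in Lfun m 2%:E,
      forall (a : R) f h, F f -> F h ->
        {ae m, forall x, T (fun y => a * f y + h y) x = a * T f x + T h x} &
      exists C : R, forall f, F f ->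
        ('N[m]_(2%:E)[EFin \o (T f : borel K -> R)] <= (C * norm f)%:E)%E].

(* Main.v *)
(* On the cell K_w the energy measure of f has mass e_f(w) = 2 E(f o psi_w) / r_w, so
   E(f), the densities of mutual energy measures with respect to nu_g, and the
   oscillation of f, which is at most a constant times the square root of
   r_w e_f(w), are all read off from the tree of words.  The density of nu_(f,g),
   obtained by differentiating along the cells that shrink to x, is the derivative
   a = df/dg(x): index one says that the Gram matrix of the densities of f and g has
   rank one, hence nu_f has density a^2, and e_(f - a g)([x]_n) = o(e_g([x]_n)).  So
   the oscillation of the remainder is negligible with respect to the square root of
   r_w e_g(w), and it remains to bound the oscillation of g below by that quantity.
   This holds for functions harmonic in the cell, because they are determined by
   finitely many boundary values; it passes to g on the cells where e_(g - H_n g) is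
   at most e_g / 4, and by Borel-Cantelli these are almost all cells around almost
   every point. *)

Require Import Defs.
From mathcomp Require Import all_boot all_order all_algebra.
From mathcomp Require Import all_classical all_reals all_analysis.
From mathcomp Require Import measurable_realfun lra ring.
Import Order.TTheory GRing.Theory Num.Theory.
Import numFieldNormedType.Exports.
Set Implicit Arguments.
Unset Strict Implicit.
Unset Printing Implicit Defensive.
Local Open Scope classical_set_scope.
Local Open Scope ring_scope.

(** * Differentiation of measures along cylinders *)

(** The energy measures are prescribed only through integrals of functions of the domain, so the
    mass of a cell has to be computed. Testing against interpolated indicators bounds it above by
    e_f(w). Cells overlap at images of V_0; selecting one code per point yields cylinders, which
    partition K at each level. Their total mass 2 E(f) is also the sum of the e_f(w), so the bounds
    are equalities on cylinders. Measures are differentiated along these cylinders by stopping at a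
    first prefix, in place of a covering theorem. This works for positive measures, and nu_(f,g) is
    reached by polarization. Harmonic functions have to be constructed as well, in order to know
    that H_n g really interpolates g. The minimization from V_0 to V_1 is iterated along the code of
    a point; regularity makes the boundary values on the successive cells converge, and
    post-critical finiteness makes the limit independent of the code. *)

Lemma bigcup_tail_measure_le d (T : measurableType d) (R : realType)
    (lam : {finite_measure set T -> \bar R}) (F : nat -> set T) (e : R) :
  (forall i, measurable (F i)) -> 0 < e ->
  exists n, (lam (\bigcup_i F i `\` \bigcup_(i in `I_n) F i) <= e%:E)%E.
Proof.
move=> mF e0; pose G n := \bigcup_i F i `\` \bigcup_(i in `I_n) F i.
have mG n : measurable (G n).
  apply: measurableD; first exact: bigcup_measurable.
  by apply: bigcup_measurable => i _.
have G0 : \bigcap_n G n = set0.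
  rewrite -subset0 => x Gx; have [[i _ Fix] _] := Gx 0%N I.
  by have [_] := Gx i.+1 I; apply; exists i => //=.
have : lam \o G @ \oo --> (0 : \bar R)%E.
  rewrite -(measure0 lam) -G0; apply: nonincreasing_cvg_mu => //.
  - by rewrite -ge0_fin_numE//; exact: fin_num_measure.
  - by rewrite G0.
  - move=> m n mn; apply/subsetPset => x [Ux nx]; split => // -[i /= im Fix].
    by apply: nx; exists i => //=; exact: leq_trans mn.
move=> /fine_cvgP[_ /cvgrPdist_le /(_ _ e0)[n _ /(_ n (leqnn n))]] /=.
rewrite sub0r normrN => Hn; exists n; rewrite -/(G n).
rewrite -(@fineK _ (lam (G n))) ?fin_num_measure// lee_fin.
exact: le_trans (ler_norm _) Hn.
Qed.

(** Outer regularity is strengthened to open covers of a set and of its complement whose overlap has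
    small mass. This form is symmetric under complement, so the sets that have it form a
    sigma-algebra; it contains the open sets because they are F_sigma. *)
Lemma finite_measure_outer_regular (K : ptopologicalType) (R : realType)
    (lam : {finite_measure set (borel K) -> \bar R})
    (Fsigma_open : forall O : set K, open O ->
      exists F : nat -> set K, (forall n, closed (F n)) /\ O = \bigcup_n F n)
    (A : set (borel K)) (e : R) : measurable A -> 0 < e ->
  exists U : set K, [/\ open U, A `<=` U & (lam U <= lam A + e%:E)%E].
Proof.
have openM (O : set K) : open O -> measurable (O : set (borel K)).
  by move=> oO; exact: sub_sigma_algebra.
have closedM (O : set K) : closed O -> measurable (O : set (borel K)).
  move=> cO; rewrite -(setCK O); apply: measurableC.
  by apply: openM; rewrite openC.
pose P (A : set K) := forall e : R, 0 < e -> exists U V : set K,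
  [/\ open U, open V, A `<=` U, ~` A `<=` V & (lam (U `&` V) <= e%:E)%E].
have Popen O : open O -> P O.
  move=> oO e' e'0; have [F [cF OF]] := Fsigma_open _ oO.
  have mF n : measurable (F n : set (borel K)) by exact: closedM.
  have [n Hn] := bigcup_tail_measure_le lam mF e'0.
  exists O, (~` \bigcup_(i in `I_n) F i); split => //.
  - by rewrite openC; apply: closed_bigcup.
  - by apply: subsetC => x [i _ Fx]; rewrite OF; exists i.
  - by rewrite -setDE OF.
have Psigma : sigma_algebra setT P.
  split; first by apply: Popen; exact: open0.
  - move=> B PB e' e'0; have [U [V [oU oV BU BV UV]]] := PB _ e'0.
    by exists V, U; rewrite setTD setCK setIC.
  - move=> B PB e' e'0.
    have /choice[U] n : exists U : set K * set K, [/\ open U.1, open U.2,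
        B n `<=` U.1, ~` B n `<=` U.2 &
        (lam (U.1 `&` U.2) <= (e' / 2 / (2 ^ n.+1)%:R)%:E)%E].
      have e2 : 0 < e' / 2 / (2 ^ n.+1)%:R.
        by rewrite !divr_gt0// ltr0n expn_gt0.
      by have [U [V H]] := PB n _ e2; exists (U, V).
    move=> HU; have oU1 n : open (U n).1 by case: (HU n).
    have oU2 n : open (U n).2 by case: (HU n).
    have mU n : measurable ((U n).1 : set (borel K)) by exact: openM.
    have mU2 n : measurable ((U n).2 : set (borel K)) by exact: openM.
    have e2 : 0 < e' / 2 by rewrite divr_gt0.
    (* An infinite intersection of the second covers need not be open, so only finitely many are
       kept: half of [e'] pays for the tail of the union, the other half for the overlaps. *)
    have [n Hn] := bigcup_tail_measure_le lam mU e2.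
    exists (\bigcup_n (U n).1), (\bigcap_(i in `I_n) (U i).2); split.
    + exact: bigcup_open.
    + rewrite -closedC setC_bigcap; apply: closed_bigcup => // i _.
      by rewrite closedC.
    + by move=> x [i _ Bx]; exists i => //; case: (HU i) => _ _ + _ _; apply.
    + move=> x nBx i _; case: (HU i) => _ _ _ + _; apply => Bx.
      by apply: nBx; exists i.
    + set T1 := (_ `\` _) in Hn.
      have mcup : measurable (\bigcup_i ((U i).1 `&` (U i).2) : set (borel K)).
        by apply: bigcup_measurable => i _; exact: measurableI.
      have mT1 : measurable (T1 : set (borel K)).
        apply: measurableD; first exact: bigcup_measurable.
        by apply: bigcup_measurable.
      have sub : \bigcup_n0 (U n0).1 `&` \bigcap_(i in `I_n) (U i).2 `<=`
          T1 `|` \bigcup_i ((U i).1 `&` (U i).2).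
        move=> x [Ux Vx]; have [[i /= im Uix]|nx] :=
          pselect ((\bigcup_(i in `I_n) (U i).1) x).
          by right; exists i => //; split => //; exact: Vx.
        by left.
      apply: (@le_trans _ _ (lam (T1 `|` \bigcup_i ((U i).1 `&` (U i).2)))).
        apply: (le_measure lam) => //; rewrite inE; last exact: measurableU.
        apply: measurableI; first exact: bigcup_measurable.
        by apply: bigcap_measurableType => i _.
      apply: (le_trans (measureU2 _ _ _)) => //.
      rewrite [in leRHS](splitr e') EFinD leeD//.
      apply: (@le_trans _ _ (\sum_(0 <= i <oo) lam ((U i).1 `&` (U i).2))%E).
        apply: measure_sigma_subadditive => // i.
        exact: measurableI.
      apply: le_trans (epsilon_trick0 _ (ltW e2)).
      by apply: lee_nneseries => // i _; case: (HU i).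
move=> mA e0; have PA : P A by move: A mA; apply: smallest_sub.
have [U [V [oU oV AU AV UV]]] := PA _ e0.
exists U; split => //.
apply: (@le_trans _ _ (lam (A `|` (U `&` V)))).
  apply: le_measure; rewrite ?inE//; first exact: openM.
    by apply: measurableU => //; apply: measurableI; exact: openM.
  move=> x Ux; have [Ax|nAx] := pselect (A x); [by left|right; split => //].
  exact: AV.
have mUV : measurable (U `&` V : set (borel K)) by apply: measurableI; exact: openM.
by apply: (le_trans (measureU2 _ _ _)) => //; rewrite leeD2l.
Qed.

Section Differentiation.
Context d (T : measurableType d) (R : realType) (N : nat).
Variable code : T -> nat -> 'I_N.

(** Cylinders of one length partition the space, which overlapping cells do not. *)
Definition cylinder (w : seq 'I_N) : set T :=
  [set x | mkseq (code x) (size w) = w].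

Lemma mem_cylinder x n : cylinder (mkseq (code x) n) x.
Proof. by rewrite /cylinder /= size_mkseq. Qed.

Lemma take_mkseq (f : nat -> 'I_N) k n : (k <= n)%N ->
  take k (mkseq f n) = mkseq f k.
Proof. by move=> kn; rewrite /mkseq -map_take take_iota (minn_idPl kn). Qed.

Lemma trivIset_cylinder n (D : set (n.-tuple 'I_N)) :
  trivIset D (fun w : n.-tuple 'I_N => cylinder w).
Proof.
apply/trivIsetP => w v _ _ wv; apply/seteqP; split => // x [].
rewrite /cylinder /= !size_tuple => wx vx.
by move/eqP: wv; case; apply/val_inj; rewrite /= -wx -vx.
Qed.

Hypothesis measurable_cylinder : forall w, measurable (cylinder w).

(** Outer regularity without a topology on [T]: a set that contains all late cylinders around each
    of its points plays the part of an open set. *)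
Definition cylinder_regular := forall (lam : {finite_measure set T -> \bar R})
    (A : set T) (e : R), measurable A -> 0 < e ->
  exists U : set T, [/\ measurable U,
    forall x, U x -> exists n0, forall n, (n0 <= n)%N ->
      cylinder (mkseq (code x) n) `<=` U,
    A `<=` U & (lam U <= lam A + e%:E)%E].

Hypothesis regular : cylinder_regular.

(* Stopping at the first admissible prefix gives disjoint cylinders that cover
   [A] and stay inside an open set that is barely larger than [A]. *)
Lemma le_measure_cylinders (mu lam : {finite_measure set T -> \bar R})
    (a b : R) (A : set T) : measurable A -> 0 <= a -> 0 <= b ->
  (forall x, A x -> forall n, exists2 m, (n <= m)%N &
     (a%:E * mu (cylinder (mkseq (code x) m)) <=
      b%:E * lam (cylinder (mkseq (code x) m)))%E) ->
  (a%:E * mu A <= b%:E * lam A)%E.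
Proof.
move=> mA a0 b0 HA; apply/lee_addgt0Pr => e e0.
(* Dividing by [b + 1] instead of [b] admits [b = 0]. *)
have b1 : 0 < b + 1 by rewrite ltr_wpDl.
have [U [mU oU AU lU]] := regular lam mA (divr_gt0 e0 b1).
pose W (w : seq 'I_N) := cylinder w `<=` U /\
   (a%:E * mu (cylinder w) <= b%:E * lam (cylinder w))%E.
pose D n : set (n.-tuple 'I_N) :=
  [set w | W w /\ forall k, (k < n)%N -> ~ W (take k w)].
pose M n := \bigcup_(w in D n) cylinder w.
have finD n : finite_set (D n) by exact: finite_finset.
have mM n : measurable (M n) by apply: fin_bigcup_measurable.
have ME n x : M n x <-> (W (mkseq (code x) n) /\
    forall k, (k < n)%N -> ~ W (mkseq (code x) k)).
  split.
    move=> [w [Ww Hw]]; rewrite /cylinder /= size_tuple => wx.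
    rewrite wx; split => // k kn.
    by rewrite -(take_mkseq (code x) (ltnW kn)) wx; exact: Hw.
  move=> [Wx Hx]; exists [tuple of mkseq (code x) n]; last first.
    exact: mem_cylinder.
  by split => //= k kn; rewrite take_mkseq 1?ltnW//; exact: Hx.
have tM : trivIset setT M.
  apply/trivIsetP => i j _ _ ij; apply/seteqP; split => // x [].
  move=> /ME[Wi Hi] /ME[Wj Hj].
  by move: ij; rewrite neq_ltn => /orP[/Hj|/Hi].
have AM : A `<=` \bigcup_n M n.
  move=> x Ax; have [n0 Hn0] := oU x (AU x Ax).
  have [m n0m Hm] := HA x Ax n0.
  have exW : exists n, `[< W (mkseq (code x) n) >].
    by exists m; apply/asboolP; split => //; exact: Hn0.
  case: (ex_minnP exW) => n /asboolP Wn Hn; exists n => //; apply/ME.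
  by split => // k kn Wk; have := Hn k (asboolT Wk); rewrite leqNgt kn.
have leM n : (a%:E * mu (M n) <= b%:E * lam (M n))%E.
  have EM (m : {finite_measure set T -> \bar R}) :
      m (M n) = (\sum_(w \in D n) m (cylinder w))%E.
    by apply: measure_fin_bigcup; [exact: finD|exact: trivIset_cylinder|].
  rewrite !EM !ge0_mule_fsumr//.
  by apply: lee_fsum => [|w [[]]//]; exact: finD.
have mUM : measurable (\bigcup_n M n) by exact: bigcup_measurable.
apply: (@le_trans _ _ (a%:E * mu (\bigcup_n M n))%E).
  by apply: lee_wpmul2l; rewrite ?lee_fin// le_measure// inE.
apply: (@le_trans _ _ (b%:E * lam (\bigcup_n M n))%E).
  rewrite !measure_semi_bigcup// -!nneseriesZl//.
  by apply: lee_nneseries => [n _|n _]; [rewrite mule_ge0//|exact: leM].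
apply: (@le_trans _ _ (b%:E * lam U)%E).
  apply: lee_wpmul2l; rewrite ?lee_fin// le_measure ?inE// => x [n _ [w [[wU _] _]]].
  exact: wU.
apply: (le_trans (lee_wpmul2l _ lU)); first by rewrite lee_fin.
have eb0 : 0 <= e / (b + 1) by rewrite divr_ge0 ?ltW.
rewrite ge0_muleDr//; apply: leeD => //; rewrite -EFinM lee_fin.
by rewrite mulrCA ler_piMr ?ltW// ltr_pdivrMr// mul1r ltrDl.
Qed.

(** There are only countably many words, so the null cylinders together form a null set. Quotients
    of masses thus have nonzero denominators almost everywhere. *)
Lemma negligible_cylinder0 (mu : {finite_measure set T -> \bar R}) :
  {ae mu, forall x, forall n, mu (cylinder (mkseq (code x) n)) != 0%E}.
Proof.
pose Z n := \bigcup_(w in [set w : n.-tuple 'I_N | mu (cylinder w) = 0%E])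
  cylinder w.
have mZ n : measurable (Z n) by apply: fin_bigcup_measurable.
exists (\bigcup_n Z n); split; first exact: bigcup_measurable.
  apply/eqP; rewrite eq_le measure_ge0 andbT.
  apply: (le_trans (measure_sigma_subadditive mu mZ _ (@subset_refl _ _))).
    exact: bigcup_measurable.
  rewrite eseries0// => n _ _; apply/eqP; rewrite eq_le measure_ge0 andbT.
  change (mu (Z n) <= 0)%E.
  have finZ : finite_set [set w : n.-tuple 'I_N | mu (cylinder w) = 0%E].
    exact: finite_finset.
  have -> : mu (Z n) = (\sum_(w \in [set w : n.-tuple 'I_N |
      mu (cylinder w) = 0%E]) mu (cylinder w))%E.
    by apply: measure_fin_bigcup => //; exact: trivIset_cylinder.
  by apply: fsume_le0 => w /= ->.
move=> x /= /existsNP[n /negP/negPn/eqP Hn]; exists n => //.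
by exists [tuple of mkseq (code x) n] => //=; exact: mem_cylinder.
Qed.

Lemma measurable_cylinder_io (Q : seq 'I_N -> Prop) :
  measurable [set x | forall n, exists2 m, (n <= m)%N & Q (mkseq (code x) m)].
Proof.
pose Z m := \bigcup_(w in [set w : m.-tuple 'I_N | Q w]) cylinder w.
rewrite [X in measurable X](_ : _ = \bigcap_n \bigcup_(m in [set m | (n <= m)%N]) Z m).
  apply: bigcapT_measurable => n; apply: bigcup_measurable => m _.
  exact: fin_bigcup_measurable.
apply/seteqP; split => x /= H n.
  move=> _; have [m nm Qm] := H n; exists m => //.
  by exists [tuple of mkseq (code x) m] => //; exact: mem_cylinder.
have [m /= nm [w Qw]] := H n I.
by rewrite /cylinder /= size_tuple => Hw; exists m => //; rewrite Hw.
Qed.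

(** Where the density is at most [a] while the quotients are infinitely often at least [b > a], the
    covering inequality gives [b * mu <= lam <= a * mu] on that set, which is therefore null; the
    opposite deviation is symmetric. Countably many rational pairs suffice for convergence. *)
Lemma cvg_cylinder_ratio (lam mu : {finite_measure set T -> \bar R}) :
  lam `<< mu ->
  {ae mu, forall x, fine (lam (cylinder (mkseq (code x) n))) /
                    fine (mu (cylinder (mkseq (code x) n)))
     @[n --> \oo] --> fine (Radon_Nikodym (charge_of_finite_measure lam) mu x)}.
Proof.
move=> lammu; set phi := Radon_Nikodym _ _.
have iphi : mu.-integrable setT phi by exact: Radon_Nikodym_integrable.
have fphi x : phi x \is a fin_num by exact: Radon_Nikodym_fin_num.
have lamE A : measurable A -> lam A = (\int[mu]_(x in A) phi x)%E.
  by move=> mA; rewrite -Radon_Nikodym_integral.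
have mphi : measurable_fun setT phi by exact: measurable_int iphi.
have mle (a : R) : measurable [set x | (phi x <= a%:E)%E].
  by rewrite -[X in measurable X]setTI; exact: emeasurable_fun_infty_c.
have mge (a : R) : measurable [set x | (a%:E <= phi x)%E].
  by rewrite -[X in measurable X]setTI; exact: emeasurable_fun_c_infty.
pose cyl x n := cylinder (mkseq (code x) n).
pose E1 (a b : R) := [set x | (phi x <= a%:E)%E] `&`
  [set x | forall n, exists2 m, (n <= m)%N &
     (b%:E * mu (cyl x m) <= lam (cyl x m))%E].
pose E2 (a b : R) := [set x | (b%:E <= phi x)%E] `&`
  [set x | forall n, exists2 m, (n <= m)%N &
     (lam (cyl x m) <= a%:E * mu (cyl x m))%E].
have mE1 a b : measurable (E1 a b).
  apply: measurableI; first exact: mle.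
  exact: (measurable_cylinder_io
    (fun w => (b%:E * mu (cylinder w) <= lam (cylinder w))%E)).
have mE2 a b : measurable (E2 a b).
  apply: measurableI; first exact: mge.
  exact: (measurable_cylinder_io
    (fun w => (lam (cylinder w) <= a%:E * mu (cylinder w))%E)).
have null (A : set T) (a b : R) : measurable A -> a < b ->
    (b%:E * mu A <= a%:E * mu A)%E -> mu A = 0%E.
  move=> mA ab; have /fineK <- : mu A \is a fin_num by exact: fin_num_measure.
  rewrite -!EFinM lee_fin => H; congr (_%:E); apply/eqP; rewrite eq_le.
  rewrite fine_ge0// andbT -(@pmulr_rle0 _ (b - a)) ?subr_gt0//.
  by rewrite mulrBl subr_le0.
have icst (A : set T) (c : R) : measurable A -> mu.-integrable A (cst c%:E).
  move=> mA; exact: finite_measure_integrable_cst.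
have nE1 (a b : R) : 0 <= a -> a < b -> mu (E1 a b) = 0%E.
  move=> a0 ab; apply: (null _ a b) => //.
  apply: (@le_trans _ _ (lam (E1 a b))).
    rewrite -[leRHS]mul1e; apply: le_measure_cylinders => //.
      exact: le_trans (ltW ab).
    by move=> x [_ Hx] n; have [m nm Hm] := Hx n; exists m => //; rewrite mul1e.
  rewrite lamE// -integral_cst//; apply: le_integral => //.
  - exact: integrableS iphi.
  - exact: icst.
  - by move=> x; rewrite inE => -[].
have nE2 (a b : R) : 0 <= a -> a < b -> mu (E2 a b) = 0%E.
  move=> a0 ab; apply: (null _ a b) => //.
  apply: (@le_trans _ _ (lam (E2 a b))); last first.
    rewrite -[leLHS]mul1e; apply: le_measure_cylinders => //.
    by move=> x [_ Hx] n; have [m nm Hm] := Hx n; exists m => //; rewrite mul1e.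
  rewrite lamE// -integral_cst//; apply: le_integral => //.
  - exact: icst.
  - exact: integrableS iphi.
  - by move=> x; rewrite inE => -[].
(* The density is that of a charge and may be negative somewhere, while [nE1] and [nE2] require
   [0 <= a]; negative values are excluded separately. *)
have nE0 (a : R) : a < 0 -> mu [set x | (phi x <= a%:E)%E] = 0%E.
  move=> a0; have mA := mle a.
  apply: (null _ a 0) => //.
  rewrite mul0e; apply: (@le_trans _ _ (lam [set x | (phi x <= a%:E)%E])) => //.
  rewrite lamE// -integral_cst//; apply: le_integral => //.
  - exact: integrableS iphi.
  - exact: icst.
  - by move=> x; rewrite inE.
(* Enumerating the pairs of rationals makes the almost sure statements simultaneous. *)
have aeQ (P : rat -> rat -> T -> Prop) : (forall p q, {ae mu, forall x, P p q x}) ->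
    {ae mu, forall x, forall p q, P p q x}.
  move=> H.
  have HH n : {ae mu, forall x, forall r, unpickle n = Some r -> P r.1 r.2 x}.
    case E : (unpickle n) => [r|]; last exact: aeW.
    by apply: filterS (H r.1 r.2) => x Hx _ [<-].
  apply: filterS (ae_foralln HH) => x Hx p q.
  by apply: (Hx (pickle (p, q)) (p, q)); rewrite pickleK.
have ae1 : {ae mu, forall x, forall p q : rat,
    [/\ p < 0 -> ~ (phi x <= (ratr p)%:E)%E,
     0 <= p -> p < q -> ~ E1 (ratr p) (ratr q) x &
     0 <= p -> p < q -> ~ E2 (ratr p) (ratr q) x]}.
  apply: aeQ => p q.
  have [p0|p0] := ltP p 0.
    have nn : mu.-negligible [set x | (phi x <= (ratr p)%:E)%E].
      exists [set x | (phi x <= (ratr p)%:E)%E]; split => //.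
      by apply: nE0; rewrite ltrq0.
    by apply: negligibleS nn => x /= Hx; apply: contrapT => nx; apply: Hx; split.
  have [pq|qp] := ltP p q; last first.
    by apply: aeW => x; split.
  have n1 : mu.-negligible (E1 (ratr p) (ratr q)).
    by exists (E1 (ratr p) (ratr q)); split => //; apply: nE1; rewrite ?ler0q ?ltr_rat.
  have n2 : mu.-negligible (E2 (ratr p) (ratr q)).
    by exists (E2 (ratr p) (ratr q)); split => //; apply: nE2; rewrite ?ler0q ?ltr_rat.
  apply: negligibleS (negligibleU n1 n2) => x /= Hx; apply: contrapT => /not_orP[x1 x2].
  by apply: Hx; split.
apply: filterS2 (negligible_cylinder0 mu) ae1 => x cx0 Hx.
have mu0 n : 0 < fine (mu (cyl x n)).
  rewrite lt_neqAle fine_ge0// andbT eq_sym; apply/negP => /eqP H.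
  have /negP := cx0 n; apply; apply/eqP.
  by rewrite -(@fineK _ (mu _)) ?fin_num_measure// -/(cyl x n) H.
have ratio_ge0 n : 0 <= fine (lam (cyl x n)) / fine (mu (cyl x n)).
  by rewrite divr_ge0 ?fine_ge0.
have muE m : mu (cyl x m) = (fine (mu (cyl x m)))%:E by rewrite fineK//;
apply: fin_num_measure; exact: measurable_cylinder.
have lamE' m : lam (cyl x m) = (fine (lam (cyl x m)))%:E by rewrite fineK//;
apply: fin_num_measure; exact: measurable_cylinder.
have phi0 : 0 <= fine (phi x).
  rewrite leNgt; apply/negP => /rat_in_itvoo[p]; rewrite in_itv /= => /andP[xp p0].
  have [+ _ _] := Hx p 0; apply; first by rewrite -(ltrq0 R).
  by rewrite -[phi x]fineK// lee_fin ltW.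
apply/cvgrPdist_lt => e e0.
have [q] := @rat_in_itvoo _ (fine (phi x)) (fine (phi x) + e) (ltr_pwDr e0 (lexx _)).
rewrite in_itv /= => /andP[xq qe].
have [p] := rat_in_itvoo xq; rewrite in_itv /= => /andP[xp pq].
have p0 : 0 <= p by rewrite -(ler0q R) ltW// (le_lt_trans phi0).
have [_ /(_ p0) + _] := Hx p q; rewrite -(ltr_rat R) => /(_ pq) HE1.
have [n1 Hn1] : exists n1, forall m, (n1 <= m)%N ->
    fine (lam (cyl x m)) / fine (mu (cyl x m)) < ratr q.
  apply: contrapT => Hn; apply: HE1; split => /=.
    by rewrite -[phi x]fineK// lee_fin ltW.
  move=> n; apply: contrapT => Hm; apply: Hn; exists n => m nm.
  rewrite ltNge; apply/negP => Hq; apply: Hm; exists m => //.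
  rewrite muE lamE'.
  by rewrite -EFinM lee_fin -ler_pdivlMr.
have [n2 Hn2] : exists n2, forall m, (n2 <= m)%N ->
    fine (phi x) - e < fine (lam (cyl x m)) / fine (mu (cyl x m)).
  have xe : fine (phi x) - e < fine (phi x) by rewrite ltrBlDr ltrDl.
  have [q'] := rat_in_itvoo xe; rewrite in_itv /= => /andP[eq' q'x].
  (* The quotients are nonnegative, so a negative level needs no argument. *)
  have [q'0|q'0] := ltP q' 0.
    exists 0%N => m _; apply: lt_le_trans (ratio_ge0 m).
    by apply: (lt_trans eq'); rewrite ltrq0.
  have [p'] := rat_in_itvoo eq'; rewrite in_itv /= => /andP[ep' pq'].
  have [p'0|p'0] := ltP p' 0.
    exists 0%N => m _; apply: lt_le_trans (ratio_ge0 m).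
    by apply: (lt_trans ep'); rewrite ltrq0.
  have [_ _ /(_ p'0)] := Hx p' q'; rewrite -(ltr_rat R) => /(_ pq') HE2.
  apply: contrapT => Hn; apply: HE2; split => /=.
    by rewrite -[phi x]fineK// lee_fin ltW.
  move=> n; apply: contrapT => Hm; apply: Hn; exists n => m nm.
  apply: (lt_trans ep'); rewrite ltNge; apply/negP => Hq; apply: Hm; exists m => //.
  rewrite muE lamE'.
  by rewrite -EFinM lee_fin -ler_pdivrMr.
exists (maxn n1 n2) => // m /=; rewrite geq_max => /andP[n1m n2m].
rewrite ltr_distlC; apply/andP; split; first exact: Hn2.
exact: lt_trans (Hn1 _ n1m) _.
Qed.

End Differentiation.

(** * Sums over words and a discriminant inequality *)

Lemma big_tupleS (V : nmodType) N m (F : seq 'I_N -> V) :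
  \sum_(w : m.+1.-tuple 'I_N) F w = \sum_(i < N) \sum_(w : m.-tuple 'I_N) F (i :: w).
Proof.
rewrite pair_bigA /=.
rewrite (reindex (fun p : 'I_N * m.-tuple 'I_N => cons_tuple p.1 p.2))//=.
exists (fun w => (thead w, [tuple of behead w])) => [[i w] _|w _] /=.
  by congr (_, _); apply/val_inj.
by rewrite [RHS]tuple_eta.
Qed.

Lemma big_tuple0 (V : nmodType) N (F : seq 'I_N -> V) :
  \sum_(w : 0.-tuple 'I_N) F w = F [::].
Proof.
rewrite (bigD1 [tuple])//= big1 ?addr0// => w.
by move=> /eqP; case; rewrite tuple0; exact: val_inj.
Qed.

Lemma big_tuple_cat (V : nmodType) N m n (F : seq 'I_N -> V) :
  \sum_(w : (m + n).-tuple 'I_N) F w =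
  \sum_(w : m.-tuple 'I_N) \sum_(v : n.-tuple 'I_N) F (w ++ v).
Proof.
elim: m F => [|m IH] F.
  by rewrite (big_tuple0 (fun w => \sum_(v : n.-tuple 'I_N) F (w ++ v))).
rewrite addSn big_tupleS.
rewrite (big_tupleS _ (fun w => \sum_(v : n.-tuple 'I_N) F (w ++ v))).
by apply: eq_bigr => i _; rewrite (IH (fun w => F (i :: w))).
Qed.

(** Cauchy-Schwarz for forms that may be degenerate; it serves both for E and for the difference E -
    E_n. *)
Lemma discr_le0 (R : realType) (a b c : R) :
  (forall t, 0 <= a + 2 * b * t + c * t ^+ 2) -> 0 <= c -> b ^+ 2 <= a * c.
Proof.
move=> H c0; have [c00|cn0] := eqVneq c 0.
  have [->|bn0] := eqVneq b 0; first by rewrite c00 expr0n /= mulr0.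
  (* This [t] gives the expression the value -1. *)
  have := H (- (a + 1) / (2 * b)); rewrite c00 mul0r addr0 mulrA mulrAC divff ?mulf_neq0//.
  by rewrite mul1r; lra.
have cp : 0 < c by rewrite lt_def cn0.
have := H (- b / c); rewrite -(@pmulr_lge0 _ c)//.
have -> : (a + 2 * b * (- b / c) + c * (- b / c) ^+ 2) * c = a * c - b ^+ 2.
  by field.
by rewrite subr_ge0.
Qed.

(** * Energy forms *)

Section DifferenceForms.
Variables (R : realType) (K : choiceType).
Implicit Types (s : seq (R * K * K)) (u v w f phi : K -> R).

(* A triple (c, x, y) is an edge between [x] and [y] with conductance [c]. *)
Definition dform s u v : R :=
  \sum_(t <- s) t.1.1 * ((u t.1.2 - u t.2) * (v t.1.2 - v t.2)).

Definition nonneg_form s := forall t, t \in s -> 0 <= t.1.1.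

Lemma dformC s u v : dform s u v = dform s v u.
Proof. by apply: eq_bigr => t _; rewrite [X in _ * X]mulrC. Qed.

Lemma dformDl s a u v w :
  dform s (fun x => a * u x + v x) w = a * dform s u w + dform s v w.
Proof.
rewrite /dform big_distrr -big_split /=; apply: eq_bigr => t _; ring.
Qed.

Lemma dform_ge0 s u v : nonneg_form s ->
  (forall x y, 0 <= (u x - u y) * (v x - v y)) -> 0 <= dform s u v.
Proof.
move=> s0 uv; rewrite /dform big_seq; apply: sumr_ge0 => t ts.
by rewrite mulr_ge0// s0.
Qed.

Lemma le_dform s u v : nonneg_form s ->
  (forall x y, `|u x - u y| <= `|v x - v y|) -> dform s u u <= dform s v v.
Proof.
move=> s0 uv; rewrite /dform !big_seq; apply: ler_sum => t ts.
by rewrite ler_wpM2l ?s0// -!expr2 -ler_sqrt ?sqr_ge0// !sqrtr_sqr.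
Qed.

(** From f(x) phi(x) - f(y) phi(y) = f(x) (phi(x) - phi(y)) + phi(y) (f(x) - f(y)). It makes the
    domain an algebra, so that the products in the identity for energy measures have finite
    energy. *)
Lemma dform_mul s f phi (a b : R) : nonneg_form s ->
  (forall x, `|f x| <= a) -> (forall x, `|phi x| <= b) ->
  dform s (f \* phi) (f \* phi) <=
    2 * a ^+ 2 * dform s phi phi + 2 * b ^+ 2 * dform s f f.
Proof.
move=> s0 fa pb; rewrite /dform !big_distrr -big_split !big_seq /=.
apply: ler_sum => t ts; have t0 := s0 t ts.
set x := t.1.2; set y := t.2.
have sq z (c : R) : `|z| <= c -> z ^+ 2 <= c ^+ 2.
  by move=> zc; rewrite -real_normK ?num_real// ler_sqr ?nnegrE// (le_trans _ zc).
apply: (@le_trans _ _ (t.1.1 * (2 * (f x ^+ 2 * (phi x - phi y) ^+ 2) +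
    2 * (phi y ^+ 2 * (f x - f y) ^+ 2)))).
  rewrite ler_wpM2l//.
  set p := f x * (phi x - phi y); set q := phi y * (f x - f y).
  have -> : f x * phi x - f y * phi y = p + q by rewrite /p /q; ring.
  have := sqr_ge0 (p - q); rewrite -!exprMn -/p -/q; nra.
rewrite !expr2 -!mulrA mulrDr mulrCA lerD//; last first.
  rewrite [X in _ <= X](_ : _ = t.1.1 * (2 * (b * b * ((f x - f y) * (f x - f y)))));
    last by ring.
  by rewrite !ler_wpM2l// mulrA ler_wpM2r -?expr2 ?sqr_ge0// sq.
rewrite [X in _ <= X](_ : _ = 2 * (t.1.1 * (a * a * ((phi x - phi y) * (phi x - phi y)))));
  last by ring.
by rewrite !ler_wpM2l// mulrA ler_wpM2r -?expr2 ?sqr_ge0// sq.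
Qed.

(* The discrete analogue of the integral of [phi] against the energy measure of [f]. *)
Definition dcharge s f phi : R :=
  2 * dform s (f \* phi) f - dform s phi (f \* f).

(** The mixed terms cancel edge by edge and leave the weight (f(x) - f(y))^2. With nonnegative
    conductances the charge is thus monotone in [phi], which the defining difference does not
    show. *)
Lemma dchargeE s f phi : dcharge s f phi =
  \sum_(t <- s) t.1.1 * ((f t.1.2 - f t.2) ^+ 2 * (phi t.1.2 + phi t.2)).
Proof.
rewrite /dcharge /dform big_distrr -sumrB /=; apply: eq_bigr => t _.
by ring.
Qed.

Lemma dcharge_le s f phi : nonneg_form s -> (forall x, phi x <= 1) ->
  dcharge s f phi <= 2 * dform s f f.
Proof.
move=> s0 p1; rewrite dchargeE big_distrr !big_seq /=; apply: ler_sum => t ts.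
rewrite [leRHS]mulrCA ler_wpM2l ?s0// -expr2 [leRHS]mulrC ler_wpM2l ?sqr_ge0//.
by have := p1 t.1.2; have := p1 t.2; lra.
Qed.

Lemma dcharge1 s f : dcharge s f (fun=> 1) = 2 * dform s f f.
Proof.
rewrite dchargeE big_distrr /=; apply: eq_bigr => t _.
by ring.
Qed.

Lemma dcharge0 s f : dcharge s f (fun=> 0) = 0.
Proof. by rewrite dchargeE big1// => t _; rewrite addr0 !mulr0. Qed.

End DifferenceForms.

Section Energies.
Variables (R : realType) (K : ptopologicalType) (N : nat) (L : selfSimilar K N).
Variable HS : harmonicStructure R L.
Hypothesis pcf : post_critically_finite L.

Local Notation D := (hD HS).
Local Notation r := (hr HS).
Local Notation E0 := (energy0 L D).
Local Notation Em := (energym L D r).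
Local Notation "u \on w" := (u \o psi_word L w) (at level 40).

Definition rw (w : seq 'I_N) : R := \prod_(i <- w) r i.

Lemma rw_gt0 w : 0 < rw w.
Proof. by apply: prodr_gt0 => i _; exact: hr_gt0. Qed.

Lemma rw_cat w v : rw (w ++ v) = rw w * rw v.
Proof. by rewrite /rw big_cat. Qed.

Lemma rw_cons i w : rw (i :: w) = r i * rw w.
Proof. by rewrite /rw big_cons. Qed.

Lemma psi_word_cat w v x : psi_word L (w ++ v) x = psi_word L w (psi_word L v x).
Proof. by elim: w => //= i w ->. Qed.

Lemma finite_V0 : finite_set (V0 L).
Proof. exact: finite_image. Qed.

Let sV : seq K := finmap.enum_fset (fset_set (V0 L)).

Let mem_sV q : (q \in sV) = (q \in V0 L).
Proof. exact: in_fset_set finite_V0 q. Qed.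

Let fsum_V0 (F : K -> R) : \sum_(q \in V0 L) F q = \sum_(q <- sV) F q.
Proof. by rewrite fsbig_finite//; exact: finite_V0. Qed.

Lemma laplacian1 q : V0 L q -> \sum_(p <- sV) D q p = 0.
Proof.
move=> Vq; have [_ H] := hD_ker HS (fun=> 1).
have /H/(_ q Vq) : exists c : R, forall q, V0 L q -> 1 = c by exists 1.
rewrite /laplacian fsum_V0 => H0; rewrite -[RHS]H0.
by apply: eq_bigr => p _; rewrite mulr1.
Qed.

(** Rows and columns of D sum to zero, so the products u(p) v(p) can be added for free; the factor
    1/2 is there because each unordered pair occurs twice. *)
Lemma energy0E u v : E0 u v = \sum_(p <- sV) \sum_(q <- sV)
  (2^-1 * D p q) * ((u p - u q) * (v p - v q)).
Proof.
have -> : E0 u v = - \sum_(p <- sV) \sum_(q <- sV) D p q * (u q * v p).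
  rewrite /energy0 fsum_V0 /= -sumrN; apply: eq_bigr => p _.
  rewrite /laplacian fsum_V0 /= mulNr big_distrl /=.
  by congr (- _); apply: eq_bigr => q _; rewrite mulrA.
have sw : \sum_(p <- sV) \sum_(q <- sV) D p q * (u p * v q) =
    \sum_(p <- sV) \sum_(q <- sV) D p q * (u q * v p).
  rewrite exchange_big /= !big_seq; apply: eq_bigr => p; rewrite mem_sV inE => Vp.
  rewrite !big_seq; apply: eq_bigr => q; rewrite mem_sV inE => Vq.
  by rewrite hD_sym.
have z1 : \sum_(p <- sV) \sum_(q <- sV) D p q * (u p * v p) = 0.
  rewrite big_seq big1// => p; rewrite mem_sV inE => Vp.
  by rewrite -big_distrl /= laplacian1// mul0r.
have z2 : \sum_(p <- sV) \sum_(q <- sV) D p q * (u q * v q) = 0.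
  rewrite exchange_big /= big_seq big1// => p; rewrite mem_sV inE => Vp.
  rewrite -big_distrl /= big_seq.
  rewrite (eq_bigr (fun q => D p q)) -?big_seq ?laplacian1 ?mul0r// => q.
  by rewrite mem_sV inE => Vq; rewrite hD_sym.
transitivity (2^-1 * (\sum_(p <- sV) \sum_(q <- sV) D p q * (u p * v p) +
    \sum_(p <- sV) \sum_(q <- sV) D p q * (u q * v q) -
    \sum_(p <- sV) \sum_(q <- sV) D p q * (u p * v q) -
    \sum_(p <- sV) \sum_(q <- sV) D p q * (u q * v p))).
  by rewrite sw z1 z2; field.
rewrite -big_split -!sumrB big_distrr /=; apply: eq_bigr => p _.
rewrite -big_split -!sumrB big_distrr /=; apply: eq_bigr => q _.
by ring.
Qed.

(** The diagonal entries of D are not conductances; they multiply u(p) - u(p) and are replaced by 0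
    to make the form nonnegative. *)
Let s0 : seq (R * K * K) :=
  [seq (if p == q then 0 else 2^-1 * D p q, p, q) | p <- sV, q <- sV].

Let nonneg_s0 : nonneg_form s0.
Proof.
move=> t /allpairsP[[p q] /= [+ + ->]]; rewrite !mem_sV !inE => Vp Vq /=.
case: eqP => //= pq; rewrite mulr_ge0//; exact: hD_offdiag.
Qed.

Lemma energy0_dform u v : E0 u v = dform s0 u v.
Proof.
rewrite energy0E /dform /s0 big_allpairs_dep /=; apply: eq_bigr => p _.
by apply: eq_bigr => q _; case: eqP => [->|//]; rewrite subrr !mul0r mulr0.
Qed.

Lemma eq_energy0 u u' v v' : (forall q, V0 L q -> u q = u' q) ->
  (forall q, V0 L q -> v q = v' q) -> E0 u v = E0 u' v'.
Proof.
move=> uu vv; rewrite !energy0E !big_seq; apply: eq_bigr => p.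
rewrite mem_sV inE => Vp; rewrite !big_seq; apply: eq_bigr => q.
by rewrite mem_sV inE => Vq; rewrite !uu// !vv.
Qed.

Lemma energym0 u v : Em 0 u v = E0 u v.
Proof.
rewrite /energym (big_tuple0 (fun w => (rw w)^-1 * E0 (u \on w) (v \on w))).
by rewrite /rw big_nil invr1 mul1r.
Qed.

Lemma energym_cat m n u v : Em (m + n) u v =
  \sum_(w : m.-tuple 'I_N) (rw w)^-1 * Em n (u \on w) (v \on w).
Proof.
rewrite /energym (big_tuple_cat _ _ (fun w => (rw w)^-1 * E0 (u \on w) (v \on w))).
apply: eq_bigr => w _; rewrite big_distrr /=; apply: eq_bigr => t _.
rewrite rw_cat invfM mulrA; congr (_ * E0 _ _); apply/funext => x /=;
by rewrite psi_word_cat.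
Qed.

Lemma energymS m u v : Em m.+1 u v =
  \sum_(i < N) (r i)^-1 * Em m (u \o psi L i) (v \o psi L i).
Proof.
rewrite -add1n energym_cat.
rewrite (big_tupleS _ (fun w => (rw w)^-1 * Em m (u \on w) (v \on w))).
apply: eq_bigr => i _.
rewrite (big_tuple0 (fun w => (rw (i :: w))^-1 * Em m (u \on (i :: w)) (v \on (i :: w)))).
by rewrite /rw big_seq1.
Qed.

(** Bilinearity, symmetry, positivity and contraction at every level are inherited from difference
    forms. The edges of level m + 1 are the images under psi_i of those of level m, with
    conductances divided by r_i. *)
Lemma energym_dform m : exists2 s, nonneg_form s &
  forall u v, Em m u v = dform s u v.
Proof.
elim: m => [|m [s s_ge0 Hs]].
  by exists s0 => // u v; rewrite energym0 energy0_dform.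
exists [seq ((r i)^-1 * t.1.1, psi L i t.1.2, psi L i t.2) |
    i <- enum 'I_N, t <- s].
  move=> t /allpairsP[[i t'] /= [_ ts ->]] /=.
  by rewrite mulr_ge0 ?s_ge0// invr_ge0 ltW// hr_gt0.
move=> u v; rewrite energymS /dform big_allpairs_dep /= big_enum /=.
apply: eq_bigr => i _; rewrite Hs /dform big_distrr /=; apply: eq_bigr => t _.
exact: mulrA.
Qed.

Lemma energym_ge0 m u : 0 <= Em m u u.
Proof.
have [s s_ge0 ->] := energym_dform m.
by apply: dform_ge0 => // x y; rewrite -expr2 sqr_ge0.
Qed.

Lemma energymC m u v : Em m u v = Em m v u.
Proof. by have [s _ H] := energym_dform m; rewrite !H dformC. Qed.

Lemma energymDl m a u v w :
  Em m (fun x => a * u x + v x) w = a * Em m u w + Em m v w.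
Proof. by have [s _ H] := energym_dform m; rewrite !H dformDl. Qed.

Lemma energym_sq m a u v : Em m (fun x => a * u x + v x) (fun x => a * u x + v x) =
  a ^+ 2 * Em m u u + 2 * a * Em m u v + Em m v v.
Proof.
rewrite energymDl (energymC m u) (energymC m v) !energymDl (energymC m v u).
by ring.
Qed.

Lemma energy0_le_energy1 u : E0 u u <= Em 1 u u.
Proof.
rewrite (energy0_inf HS); apply: ge_inf; last by exists u.
by exists 0 => _ [v _ <-]; exact: energym_ge0.
Qed.

(** Refining a cell by one level cannot lower its energy, as E_0 is the infimum of E_1 over
    extensions. *)
Lemma energym_homo u : {homo (fun m => Em m u u) : m n / (m <= n)%N >-> m <= n}.
Proof.
apply: homo_leq => [//|x y z|m]; first exact: le_trans.
rewrite -[m.+1]addn1 energym_cat {1}/energym; apply: ler_sum => w _.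
by rewrite ler_wpM2l ?invr_ge0 ?(ltW (rw_gt0 w))//; exact: energy0_le_energy1.
Qed.

End Energies.

Local Notation shift := Defs.shift.
Local Notation code := Defs.code.

(** * Words, codes and cells *)

Section ShiftSpace.
Variable N : nat.

Lemma cvg_shift_space (F : nat -> shift_space N) (omega : shift_space N) :
  (forall j, exists k0, forall k, (k0 <= k)%N -> F k j = omega j) ->
  F k @[k --> \oo] --> omega.
Proof.
move=> H; apply/(@pointwise_cvgP nat (discrete_topology 'I_N)) => j.
have [k0 Hk0] := H j; apply: cvg_near_cst.
by exists k0 => //.
Qed.

End ShiftSpace.

Section Words.
Variable N : nat.
Implicit Types (omega alpha : shift_space N) (w : seq 'I_N).

Definition scat w alpha : shift_space N := foldr (@shift_cons N) alpha w.

Lemma mkseq_cons (T : Type) (f : nat -> T) n : mkseq f n.+1 = f 0%N :: mkseq (f \o S) n.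
Proof. by rewrite /mkseq /= -[1%N]addn0 iotaDl -map_comp. Qed.

Lemma shift_scat w alpha : shift (size w) (scat w alpha) = alpha.
Proof. by elim: w. Qed.

Lemma scat_mkseq omega n : scat (mkseq omega n) (shift n omega) = omega.
Proof.
elim: n omega => [//|n IH] omega; rewrite mkseq_cons /=.
apply/funext => -[//|k] /=.
exact: (congr1 (fun a : shift_space N => a k) (IH (shift 1 omega))).
Qed.

Lemma scat_mkseq_lt omega alpha n j : (j < n)%N ->
  scat (mkseq omega n) alpha j = omega j.
Proof.
elim: n omega j => [//|n IH] omega [|j] jn; rewrite mkseq_cons //=.
exact: (IH (shift 1 omega)).
Qed.

Lemma mkseq_scat w alpha : mkseq (scat w alpha) (size w) = w.
Proof. by elim: w => [//|i w IH]; rewrite mkseq_cons /= -[in RHS]IH. Qed.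

Lemma shift_shift m n omega : shift m (shift n omega) = shift (n + m) omega.
Proof. by apply/funext => k; rewrite /shift addnA. Qed.

End Words.

Section PostCritical.
Variables (K : topologicalType) (N : nat) (L : selfSimilar K N).
Implicit Types (omega alpha : shift_space N) (w : seq 'I_N).

Lemma coding_scat w alpha : coding L (scat w alpha) = psi_word L w (coding L alpha).
Proof. by elim: w => //= i w <-; rewrite psi_coding. Qed.

Lemma coding_code x : coding L (code L x) = x.
Proof. by rewrite /code; case: cid. Qed.

Lemma psi_word_inj w : injective (psi_word L w).
Proof.
elim: w => [//|i w IH] x y /= /(@psi_injective _ _ L i).
exact: IH.
Qed.

Lemma psi_word_continuous w : continuous (psi_word L w).
Proof.
elim: w => [|i w IH] x /=; first exact: cvg_id.
apply: (@continuous_comp _ _ _ (psi_word L w) (psi L i)); first exact: IH.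
exact: psi_continuous.
Qed.

Lemma code_prefixE x n :
  x = psi_word L (code_prefix L x n) (coding L (shift n (code L x))).
Proof. by rewrite -coding_scat scat_mkseq coding_code. Qed.

Lemma cell_code_prefix x n : cell L (code_prefix L x n) x.
Proof. by rewrite [X in cell _ _ X](code_prefixE x n);
exists (coding L (shift n (code L x))). Qed.

Lemma size_code_prefix x n : size (code_prefix L x n) = n.
Proof. by rewrite size_mkseq. Qed.

Lemma cellP w x : cell L w x <-> exists alpha, x = coding L (scat w alpha).
Proof.
split=> [[y _ <-]|[alpha ->]]; last by rewrite coding_scat; exists (coding L alpha).
by exists (code L y); rewrite coding_scat coding_code.
Qed.

Lemma cell_cat w v : cell L (w ++ v) `<=` cell L w.
Proof.
move=> x /cellP[alpha ->]; apply/cellP; exists (scat v alpha).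
by rewrite /scat foldr_cat.
Qed.

Lemma coding_prefix_cvg omega (alpha : nat -> shift_space N) :
  coding L (scat (mkseq omega n) (alpha n)) @[n --> \oo] --> coding L omega.
Proof.
apply: continuous_cvg; first exact: coding_continuous.
apply: cvg_shift_space => j; exists j.+1 => k jk; exact: scat_mkseq_lt.
Qed.

(** Points of the successive cells outside [O] would have codes converging to that of [x], against
    the continuity of the coding. *)
Lemma cell_code_prefix_sub x (O : set K) : open O -> O x ->
  exists n0, forall n, (n0 <= n)%N -> cell L (code_prefix L x n) `<=` O.
Proof.
move=> oO Ox; suff [n0 Hn0] : exists n, cell L (code_prefix L x n) `<=` O.
  exists n0 => n n0n; apply: subset_trans Hn0.
  have -> : code_prefix L x n = code_prefix L x n0 ++ drop n0 (code_prefix L x n).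
    rewrite -[LHS](cat_take_drop n0); congr (_ ++ _).
    by rewrite /code_prefix /mkseq -map_take take_iota (minn_idPl n0n).
  exact: cell_cat.
apply: contrapT => /forallNP H.
have /choice[alpha Ha] n : exists alpha,
    ~ O (coding L (scat (code_prefix L x n) alpha)).
  have /existsNP[y /not_implyP[/cellP[alpha ->] nO]] := H n.
  by exists alpha.
have := @coding_prefix_cvg (code L x) alpha.
rewrite coding_code => /(_ O) /=; case; first exact: open_nbhs_nbhs.
by move=> n _ /(_ n (leqnn n)); exact: Ha.
Qed.

Lemma post_critical_shift alpha : post_critical L alpha ->
  post_critical L (shift 1 alpha).
Proof.
move=> [m /= m1 [omega Ho <-]]; exists m.+1 => //.
by exists omega => //; rewrite shift_shift addn1.
Qed.

(** The shift preserves the post-critical set, which gives the inclusion of V_0 in V_1. *)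
Lemma V0_psi q : V0 L q -> exists i, exists2 q', V0 L q' & q = psi L i q'.
Proof.
move=> [alpha Pa <-]; exists (alpha 0%N), (coding L (shift 1 alpha)).
  by exists (shift 1 alpha) => //; exact: post_critical_shift.
by rewrite psi_coding; congr (coding L _); apply/funext => -[].
Qed.

(* Two codes of a point that differ before time [n] do so for the first time at
   some [k < n], where their shifts code a point of the overlap of two 1-cells. *)
Lemma post_critical_split (a b : shift_space N) n : coding L a = coding L b ->
  mkseq a n <> mkseq b n -> post_critical L (shift n a).
Proof.
move=> ab nab; have [k kn Hk] : exists2 k, (k < n)%N &
    mkseq a k = mkseq b k /\ a k <> b k.
  elim: n nab => [//|n IH]; have [/[dup] eab /eqP|nab _] := eqVneq (mkseq a n) (mkseq b n).
    move=> _ H; exists n => //; split => // Hn; apply: H.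
    by rewrite !mkseqS eab Hn.
  by have [|k kn H] := IH; [exact/eqP|exists k => //; exact: ltnW].
have {Hk}[eab nk] := Hk.
exists (n - k)%N; first by rewrite /= subn_gt0.
exists (shift k a); last by rewrite shift_shift subnKC// ltnW.
have sab : coding L (shift k a) = coding L (shift k b).
  apply: (@psi_word_inj (mkseq a k)); rewrite -coding_scat scat_mkseq.
  by rewrite eab -coding_scat scat_mkseq.
exists (a k), (b k); split; first exact/eqP.
- apply/cellP; exists (shift k.+1 a); congr (coding L _).
  by apply/funext => -[|j] /=; rewrite /shift ?addn0 ?addnS.
- rewrite sab; apply/cellP; exists (shift k.+1 b); congr (coding L _).
  by apply/funext => -[|j] /=; rewrite /shift ?addn0 ?addnS.
Qed.

(** The common point has a code that begins with [w] and another that begins with [v], so the tail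
    of the first is post-critical. Cells of one level therefore meet only at images of V_0. *)
Lemma cell_meet w v y z : size w = size v -> w <> v ->
  psi_word L w y = psi_word L v z -> V0 L y.
Proof.
rewrite -(coding_code y) -(coding_code z) -!coding_scat => wv nwv H.
exists (code L y) => //; rewrite -[code L y](shift_scat w).
apply: (post_critical_split H); rewrite [in X in _ <> X]wv.
by rewrite !mkseq_scat.
Qed.

Hypothesis K_compact : compact [set: K].
Hypothesis hK : hausdorff_space K.

Lemma closed_cell w : closed (cell L w).
Proof.
apply: compact_closed => //; apply: continuous_compact => //.
apply: continuous_subspaceT; exact: psi_word_continuous.
Qed.

Hypothesis K_connected : connected [set: K].
Hypothesis N_ge2 : (2 <= N)%N.
Hypothesis K_point : [set: K] !=set0.

Lemma cell_nonempty w : cell L w !=set0.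
Proof. by case: K_point => x _; exists (psi_word L w x), x. Qed.

(** Connectedness as an induction on letters: if [P] failed somewhere, the cells with [P] and those
    without would split K into two disjoint nonempty closed sets. *)
Lemma cell_connect (P : 'I_N -> Prop) : (exists i, P i) ->
  (forall i j, P i -> i <> j -> cell L [:: i] `&` cell L [:: j] !=set0 -> P j) ->
  forall i, P i.
Proof.
move=> [i0 Pi0] Padj i.
pose A := \bigcup_(i in P) cell L [:: i].
pose B := \bigcup_(i in ~` P) cell L [:: i].
have cA : closed A by apply: closed_bigcup => [|j _];
[exact: finite_finset|exact: closed_cell].
have cB : closed B by apply: closed_bigcup => [|j _];
[exact: finite_finset|exact: closed_cell].
have AB : ~` B = A.
  apply/seteqP; split => x.
    move=> nB; have := @cell_code_prefix x 1; rewrite /code_prefix /= => Cx.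
    exists (code L x 0%N) => //; apply: contrapT => nP; apply: nB.
    by exists (code L x 0%N).
  move=> [j Pj Cj] [k nPk Ck]; apply: (nPk).
  by apply: (Padj j) => //; [move=> jk; apply: nPk; rewrite -jk|exists x].
have AT : A = setT.
  apply: K_connected.
  - by have [x Cx] := cell_nonempty [:: i0]; exists x, i0.
  - by exists A; rewrite ?setTI// -AB openC.
  - by exists A; rewrite ?setTI.
apply: contrapT => nPi; have [x Cx] := cell_nonempty [:: i].
have : A x by rewrite AT.
by rewrite -AB; apply; exists i.
Qed.

(** Otherwise 1-cells of different letters would be disjoint, and induction along meeting cells
    would leave a single letter. *)
Lemma V0_nonempty : V0 L !=set0.
Proof.
have i0 : 'I_N by exact: (Ordinal (ltnW N_ge2)).
apply: contrapT => /set0P/negP/negPn/eqP V00.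
have ord i : i = Ordinal (ltnW N_ge2).
  apply: (cell_connect (P := fun i => i = Ordinal (ltnW N_ge2))).
    by exists (Ordinal (ltnW N_ge2)).
  move=> i1 j _ ij [x [[y _ Hy] [z _ Hz]]].
  have : V0 L y by apply: (@cell_meet [:: i1] [:: j] y z) => //; [move=> -[]|rewrite Hy].
  by rewrite V00.
by have /(congr1 val) := ord (Ordinal N_ge2).
Qed.

End PostCritical.

Lemma metrizable_hausdorff (R : realType) (K : topologicalType) :
  metrizable R K -> hausdorff_space K.
Proof.
move=> [dist [d0 dC dT dN]] p q pq; apply: contrapT => npq.
have dge0 x y : 0 <= dist x y.
  have := dT x y x; rewrite (dC y x) (_ : dist x x = 0); last exact/d0.
  by lra.
have dpq : 0 < dist p q / 2.
  by rewrite divr_gt0// lt_def dge0 andbT; apply/eqP => /d0.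
have [] := pq [set y | dist p y < dist p q / 2] [set y | dist q y < dist p q / 2].
- by apply/dN; exists (dist p q / 2).
- by apply/dN; exists (dist p q / 2).
move=> x /= [px qx]; have := dT p x q; rewrite (dC x q); lra.
Qed.

Lemma dform_term (R : realType) (K : choiceType) (s : seq (R * K * K)) u t :
  nonneg_form s -> t \in s -> t.1.1 * (u t.1.2 - u t.2) ^+ 2 <= dform s u u.
Proof.
move=> s0 ts; rewrite /dform (big_rem t)//= -expr2 lerDl big_seq.
apply: sumr_ge0 => t' /mem_rem t's.
by rewrite mulr_ge0 ?s0// -expr2 sqr_ge0.
Qed.

(** * Oscillation and energy *)

Section Oscillation.
Variables (R : realType) (K : ptopologicalType) (N : nat) (L : selfSimilar K N).
Variable HS : harmonicStructure R L.
Hypothesis pcf : post_critically_finite L.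

Local Notation D := (hD HS).
Local Notation r := (hr HS).
Local Notation E0 := (energy0 L D).
Local Notation Em := (energym L D r).
Local Notation "u \on w" := (u \o psi_word L w) (at level 40).

Let sV : seq K := finmap.enum_fset (fset_set (V0 L)).

Let mem_sV q : (q \in sV) = (q \in V0 L).
Proof. exact: in_fset_set (finite_V0 pcf) q. Qed.

Let fsum_V0 (F : K -> R) : \sum_(q \in V0 L) F q = \sum_(q <- sV) F q.
Proof. by rewrite fsbig_finite//; exact: finite_V0. Qed.

Lemma energy0_edge u p q : V0 L p -> V0 L q -> p <> q ->
  D p q * (u p - u q) ^+ 2 <= 2 * E0 u u.
Proof.
move=> Vp Vq pq; rewrite (energy0_dform HS pcf).
set s := [seq _ | _ <- _, _ <- _].
have s0 : nonneg_form s.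
  move=> t /allpairsP[[p' q'] /= [+ + ->]]; rewrite !mem_sV !inE => Vp' Vq' /=.
  case: eqP => //= pq'; rewrite mulr_ge0//; exact: hD_offdiag.
have ts : (2^-1 * D p q, p, q) \in s.
  apply/allpairsP; exists (p, q); split => /=; rewrite -/sV ?mem_sV ?inE//.
  by case: eqP.
by have := dform_term u s0 ts => /=; lra.
Qed.

(** The bound holds for pairs with positive conductance and passes along paths. The graph is
    connected because the kernel of D contains only constants: D annihilates the indicator of the
    points reached from [p]. *)
Lemma energy0_lb : exists2 C : R, 0 <= C & forall u p q, V0 L p -> V0 L q ->
  (u p - u q) ^+ 2 <= C * E0 u u.
Proof.
have step p : V0 L p -> forall q, V0 L q -> exists2 C : R, 0 <= C & forall u,
    (u p - u q) ^+ 2 <= C * E0 u u.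
  move=> Vp; pose T q := exists2 C : R, 0 <= C & forall u,
    (u p - u q) ^+ 2 <= C * E0 u u.
  have Tp : T p by exists 0 => // u; rewrite subrr expr0n mul0r.
  have Tadj q q' : V0 L q -> V0 L q' -> T q -> q <> q' -> 0 < D q q' -> T q'.
    move=> Vq Vq' [C C0 HC] qq' Dqq'.
    (* From (s + t)^2 <= 2 s^2 + 2 t^2, where the new edge is bounded by [energy0_edge]. *)
    exists (2 * C + 4 / D q q').
      by apply: addr_ge0; [exact: mulr_ge0|apply: divr_ge0 => //; exact: ltW].
    move=> u; have H1 := HC u; have H2 := energy0_edge u Vq Vq' qq'.
    have H3 : (u q - u q') ^+ 2 <= 2 / D q q' * E0 u u.
      by rewrite mulrAC ler_pdivlMr// mulrC.
    have -> : u p - u q' = (u p - u q) + (u q - u q') by ring.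
    apply: (@le_trans _ _ (2 * (u p - u q) ^+ 2 + 2 * (u q - u q') ^+ 2)).
      by have := sqr_ge0 ((u p - u q) - (u q - u q')); nra.
    rewrite [leRHS]mulrDl; apply: lerD; first by rewrite -mulrA ler_wpM2l.
    rewrite (_ : 4 / D q q' * E0 u u = 2 * (2 / D q q' * E0 u u)); last by ring.
    by rewrite ler_wpM2l.
  pose u q : R := if `[< T q >] then 1 else 0.
  have Du q : V0 L q -> laplacian L D u q = 0.
    move=> Vq; have -> : laplacian L D u q = \sum_(q' <- sV) D q q' * (u q' - u q).
      under [RHS]eq_bigr do rewrite mulrBr.
      by rewrite sumrB -big_distrl /= laplacian1// mul0r subr0 /laplacian fsum_V0.
    rewrite big_seq big1// => q'; rewrite mem_sV inE => Vq'.
    have [->|/eqP qq'] := eqVneq q q'; first by rewrite subrr mulr0.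
    have D0 : 0 <= D q q' by exact: hD_offdiag.
    rewrite /u; case: asboolP => [Tq'|nTq']; case: asboolP => [Tq|nTq];
      rewrite ?subrr ?mulr0//.
      have [->|Dn0] := eqVneq (D q q') 0; first by rewrite mul0r.
      exfalso; apply: nTq; apply: (Tadj q' q) => //; first exact/nesym.
      by rewrite hD_sym// lt_def Dn0.
    have [->|Dn0] := eqVneq (D q q') 0; first by rewrite mul0r.
    by exfalso; apply: nTq'; apply: (Tadj q q') => //; rewrite lt_def Dn0.
  have [/(_ Du)[c Hc] _] := hD_ker HS u.
  move=> q Vq; have := Hc q Vq; rewrite -(Hc p Vp) /u (asboolT Tp).
  by case: asboolP => // _ /eqP; rewrite eq_sym oner_eq0.
have /choice[C HC] (pq : K * K) : exists C : R, 0 <= C /\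
    (V0 L pq.1 -> V0 L pq.2 -> forall u, (u pq.1 - u pq.2) ^+ 2 <= C * E0 u u).
  have [Vp|nVp] := pselect (V0 L pq.1); last by exists 0; split.
  have [Vq|nVq] := pselect (V0 L pq.2); last by exists 0; split.
  by have [C C0 H] := step _ Vp _ Vq; exists C.
have C0 pq : 0 <= C pq by case: (HC pq).
exists (\sum_(p <- sV) \sum_(q <- sV) C (p, q)).
  by apply: sumr_ge0 => p _; apply: sumr_ge0.
move=> u p q Vp Vq; have [_ /(_ Vp Vq u) H] := HC (p, q).
apply: (le_trans H); rewrite ler_wpM2r//.
  by rewrite -(energym0 HS); exact: energym_ge0.
have ps : p \in sV by rewrite mem_sV inE.
have qs : q \in sV by rewrite mem_sV inE.
rewrite (big_rem p)//= (big_rem q)//= -addrA lerDl addr_ge0//.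
  exact: sumr_ge0.
by apply: sumr_ge0 => p' _; apply: sumr_ge0.
Qed.

(** Read backwards, this bounds the oscillation of boundary values from below by their energy; this
    is how the denominator osc g is controlled. *)
Lemma energy0_ub : exists2 C : R, 0 <= C & forall u b, 0 <= b ->
  (forall p q, V0 L p -> V0 L q -> `|u p - u q| <= b) -> E0 u u <= C * b ^+ 2.
Proof.
exists (\sum_(p <- sV) \sum_(q <- sV) `|2^-1 * D p q|).
  by apply: sumr_ge0 => p _; apply: sumr_ge0.
move=> u b b0 H; rewrite (energy0E HS pcf) -/sV !big_distrl !big_seq /=.
apply: ler_sum => p; rewrite mem_sV inE => Vp.
rewrite big_distrl !big_seq /=; apply: ler_sum => q; rewrite mem_sV inE => Vq.
apply: le_trans (ler_norm _) _; rewrite normrM ler_wpM2l// -expr2.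
rewrite ger0_norm ?sqr_ge0// -real_normK ?num_real//.
by rewrite ler_sqr ?nnegrE// H.
Qed.

Lemma energym_le_cell m n u (w : seq 'I_N) : size w = m ->
  Em n (u \on w) (u \on w) <= rw HS w * Em (m + n) u u.
Proof.
move=> sw; rewrite mulrC -ler_pdivrMr ?rw_gt0// mulrC energym_cat.
have wE : w = in_tuple w by [].
rewrite -sw (bigD1 (in_tuple w))//= lerDl; apply: sumr_ge0 => v _.
by rewrite mulr_ge0 ?energym_ge0// invr_ge0 ltW// rw_gt0.
Qed.

Hypothesis K_compact : compact [set: K].
Hypothesis hK : hausdorff_space K.
Hypothesis K_connected : connected [set: K].
Hypothesis N_ge2 : (2 <= N)%N.

(** Any two 1-cells are linked by a chain of meeting cells, and consecutive ones share a point that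
    is an image of V_0 from both sides. Adding [energy0_lb] along the chain compares the boundary
    values of all 1-cells, and [p] lies on one of these boundaries. *)
Lemma energy1_lb : exists2 C : R, 0 <= C & forall u p q i, V0 L p -> V0 L q ->
  (u p - u (psi L i q)) ^+ 2 <= C * Em 1 u u.
Proof.
have [C0 C0_ge0 HC0] := energy0_lb.
have cellE u i p q : V0 L p -> V0 L q ->
    (u (psi L i p) - u (psi L i q)) ^+ 2 <= C0 * r i * Em 1 u u.
  move=> Vp Vq; apply: (le_trans (HC0 (u \o psi L i) _ _ Vp Vq)).
  rewrite -mulrA ler_wpM2l//.
  by have := @energym_le_cell 1 0 u [:: i] erefl; rewrite /rw big_seq1 energym0.
have step i j : exists2 C : R, 0 <= C & forall u p q, V0 L p -> V0 L q ->
    (u (psi L i p) - u (psi L j q)) ^+ 2 <= C * Em 1 u u.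
  move: j; apply: (@cell_connect _ _ L K_compact hK K_connected); first by exists point.
    exists i, (C0 * r i); first by rewrite mulr_ge0// ltW// hr_gt0.
    by move=> u p q; exact: cellE.
  move=> j k [C C_ge0 HC] jk [x [[y _ Hy] [z _ Hz]]].
  have Vy : V0 L y.
    by apply: (@cell_meet _ _ L [:: j] [:: k] y z) => //;
    [move=> -[]|exact: etrans Hy (esym Hz)].
  have Vz : V0 L z.
    by apply: (@cell_meet _ _ L [:: k] [:: j] z y) => //;
    [move=> -[] /esym|exact: etrans Hz (esym Hy)].
  exists (2 * C + 2 * (C0 * r k)).
    by rewrite addr_ge0 ?mulr_ge0// ltW// hr_gt0.
  move=> u p q Vp Vq.
  have -> : u (psi L i p) - u (psi L k q) = (u (psi L i p) - u (psi L j y)) +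
      (u (psi L k z) - u (psi L k q)).
    have -> : psi L k z = psi L j y by exact: etrans Hz (esym Hy).
    by ring.
  have H1 := HC u p y Vp Vy; have H2 := cellE u k z q Vz Vq.
  rewrite mulrDl -!(mulrA 2) -mulrDr.
  apply: le_trans (ler_wpM2l _ (lerD H1 H2)) => //.
  set a := _ - _; set b := _ - _; have := sqr_ge0 (a - b); nra.
have /choice[C HC] (ij : 'I_N * 'I_N) : exists C : R, 0 <= C /\
    forall u p q, V0 L p -> V0 L q ->
    (u (psi L ij.1 p) - u (psi L ij.2 q)) ^+ 2 <= C * Em 1 u u.
  by have [C ? ?] := step ij.1 ij.2; exists C.
exists (\sum_ij C ij); first by apply: sumr_ge0 => ij _; case: (HC ij).
move=> u p q j Vp Vq; have [i [p' Vp' ->]] := V0_psi Vp.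
have [_ /(_ u p' q Vp' Vq) H] := HC (i, j).
apply: (le_trans H); rewrite ler_wpM2r ?energym_ge0//.
rewrite (bigD1 (i, j))//= lerDl; apply: sumr_ge0 => ij _; by case: (HC ij).
Qed.

Hypothesis HS_regular : regular_harmonic HS.

(** The energy in a cell carries the factor r_w, differences of values only its square root; [rho]
    is chosen as the rate of the latter. *)
Lemma regular_ratio : exists rho : R, [/\ 0 < rho, rho < 1 &
  forall w, rw HS w <= (rho ^+ 2) ^+ size w].
Proof.
pose m := \big[Order.max/2^-1]_(i < N) r i.
have m1 : m < 1.
  by apply: bigmax_lt => [|i _]; [lra|case/andP: (HS_regular i)].
have m0 : 0 < m by apply: (@lt_le_trans _ _ 2^-1); [lra|exact: bigmax_ge_id].
exists (Num.sqrt m); split.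
- by rewrite sqrtr_gt0.
- by rewrite -sqrtr1 ltr_sqrt.
- rewrite sqr_sqrtr ?(ltW m0)//; elim=> [|i w IH]; first by rewrite /rw big_nil expr0.
  rewrite rw_cons /= exprS ler_pM//.
  + exact/ltW/hr_gt0.
  + exact/ltW/rw_gt0.
  + exact: le_bigmax.
Qed.

(* Telescoping along the code of a point: the n-th step takes place in a cell of
   level n, whose resistance is geometrically small. *)
Lemma energy_osc : exists2 C : R, 0 <= C & forall u B, continuous u ->
  (forall m, Em m u u <= B) -> forall x y, `|u x - u y| <= C * Num.sqrt B.
Proof.
have [C1 C1_ge0 HC1] := energy1_lb.
have [rho [rho0 rho1 Hrho]] := regular_ratio.
have [q0 Vq0] := V0_nonempty L K_compact hK K_connected N_ge2
  (ex_intro _ point I : [set: K] !=set0).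
pose A := Num.sqrt C1 / (1 - rho).
have A0 : 0 <= A by rewrite divr_ge0// subr_ge0 ltW.
exists (2 * A); first by rewrite mulr_ge0.
move=> u B cu HB x y.
have B0 : 0 <= B by exact: le_trans (energym_ge0 HS pcf 0 u) (HB 0%N).
suff H z : `|u z - u q0| <= A * Num.sqrt B.
  have -> : u x - u y = (u x - u q0) - (u y - u q0) by ring.
  apply: (le_trans (ler_normB _ _)); have := H x; have := H y; nra.
have [alpha Pa Hq0] := Vq0.
(* These points of V_n start at [q0] and converge to [z]; two consecutive ones lie in one cell of
   level n. *)
pose z_ n := psi_word L (code_prefix L z n) q0.
have z_E n : z_ n = coding L (scat (code_prefix L z n) alpha).
  by rewrite coding_scat Hq0.
have cvz : u (z_ n) @[n --> \oo] --> u z.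
  apply: (@cvg_comp _ _ _ z_ u _ (nbhs z)); last exact: cu.
  have -> : z_ = fun n => coding L (scat (code_prefix L z n) alpha).
    by apply/funext => n; exact: z_E.
  have := @coding_prefix_cvg _ _ L (code L z) (fun=> alpha).
  by rewrite coding_code; exact.
have step n : `|u (z_ n.+1) - u (z_ n)| <= Num.sqrt C1 * Num.sqrt B * rho ^+ n.
  have -> : z_ n.+1 = psi_word L (code_prefix L z n) (psi L (code L z n) q0).
    by rewrite /z_ /code_prefix mkseqS -cats1 psi_word_cat.
  have := HC1 (u \on code_prefix L z n) q0 q0 (code L z n) Vq0 Vq0 => /= H.
  rewrite distrC -[X in X <= _]sqrtr_sqr.
  have -> : Num.sqrt C1 * Num.sqrt B * rho ^+ n =
      Num.sqrt (C1 * ((rho ^+ 2) ^+ n * B)).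
    have -> : (rho ^+ 2) ^+ n = (rho ^+ n) ^+ 2 by rewrite -!exprM mulnC.
    rewrite (sqrtrM _ C1_ge0) (sqrtrM _ (sqr_ge0 _)) sqrtr_sqr.
    by rewrite ger0_norm ?exprn_ge0 ?(ltW rho0)//; ring.
  rewrite ler_sqrt; last by rewrite mulr_ge0// mulr_ge0// exprn_ge0// sqr_ge0.
  apply: (le_trans H); rewrite ler_wpM2l//.
  apply: (le_trans (energym_le_cell 1 u (size_code_prefix L z n))).
  rewrite ler_pM ?energym_ge0 ?(ltW (rw_gt0 _ _))//.
  by have := Hrho (code_prefix L z n); rewrite size_code_prefix.
have bound n : `|u (z_ n) - u q0| <= A * Num.sqrt B.
  apply: (@le_trans _ _ (Num.sqrt C1 * Num.sqrt B * \sum_(i < n) rho ^+ i)).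
    elim: n => [|n IH]; first by rewrite /z_ /= subrr normr0 big_ord0 mulr0.
    rewrite big_ord_recr /= mulrDr.
    have -> : u (z_ n.+1) - u q0 = (u (z_ n.+1) - u (z_ n)) + (u (z_ n) - u q0) by ring.
    by apply: (le_trans (ler_normD _ _)); rewrite addrC lerD.
  have -> : A * Num.sqrt B = Num.sqrt C1 * Num.sqrt B * (1 - rho)^-1.
    by rewrite /A; ring.
  rewrite ler_wpM2l ?mulr_ge0// -[leRHS]mul1r ler_pdivlMr ?subr_gt0//.
  rewrite mulrC -opprB mulNr -subrX1 opprB gerBl exprn_ge0// ltW//.
have cvn : `|u (z_ n) - u q0| @[n --> \oo] --> `|u z - u q0|.
  by apply: cvg_norm; apply: cvgB => //; exact: cvg_cst.
by apply: (cvgr_to_le cvn); exact: nearW.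
Qed.

End Oscillation.

(** * The limit form and its domain *)

Section EnergyForm.
Variables (R : realType) (K : ptopologicalType) (N : nat) (L : selfSimilar K N).
Variable HS : harmonicStructure R L.
Hypothesis pcf : post_critically_finite L.
Hypothesis K_compact : compact [set: K].
Hypothesis hK : hausdorff_space K.
Hypothesis K_connected : connected [set: K].
Hypothesis N_ge2 : (2 <= N)%N.
Hypothesis HS_regular : regular_harmonic HS.

Local Notation Em := (energym L (hD HS) (hr HS)).
Local Notation F := (domF HS).
Local Notation E := (energy HS).
Local Notation "u \on w" := (u \o psi_word L w) (at level 40).

(** The energies increase with the level, so convergence amounts to boundedness. *)
Lemma domFP u : F u <-> continuous u /\ exists B, forall m, Em m u u <= B.
Proof.
split=> -[cu Hu]; split => //.
  exists (limn (fun m => Em m u u)) => m.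
  by apply: nondecreasing_cvgn_le => // i j; exact: energym_homo.
have [B HB] := Hu; apply: nondecreasing_is_cvgn.
  by move=> i j; exact: energym_homo.
by exists B => _ [m _ <-].
Qed.

Lemma energym_le_energy m u : F u -> Em m u u <= E u u.
Proof.
move=> [cu Hu]; apply: nondecreasing_cvgn_le => // i j; exact: energym_homo.
Qed.

Lemma energy_le u B : F u -> (forall m, Em m u u <= B) -> E u u <= B.
Proof.
move=> [cu Hu] HB; apply: limr_le => //; exact: nearW.
Qed.

Lemma domF_lin a u v : F u -> F v -> F (fun x => a * u x + v x).
Proof.
move=> Fu Fv; have [cu _] := Fu; have [cv _] := Fv; apply/domFP; split.
  move=> x; apply: continuousD (cv x); apply: continuousM (cu x).
  exact: cst_continuous.
exists (2 * a ^+ 2 * E u u + 2 * E v v) => m; rewrite energym_sq//.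
(* Nonnegativity of the energy of [- a * u + v] bounds the cross term. *)
have := energym_ge0 HS pcf m (fun x => - a * u x + v x); rewrite energym_sq//.
have := energym_le_energy m Fu; have := energym_le_energy m Fv.
have := sqr_ge0 a; nra.
Qed.

Lemma domFD u v : F u -> F v -> F (u \+ v).
Proof.
move=> Fu Fv; rewrite (_ : u \+ v = fun x => 1 * u x + v x); first exact: domF_lin.
by apply/funext => x; rewrite mul1r.
Qed.

Lemma domFB u v : F u -> F v -> F (u \- v).
Proof.
move=> Fu Fv; rewrite (_ : u \- v = fun x => - 1 * v x + u x); first exact: domF_lin.
by apply/funext => x; rewrite mulN1r addrC.
Qed.

Lemma domF_cst (c : R) : F (fun=> c).
Proof.
apply/domFP; split; first by move=> x; exact: cst_continuous.
exists 0 => m; have [s _ ->] := energym_dform HS pcf m.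
by rewrite /dform big1// => t _; rewrite subrr !mulr0.
Qed.

(** Mutual energies, which are not monotone in the level, converge because of this identity. *)
Lemma energym_polar m u v : Em m u v =
  2^-1 * (Em m (u \+ v) (u \+ v) - Em m u u - Em m v v).
Proof.
rewrite (_ : u \+ v = fun x => 1 * u x + v x); last first.
  by apply/funext => x; rewrite mul1r.
by rewrite energym_sq//; field.
Qed.

Lemma energy_cvg u v : F u -> F v -> Em m u v @[m --> \oo] --> E u v.
Proof.
move=> Fu Fv; suff : cvgn (fun m => Em m u v) by [].
rewrite (_ : (fun m => _) = (fun m => 2^-1 *
    (Em m (u \+ v) (u \+ v) - Em m u u - Em m v v))); last first.
  by apply/funext => m; exact: energym_polar.
have [_ cuv] := domFD Fu Fv; have [_ cu] := Fu; have [_ cv] := Fv.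
apply: is_cvgM; first exact: is_cvg_cst.
by apply: is_cvgB => //; exact: is_cvgB.
Qed.

Lemma energyC u v : E u v = E v u.
Proof.
rewrite /energy; congr (limn _); apply/funext => m; exact: energymC.
Qed.

Lemma energy_ge0 u : F u -> 0 <= E u u.
Proof. by move=> Fu; exact: le_trans (energym_ge0 HS pcf 0 u) (energym_le_energy 0 Fu). Qed.

Lemma energyDl a u v w : F u -> F v -> F w ->
  E (fun x => a * u x + v x) w = a * E u w + E v w.
Proof.
move=> Fu Fv Fw; apply: (@cvg_unique _ (@Rhausdorff R) (Em m (fun x => a * u x + v x) w
  @[m --> \oo])).
  by apply: energy_cvg => //; exact: domF_lin.
rewrite (_ : (fun m => _) = (fun m => a * Em m u w + Em m v w)); last first.
  by apply/funext => m; exact: energymDl.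
apply: cvgD; last exact: energy_cvg.
by apply: cvgM; [exact: cvg_cst|exact: energy_cvg].
Qed.

Lemma energy_sq a u v : F u -> F v ->
  E (fun x => a * u x + v x) (fun x => a * u x + v x) =
  a ^+ 2 * E u u + 2 * a * E u v + E v v.
Proof.
move=> Fu Fv; have Fuv := domF_lin a Fu Fv.
rewrite energyDl// (energyC u) (energyC v) !energyDl// (energyC v u).
by ring.
Qed.

Lemma energy_CS u v : F u -> F v -> E u v ^+ 2 <= E u u * E v v.
Proof.
move=> Fu Fv; rewrite mulrC; apply: discr_le0; last exact: energy_ge0.
move=> t; have := energy_ge0 (domF_lin t Fu Fv); rewrite energy_sq//.
by congr (_ <= _); ring.
Qed.

Lemma sqrt_energyB u v : F u -> F v ->
  Num.sqrt (E u u) - Num.sqrt (E (u \- v) (u \- v)) <= Num.sqrt (E v v).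
Proof.
move=> Fu Fv; have Fuv := domFB Fu Fv.
have -> : u = fun x => 1 * (u \- v) x + v x.
  by apply/funext => x /=; ring.
rewrite energy_sq// (_ : (fun x => 1 * (u \- v) x + v x) \- v = u \- v); last first.
  by apply/funext => x /=; ring.
set a := Num.sqrt (E (u \- v) _); set b := Num.sqrt (E v v).
have a0 : 0 <= a by exact: sqrtr_ge0.
have b0 : 0 <= b by exact: sqrtr_ge0.
have aE : E (u \- v) (u \- v) = a ^+ 2 by rewrite sqr_sqrtr// energy_ge0.
have bE : E v v = b ^+ 2 by rewrite sqr_sqrtr// energy_ge0.
rewrite lerBlDl -[leRHS](@ger0_norm _ (a + b)) ?addr_ge0// -sqrtr_sqr.
rewrite ler_sqrt ?sqr_ge0// bE aE.
have : E (u \- v) v <= a * b.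
  have := energy_CS Fuv Fv; rewrite aE bE -exprMn => H.
  apply: le_trans (ler_norm _) _; rewrite -[leRHS]ger0_norm ?mulr_ge0//.
  by rewrite -ler_sqr ?nnegrE// !real_normK ?num_real.
by lra.
Qed.

Lemma energy_osc_domF : exists2 C : R, 0 <= C &
  forall u, F u -> forall x y, `|u x - u y| <= C * Num.sqrt (E u u).
Proof.
have [C C0 HC] := energy_osc pcf K_compact hK K_connected N_ge2 HS_regular.
exists C => // u Fu x y; apply: HC; first by case: Fu.
by move=> m; exact: energym_le_energy.
Qed.

Lemma domF_bounded u : F u -> exists a, forall x, `|u x| <= a.
Proof.
move=> Fu; have [C C0 HC] := energy_osc_domF.
exists (`|u point| + C * Num.sqrt (E u u)) => x.
rewrite -[X in `|X|](subrKC (u point)).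
by apply: le_trans (ler_normD _ _) _; apply: lerD => //; exact: HC.
Qed.

Lemma domF_mul f phi : F f -> F phi -> F (f \* phi).
Proof.
move=> Ff Fp; have [a Ha] := domF_bounded Ff; have [b Hb] := domF_bounded Fp.
have [cf _] := Ff; have [cp _] := Fp.
apply/domFP; split; first by move=> x; exact: continuousM (cf x) (cp x).
exists (2 * a ^+ 2 * E phi phi + 2 * b ^+ 2 * E f f) => m.
have := energym_le_energy m Ff; have := energym_le_energy m Fp.
have [s s0 Hs] := energym_dform HS pcf m; rewrite !Hs => H1 H2.
apply: (le_trans (dform_mul s0 Ha Hb)).
by rewrite lerD// ler_wpM2l// mulr_ge0// sqr_ge0.
Qed.

Lemma domF_lip u v : F u -> continuous v ->
  (forall x y, `|v x - v y| <= `|u x - u y|) -> F v.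
Proof.
move=> Fu cv uv; apply/domFP; split => //; exists (E u u) => m.
apply: le_trans (energym_le_energy m Fu).
by have [s s0 Hs] := energym_dform HS pcf m; rewrite !Hs; exact: le_dform.
Qed.

Lemma domF_cell u w : F u -> F (u \on w).
Proof.
move=> Fu; apply/domFP; split.
  move=> x; apply: continuous_comp; first exact: psi_word_continuous.
  by case: Fu => cu _; exact: cu.
exists (rw HS w * E u u) => m.
have := @energym_le_cell _ _ _ _ HS pcf _ m u w erefl => /le_trans; apply.
by rewrite ler_wpM2l ?(ltW (rw_gt0 _ _))//; exact: energym_le_energy.
Qed.

Lemma energy_cat m u v : F u -> F v ->
  E u v = \sum_(w : m.-tuple 'I_N) (rw HS w)^-1 * E (u \on w) (v \on w).
Proof.
move=> Fu Fv; apply: (@cvg_unique _ (@Rhausdorff R) (Em (m + n) u v @[n --> \oo])).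
  rewrite (_ : (fun n => Em (m + n) u v) = (fun n => Em n u v) \o (fun n => m + n)%N)//.
  apply: cvg_comp; last exact: energy_cvg.
  by apply: cvg_addnl.
rewrite (_ : (fun n => _) = (fun n => \sum_(w : m.-tuple 'I_N)
    (rw HS w)^-1 * Em n (u \on w) (v \on w))); last first.
  by apply/funext => n; exact: energym_cat.
apply: cvg_big => [|w _]; first exact: add_continuous.
apply: cvgM; first exact: cvg_cst.
by apply: energy_cvg; exact: domF_cell.
Qed.

End EnergyForm.

(** * Harmonic interpolation *)

Lemma clip_lip (R : realType) (a b s t : R) :
  `|Num.min b (Num.max a s) - Num.min b (Num.max a t)| <= `|s - t|.
Proof.
have h1 := ler_norm (s - t); have h2 := ler_norm (- (s - t)); rewrite normrN in h2.
have h3 := normr_ge0 (s - t); rewrite ler_norml.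
case: (lerP a s) => ?; case: (lerP a t) => ?;
case: (lerP b a) => ?; case: (lerP b s) => ?; case: (lerP b t) => ?;
apply/andP; split; lra.
Qed.

(** * The minimal extension from V_0 to V_1 *)

Section HarmonicExtension.
Variables (R : realType) (K : ptopologicalType) (N : nat) (L : selfSimilar K N).
Variable HS : harmonicStructure R L.
Hypothesis pcf : post_critically_finite L.
Hypothesis K_compact : compact [set: K].
Hypothesis hK : hausdorff_space K.
Hypothesis K_connected : connected [set: K].
Hypothesis N_ge2 : (2 <= N)%N.

Local Notation E0 := (energy0 L (hD HS)).
Local Notation Em := (energym L (hD HS) (hr HS)).

Lemma V0_bounds (v : K -> R) : exists a b, (forall q, V0 L q -> a <= v q <= b) /\
  forall a' b', (forall q, V0 L q -> a' <= v q <= b') -> a' <= a /\ b <= b'.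
Proof.
have finV : finite_set (v @` V0 L) by apply: finite_image; exact: finite_V0.
have nV : v @` V0 L !=set0.
  have [q Vq] := V0_nonempty L K_compact hK K_connected N_ge2
    (ex_intro _ point I : [set: K] !=set0).
  by exists (v q), q.
have /finite_seqP[M HM] := finV.
have bnd t : (v @` V0 L) t -> `|t| <= \sum_(x <- M) `|x|.
  rewrite HM /= => tM; rewrite (big_rem t)//= lerDl; exact: sumr_ge0.
have ub : has_ubound (v @` V0 L).
  by exists (\sum_(x <- M) `|x|) => t /bnd; apply: le_trans; exact: ler_norm.
have lb : has_lbound (v @` V0 L).
  by exists (- \sum_(x <- M) `|x|) => t /bnd; rewrite ler_norml => /andP[].
exists (inf (v @` V0 L)), (sup (v @` V0 L)); split.
  by move=> q Vq; rewrite ge_inf ?ub_le_sup//; exists q.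
move=> a' b' H; split.
  by apply: lb_le_inf => // _ [q Vq <-]; case/andP: (H q Vq).
by apply: ge_sup => // _ [q Vq <-]; case/andP: (H q Vq).
Qed.

Lemma dform_continuous (T : topologicalType) (ev : T -> K -> R)
    (s : seq (R * K * K)) : (forall x, continuous (ev ^~ x)) ->
  continuous (fun u => dform s (ev u) (ev u)).
Proof.
move=> cev u; rewrite /dform; apply: cvg_big => [|t _]; first exact: add_continuous.
apply: cvgM; first exact: cvg_cst.
by apply: cvgM; apply: cvgB; exact: cev.
Qed.

(* The minimum of [E_1] over the extensions of [v] exists because clipping
   reduces the problem to a product of compact intervals. *)
Lemma harmonic_step_exists (v : K -> R) : exists u : K -> R,
  [/\ forall q, V0 L q -> u q = v q, Em 1 u u = E0 v v &
      forall a b, (forall q, V0 L q -> a <= v q <= b) -> forall x, a <= u x <= b].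
Proof.
have [a [b [vab Hab]]] := V0_bounds v.
have [s s0 Hs] := energym_dform HS pcf 1.
have [q0 Vq0] := V0_nonempty L K_compact hK K_connected N_ge2
    (ex_intro _ point I : [set: K] !=set0).
have ab : a <= b by have /andP[] := vab _ Vq0; exact: le_trans.
(* Values are fixed on V_0 and confined to an interval elsewhere; the product over all of K is
   compact by Tychonoff. *)
pose A (x : K) : set R := if `[< V0 L x >] then [set v x] else `[a, b]%classic.
have cA x : compact (A x).
  by rewrite /A; case: asboolP => _; [exact: compact_set1|exact: segment_compact].
pose X := [set u : prod_topology (fun _ : K => R) | forall x, A x (u x)].
have cX : compact X by apply: (@tychonoff K (fun=> R)).
have nX : X !=set0.
  exists (fun x => if `[< V0 L x >] then v x else a) => x.
  by rewrite /A; case: asboolP => //= _; rewrite in_itv /= lexx.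
have cs : continuous (fun u : prod_topology (fun _ : K => R) => dform s u u).
  apply: (@dform_continuous (prod_topology (fun _ : K => R)) id s) => x.
  exact: (@proj_continuous K (fun=> R) x).
have [u uX Hu] := compact_EVT_min nX cX (continuous_subspaceT cs).
move: uX; rewrite inE => uX.
have uV q : V0 L q -> u q = v q by move=> Vq; have := uX q; rewrite /A asboolT.
have uab x : a <= u x <= b.
  have := uX x; rewrite /A; case: asboolP => [Vx ->|_ /=]; first exact: vab.
  by rewrite in_itv.
have Hmin w : (forall q, V0 L q -> w q = v q) -> Em 1 u u <= Em 1 w w.
  move=> wV; pose w' x := Num.min b (Num.max a (w x)).
  have w'X : w' \in X.
    rewrite inE => x; rewrite /A /w'; case: asboolP => [Vx|_] /=.
      rewrite wV//; have /andP[av vb] := vab x Vx.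
      by rewrite (max_idPr av) (min_idPr vb).
    by rewrite in_itv /= le_min ab le_max lexx ge_min lexx.
  rewrite !Hs; apply: (le_trans (Hu _ w'X)); apply: le_dform => // x y.
  exact: clip_lip.
exists u; split => //.
  rewrite (energy0_inf HS); apply/eqP; rewrite eq_le; apply/andP; split.
    apply: lb_le_inf; first by exists (Em 1 u u), u.
    by move=> _ [w wV <-]; exact: Hmin.
  apply: ge_inf; last by exists u.
  by exists 0 => _ [w _ <-]; exact: energym_ge0.
move=> a' b' /Hab[a'a bb'] x; have /andP[au ub] := uab x.
by rewrite (le_trans a'a)//= (le_trans ub).
Qed.

End HarmonicExtension.

(** * Harmonic extension to K and interpolation on cells *)

Section HarmonicInterpolation.
Variables (R : realType) (K : ptopologicalType) (N : nat) (L : selfSimilar K N).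
Variable HS : harmonicStructure R L.
Hypothesis pcf : post_critically_finite L.
Hypothesis K_compact : compact [set: K].
Hypothesis hK : hausdorff_space K.
Hypothesis K_connected : connected [set: K].
Hypothesis N_ge2 : (2 <= N)%N.
Hypothesis HS_regular : regular_harmonic HS.

Local Notation E0 := (energy0 L (hD HS)).
Local Notation Em := (energym L (hD HS) (hr HS)).
Local Notation F := (domF HS).
Local Notation E := (energy HS).
Local Notation "u \on w" := (u \o psi_word L w) (at level 40).

Let V0n : V0 L !=set0.
Proof.
apply: (V0_nonempty L K_compact hK K_connected N_ge2); by exists point.
Qed.

(* One step of the harmonic extension, from V_0 to V_1. *)
Definition hstep : (K -> R) -> K -> R :=
  projT1 (choice (harmonic_step_exists HS pcf K_compact hK K_connected N_ge2)).

Lemma hstepP v : [/\ forall q, V0 L q -> hstep v q = v q, Em 1 (hstep v) (hstep v) = E0 v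
  v &
      forall a b, (forall q, V0 L q -> a <= v q <= b) -> forall x, a <= hstep v x <= b].
Proof. by rewrite /hstep; case: choice. Qed.

(* The values on V_0 of (the harmonic function with boundary value [v]) o psi_w. *)
Definition hword (v : K -> R) (w : seq 'I_N) : K -> R :=
  foldl (fun u i => hstep u \o psi L i) v w.

Lemma hword_rcons v w i : hword v (rcons w i) = hstep (hword v w) \o psi L i.
Proof. by rewrite /hword -cats1 foldl_cat. Qed.

Lemma hword_bounds v w a b : (forall q, V0 L q -> a <= v q <= b) ->
  forall q, V0 L q -> a <= hword v w q <= b.
Proof.
elim/last_ind: w => [//|w i IH] H q Vq; rewrite hword_rcons /=.
have [_ _ ] := hstepP (hword v w); apply; exact: IH.
Qed.

Lemma energy0_hstep v i : E0 (hstep v \o psi L i) (hstep v \o psi L i) <= hr HS i * E0 v v.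
Proof.
have [_ <- _] := hstepP v.
have := @energym_le_cell _ _ _ _ HS pcf 1 0 (hstep v) [:: i] erefl.
by rewrite /rw big_seq1 energym0.
Qed.

Lemma energy0_hword v w : E0 (hword v w) (hword v w) <= rw HS w * E0 v v.
Proof.
elim/last_ind: w => [|w i IH]; first by rewrite /rw big_nil mul1r.
rewrite hword_rcons; apply: (le_trans (energy0_hstep _ _)).
rewrite -cats1 rw_cat [rw HS [:: i]]/rw big_seq1 (mulrC (rw HS w)) -mulrA.
by rewrite ler_wpM2l// ltW// hr_gt0.
Qed.

(** The value at the coded point, as the limit of the boundary values on the cells along [omega],
    uniformly over V_0. *)
Definition is_hlim v (omega : shift_space N) (l : R) := forall e, 0 < e ->
  exists k0, forall k, (k0 <= k)%N -> forall q, V0 L q ->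
    `|l - hword v (mkseq omega k) q| <= e.

Lemma is_hlim_unique v omega l l' : is_hlim v omega l -> is_hlim v omega l' -> l = l'.
Proof.
move=> Hl Hl'; apply/eqP/negPn/negP => ll'.
have e0 : 0 < `|l - l'| / 4 by rewrite divr_gt0// normr_gt0 subr_eq0.
have [k0 H0] := Hl _ e0; have [k1 H1] := Hl' _ e0; have [q Vq] := V0n.
have := H0 _ (leq_maxl k0 k1) q Vq; have := H1 _ (leq_maxr k0 k1) q Vq.
set y := hword _ _ _; rewrite (distrC l' y) => h1 h2.
have := ler_distD y l l'; lra.
Qed.

Lemma mkseq_add (T : Type) (f : nat -> T) m n :
  mkseq f (m + n) = mkseq f m ++ mkseq (fun k => f (m + k)%N) n.
Proof.
rewrite /mkseq iotaD map_cat add0n; congr (_ ++ _).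
by rewrite -[X in iota X]addn0 iotaDl -map_comp.
Qed.

Lemma hword_osc : exists2 C : R, 0 <= C & exists rho : R, [/\ 0 < rho, rho < 1 &
  forall v w p q, V0 L p -> V0 L q ->
    `|hword v w p - hword v w q| <= C * Num.sqrt (E0 v v) * rho ^+ size w].
Proof.
have [C C0 HC] := energy0_lb HS pcf; have [rho [rho0 rho1 Hrho]] := regular_ratio
  HS_regular.
exists (Num.sqrt C); first exact: sqrtr_ge0.
exists rho; split => // v w p q Vp Vq.
have E00 u : 0 <= E0 u u by rewrite -(energym0 HS); exact: energym_ge0.
rewrite -(ler_sqr (normr_ge0 _)) ?nnegrE; last first.
  by rewrite !mulr_ge0 ?sqrtr_ge0// exprn_ge0// ltW.
rewrite !exprMn !sqr_sqrtr// real_normK ?num_real//.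
apply: (le_trans (HC _ _ _ Vp Vq)); rewrite -mulrA ler_wpM2l//.
apply: (le_trans (energy0_hword _ _)); rewrite mulrC ler_wpM2l//.
by rewrite -exprM mulnC exprM.
Qed.

(** The range of the boundary values shrinks geometrically by [hword_osc], and the maximum principle
    [hword_bounds] keeps all later values within the current range. *)
Lemma hlim_exists v omega : exists l, is_hlim v omega l.
Proof.
have [C C0 [rho [rho0 rho1 Hosc]]] := hword_osc.
have [q0 Vq0] := V0n.
pose y k := hword v (mkseq omega k) q0.
pose c := C * Num.sqrt (E0 v v).
have c0 : 0 <= c by rewrite mulr_ge0 ?sqrtr_ge0.
have close k m : (k <= m)%N -> forall q, V0 L q ->
    `|y m - hword v (mkseq omega k) q| <= c * rho ^+ k.
  move=> km q Vq.
  have hull : forall p, V0 L p -> hword v (mkseq omega k) q - c * rho ^+ k <=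
      hword v (mkseq omega k) p <= hword v (mkseq omega k) q + c * rho ^+ k.
    move=> p Vp; have := Hosc v (mkseq omega k) p q Vp Vq.
    by rewrite size_mkseq ler_distl.
  have -> : y m = hword (hword v (mkseq omega k)) (mkseq (shift k omega) (m - k)) q0.
    by rewrite /y -[in LHS](subnKC km) mkseq_add /hword foldl_cat.
  by rewrite ler_distl; exact: (hword_bounds _ hull).
have clo k m : y k - c * rho ^+ k <= y m + c * rho ^+ m.
  have rk0 n : 0 <= c * rho ^+ n by rewrite mulr_ge0// exprn_ge0// ltW.
  have [km|/ltnW mk] := leqP k m.
    have := close k m km q0 Vq0; rewrite ler_distl -/(y k) => /andP[+ _].
    by have := rk0 m; lra.
  have := close m k mk q0 Vq0; rewrite ler_distl -/(y m) => /andP[_].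
  by have := rk0 k; lra.
(* Left endpoints of intervals any two of which meet, by [clo]; their supremum lies in every
   interval. *)
pose S := [set y k - c * rho ^+ k | k in [set: nat]].
have l1 k : y k - c * rho ^+ k <= sup S.
  apply: ub_le_sup; last by exists k.
  by exists (y 0%N + c * rho ^+ 0) => _ [m _ <-].
have l2 k : sup S <= y k + c * rho ^+ k.
  apply: ge_sup; first by exists (y 0%N - c * rho ^+ 0), 0%N.
  by move=> _ [m _ <-].
exists (sup S) => e e0.
have : (2 * c * rho ^+ k) @[k --> \oo] --> 2 * c * 0.
  by apply: cvgM; [exact: cvg_cst|apply: cvg_expr; rewrite ger0_norm// ltW].
rewrite mulr0 => /cvgrPdist_le /(_ _ e0)[k0 _ Hk0]; exists k0 => k kk0 q Vq.
have := Hk0 k kk0; rewrite /= sub0r normrN => /(le_trans (ler_norm _)) He.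
apply: le_trans He; have := close k k (leqnn k) q Vq; rewrite -/(y k) !ler_distl.
have := l1 k; have := l2 k; move=> *; apply/andP; split; lra.
Qed.

Definition hlim v omega : R := sval (cid (hlim_exists v omega)).

Lemma hlimP v omega : is_hlim v omega (hlim v omega).
Proof. by rewrite /hlim; case: cid. Qed.

Lemma hlim_cons v i omega :
  hlim v (shift_cons i omega) = hlim (hstep v \o psi L i) omega.
Proof.
apply: (is_hlim_unique (hlimP _ _)) => e e0.
have [k0 H] := hlimP (hstep v \o psi L i) omega e0.
exists k0.+1 => -[//|k] kk q Vq; rewrite mkseq_cons.
exact: (H k kk q Vq).
Qed.

Lemma hlim_bounds v omega a b : (forall q, V0 L q -> a <= v q <= b) ->
  a <= hlim v omega <= b.
Proof.
move=> H; have [q Vq] := V0n.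
apply/andP; split; apply/ler_addgt0Pr => e e0; have [k0 Hk0] := hlimP v omega e0;
  have := Hk0 k0 (leqnn _) q Vq; have := hword_bounds (mkseq omega k0) H Vq;
  rewrite ler_distl => /andP[h1 h2] /andP[h3 h4]; lra.
Qed.

(** The coded point is a boundary point of every cell along [alpha], and each extension step retains
    boundary values. *)
Lemma hlim_post v alpha : post_critical L alpha -> hlim v alpha = v (coding L alpha).
Proof.
move=> Pa; have Pk k : post_critical L (shift k alpha).
  elim: k => [//|k IH].
  by rewrite -addn1 -shift_shift; exact: post_critical_shift.
have wE k : hword v (mkseq alpha k) (coding L (shift k alpha)) = v (coding L alpha).
  elim: k => [//|k IH]; rewrite mkseqS hword_rcons /=.
  have -> : psi L (alpha k) (coding L (shift k.+1 alpha)) = coding L (shift k alpha).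
    rewrite psi_coding; congr (coding L _).
    by apply/funext => -[|j] /=; rewrite /Defs.shift ?addn0 ?addnS.
  have [HV _ _] := hstepP (hword v (mkseq alpha k)).
  by rewrite HV; [exact: IH|exists (shift k alpha); [exact: Pk|]].
apply/eqP; rewrite -subr_eq0 -normr_le0; apply/ler_addgt0Pr => e e0; rewrite add0r.
have [k0 Hk0] := hlimP v alpha e0.
by rewrite -(wE k0); apply: Hk0 => //; exists (shift k0 alpha); [exact: Pk|].
Qed.

(* Codes of a point of V_0 keep the boundary value, so that the two codes of a
   point common to two cells give the same limit. *)
Lemma hlim_wd v (alpha beta : shift_space N) : coding L alpha = coding L beta ->
  hlim v alpha = hlim v beta.
Proof.
move=> ab; have [->//|/eqP nab] := eqVneq alpha beta.
have [k nk] : exists k, mkseq alpha k <> mkseq beta k.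
  apply: contrapT => /forallNP H; apply: nab; apply/funext => k.
  have := contrapT (H k.+1); rewrite !mkseqS => /eqP.
  by rewrite eqseq_rcons => /andP[_ /eqP].
have split (omega : shift_space N) :
    omega = shift_cons (omega 0%N) (shift 1 omega).
  by apply/funext => -[].
elim: k v alpha beta ab nab nk => [//|k IH] v alpha beta ab nab nk.
(* The case of different first letters; a common first letter is stripped afterwards, using that
   psi_i is injective. *)
have nk1 : mkseq alpha 1 <> mkseq beta 1 -> hlim v alpha = hlim v beta.
  move=> n1; have Pa := post_critical_split ab n1.
  have Pb := post_critical_split (esym ab) (nesym n1).
  rewrite [in LHS](split alpha) [in RHS](split beta) !hlim_cons !hlim_post//=.
  by rewrite !psi_coding -!split ab.
have [e0|/eqP n0] := eqVneq (alpha 0%N) (beta 0%N); last by apply: nk1 => -[].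
have ab1 : coding L (shift 1 alpha) = coding L (shift 1 beta).
  apply: (@psi_injective _ _ L (alpha 0%N)); rewrite [in RHS]e0 !psi_coding.
  by rewrite -!split.
rewrite [in LHS](split alpha) [in RHS](split beta) !hlim_cons e0.
apply: IH => //; first by move=> H; apply: nab; rewrite (split alpha) H e0 -split.
move: nk; rewrite !mkseq_cons e0 => nk H; apply: nk; congr (_ :: _).
exact: H.
Qed.

Definition hext v x := hlim v (code L x).

Lemma hext_coding v omega : hext v (coding L omega) = hlim v omega.
Proof. by apply: hlim_wd; rewrite coding_code. Qed.

Lemma hext_psi v i x : hext v (psi L i x) = hext (hstep v \o psi L i) x.
Proof.
by rewrite -{1}(coding_code L x) psi_coding hext_coding hlim_cons.
Qed.

Lemma hext_psi_word v w x : hext v (psi_word L w x) = hext (hword v w) x.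
Proof. by elim: w v => [//|i w IH] v /=; rewrite hext_psi IH. Qed.

Lemma hext_V0 v q : V0 L q -> hext v q = v q.
Proof. by move=> [alpha Pa <-]; rewrite hext_coding hlim_post. Qed.

Lemma hext_bounds v a b : (forall q, V0 L q -> a <= v q <= b) ->
  forall x, a <= hext v x <= b.
Proof. by move=> H x; exact: hlim_bounds. Qed.

(** Each extension step attains the infimum E_0, so refinement adds no energy. *)
Lemma energym_hext m v : Em m (hext v) (hext v) = E0 v v.
Proof.
elim: m v => [|m IH] v.
  by rewrite energym0; apply: eq_energy0 => // q Vq; rewrite hext_V0.
rewrite energymS//; have [_ <- _] := hstepP v; rewrite energymS//.
apply: eq_bigr => i _; congr (_ * _); rewrite energym0.
rewrite (_ : hext v \o psi L i = hext (hstep v \o psi L i)) ?IH//.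
by apply/funext => x /=; exact: hext_psi.
Qed.

Definition interp n (f : K -> R) (x : K) :=
  hext (f \on code_prefix L x n) (coding L (shift n (code L x))).

(** [interp] uses the cell of the selected code. A point that lies in another cell of the same level
    is the image of a boundary point in both, and there both extensions return the value of [f]. *)
Lemma interp_psi_word n f w y : size w = n ->
  interp n f (psi_word L w y) = hext (f \on w) y.
Proof.
move=> sw; rewrite /interp; set x := psi_word L w y.
set v := code_prefix L x n; set z := coding L _.
have xE : x = psi_word L v z by exact: code_prefixE.
have sv : size v = n by rewrite size_code_prefix.
have [vw|/eqP vw] := eqVneq w v.
  by rewrite -vw; congr (hext _ _); apply: (@psi_word_inj _ _ L v); rewrite -xE -vw.
have sz : size w = size v by rewrite sw.
have Vy : V0 L y by apply: (cell_meet sz vw (etrans (erefl x) xE)).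
have Vz : V0 L z by apply: (cell_meet (esym sz) (nesym vw) (esym (etrans (erefl x) xE))).
by rewrite !hext_V0//= -xE.
Qed.

Lemma interp_cell n f w : size w = n -> interp n f \on w = hext (f \on w).
Proof. by move=> sw; apply/funext => y; exact: interp_psi_word. Qed.

Lemma interp_V n f x : V L n x -> interp n f x = f x.
Proof. by move=> [w /= sw [q Vq <-]]; rewrite interp_psi_word// hext_V0. Qed.

Lemma energym_interp m n f : Em (n + m) (interp n f) (interp n f) = Em n f f.
Proof.
rewrite energym_cat// [RHS]/energym; apply: eq_bigr => w _.
by rewrite interp_cell ?size_tuple// energym_hext.
Qed.

(** The cells of level [M] that avoid [x] form a closed set, and every point off it shares with [x]
    a cell of that level. *)
Lemma continuous_cells (u : K -> R) : (forall e, 0 < e -> exists M, forall w,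
    size w = M -> forall x y, `|u (psi_word L w x) - u (psi_word L w y)| <= e) ->
  continuous u.
Proof.
move=> H x; apply/cvgrPdist_le => e e0; have [M HM] := H _ e0.
pose B := \bigcup_(w in [set w : M.-tuple 'I_N | ~ cell L w x]) cell L w.
have cB : closed B.
  apply: closed_bigcup => [|w _]; first exact: finite_finset.
  exact: closed_cell.
have oB : open (~` B) by rewrite openC.
have nB : nbhs x (~` B) by apply: open_nbhs_nbhs; split => // -[w].
apply: filterS nB => y /= nBy; set w := code_prefix L y M.
have Cx : cell L w x.
  apply: contrapT => nx; apply: nBy; exists [tuple of w] => //=.
  exact: cell_code_prefix.
have sw : size w = M by rewrite size_code_prefix.
have [x' _ <-] := Cx; rewrite (code_prefixE L y M); exact: HM.
Qed.

Lemma interp_continuous n f : continuous (interp n f).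
Proof.
have [C C0 [rho [rho0 rho1 Hosc]]] := hword_osc.
have [rho' [rho'0 rho'1 Hrw]] := regular_ratio HS_regular.
apply: continuous_cells => e e0.
have [q0 Vq0] := V0n.
pose c := C * Num.sqrt (Em n f f).
have c0 : 0 <= c by rewrite mulr_ge0 ?sqrtr_ge0.
have : (2 * c * rho ^+ k) @[k --> \oo] --> 2 * c * 0.
  by apply: cvgM; [exact: cvg_cst|apply: cvg_expr; rewrite ger0_norm// ltW].
rewrite mulr0 => /cvgrPdist_le /(_ _ e0)[k _ /(_ k (leqnn k))] /=.
rewrite sub0r normrN => /(le_trans (ler_norm _)) He.
exists (n + k)%N => w sw x y.
have -> : w = take n w ++ drop n w by rewrite cat_take_drop.
have s1 : size (take n w) = n by rewrite size_takel// sw leq_addr.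
have s2 : size (drop n w) = k by rewrite size_drop sw addKn.
move: (take n w) (drop n w) s1 s2 => w1 w2 s1 s2.
rewrite !psi_word_cat !interp_psi_word// !hext_psi_word.
set v := hword _ _.
have hull : forall p, V0 L p -> v q0 - c * rho ^+ k <= v p <= v q0 + c * rho ^+ k.
  move=> p Vp; rewrite -ler_distl; apply: le_trans (Hosc _ _ _ _ Vp Vq0) _.
  rewrite s2 ler_wpM2r ?exprn_ge0 ?(ltW rho0)// ler_wpM2l// ler_sqrt ?energym_ge0//.
  have := @energym_le_cell _ _ _ _ HS pcf n 0 f w1 s1;
  rewrite addn0 energym0 => /le_trans; apply.
  rewrite -[leRHS]mul1r ler_wpM2r ?energym_ge0//.
  apply: le_trans (Hrw w1) _; apply: exprn_ile1; first exact: sqr_ge0.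
  by rewrite exprn_ile1// ltW.
have /andP[hx1 hx2] := hext_bounds hull x; have /andP[hy1 hy2] := hext_bounds hull y.
by rewrite ler_norml; apply/andP; split; lra.
Qed.

Lemma domF_interp n f : F (interp n f).
Proof.
apply/domFP => //; split; first exact: interp_continuous.
exists (Em n f f) => m; rewrite -(energym_interp m n f) addnC.
by apply: energym_homo => //; exact: leq_addr.
Qed.

Lemma energy_interp n f : E (interp n f) (interp n f) = Em n f f.
Proof.
apply/eqP; rewrite eq_le; apply/andP; split.
  apply: energy_le => //; first exact: domF_interp.
  move=> m; rewrite -(energym_interp m n f) addnC.
  by apply: energym_homo => //; exact: leq_addr.
rewrite -(energym_interp 0 n f); apply: energym_le_energy => //.
exact: domF_interp.
Qed.

End HarmonicInterpolation.

(** * Energy measures of cells *)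

Lemma borel_continuous_measurable (R : realType) (K : ptopologicalType) (f : K -> R) :
  continuous f -> measurable_fun [set: borel K] (f : borel K -> R).
Proof.
move=> /continuousP cf; apply: (measurability _ (RGenOpens.measurableE R)).
move=> _ [_ [a [b ->] <-]]; rewrite setTI; apply: sub_sigma_algebra.
exact/cf/interval_open.
Qed.

Section PointMasses.
Variables (R : realType) (K : ptopologicalType) (N : nat) (L : selfSimilar K N).
Variable HS : harmonicStructure R L.
Hypothesis pcf : post_critically_finite L.
Hypothesis K_compact : compact [set: K].
Hypothesis hK : hausdorff_space K.
Hypothesis K_connected : connected [set: K].
Hypothesis N_ge2 : (2 <= N)%N.
Hypothesis HS_regular : regular_harmonic HS.

Local Notation Em := (energym L (hD HS) (hr HS)).
Local Notation F := (domF HS).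
Local Notation E := (energy HS).
Local Notation "u \on w" := (u \o psi_word L w) (at level 40).

Lemma energym_small m f e : 0 < e -> exists2 d, 0 < d & forall u,
  (forall x y, `|u x - u y| <= d) -> Em m f u <= e.
Proof.
move=> e0; have [s s0 Hs] := energym_dform HS pcf m.
pose S := \sum_(t <- s) `|t.1.1 * (f t.1.2 - f t.2)|.
have S0 : 0 <= S by apply: sumr_ge0.
exists (e / (S + 1)); first by rewrite divr_gt0// ltr_wpDl.
move=> u Hu; rewrite Hs /dform; apply: (@le_trans _ _ (S * (e / (S + 1)))).
  rewrite /S big_distrl /=; apply: ler_sum => t _.
  apply: le_trans (ler_norm _) _; rewrite mulrA normrM ler_wpM2l//.
by rewrite mulrCA ler_piMr ?(ltW e0)// ler_pdivrMr ?mul1r ?lerDl// ltr_wpDl.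
Qed.

Definition clip (d t : R) := Num.min d (Num.max (- d) t).

Lemma clip_le d s t : s <= t -> clip d s <= clip d t.
Proof.
by move=> st; rewrite /clip le_min ge_min lexx/= ge_min ge_max !le_max lexx st !orbT.
Qed.

Lemma clip_bound d t : 0 <= d -> `|clip d t| <= d.
Proof.
move=> d0; rewrite ler_norml /clip le_min le_max ge_min !lexx /= andbT.
by rewrite lerNl (le_trans _ d0)// oppr_le0.
Qed.

Lemma clip_id d t : `|t| <= d -> clip d t = t.
Proof.
by rewrite ler_norml /clip => /andP[dt td]; rewrite (max_idPr dt) (min_idPr td).
Qed.

(** E(f, u) is split into E_n(f, u) and a rest. Cauchy-Schwarz for the nonnegative form E - E_n
    makes the rest small once E_n(f, f) is close to E(f, f), since truncation does not raise the
    energy. With n fixed, E_n(f, u) is a finite sum that is small with the height of the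
    truncation. *)
Lemma energy_clip f p e : F f -> 0 < e -> exists2 d, 0 < d &
  forall u, u = (fun x => clip d (f x - f p)) -> F u /\ E f u <= e.
Proof.
move=> Ff e0.
have [n Hn] : exists n, (E f f - Em n f f) * (E f f) <= (e / 2) ^+ 2.
  have : (E f f - Em n f f) * E f f @[n --> \oo] --> (E f f - E f f) * E f f.
    apply: cvgM; last exact: cvg_cst.
    by apply: cvgB; [exact: cvg_cst|exact: energy_cvg].
  rewrite subrr mul0r => /cvgrPdist_le /(_ ((e / 2) ^+ 2)) [].
    by rewrite exprn_gt0// divr_gt0.
  move=> n _ /(_ n (leqnn n)); rewrite /= sub0r normrN => H; exists n.
  exact: le_trans (ler_norm _) H.
have [d d0 Hd] := @energym_small n f (e / 2) (divr_gt0 e0 (ltr0n _ 2)).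
exists (d / 2); first by rewrite divr_gt0.
move=> u uE; have d20 : 0 <= d / 2 by rewrite ltW// divr_gt0.
have uf x y : `|u x - u y| <= `|f x - f y|.
  rewrite uE; apply: (le_trans (clip_lip _ _ _ _)).
  by rewrite (_ : f x - f p - (f y - f p) = f x - f y)//; ring.
have Fu : F u.
  apply: (domF_lip pcf Ff) => // x; rewrite uE.
  apply: (@continuous_comp _ _ _ (fun x => f x - f p) (clip (d / 2))).
    apply: continuousB; [by case: Ff => cf _; exact: cf|exact: cst_continuous].
  apply/cvgrPdist_le => e' e'0; near=> t.
  apply: (le_trans (clip_lip _ _ _ _)); near: t.
  by apply: cvgr_dist_le => //; exact: cvg_id.
split => //.
have H1 : Em n f u <= e / 2.
  apply: Hd => x y; apply: (le_trans (ler_normB _ _)).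
  by rewrite (splitr d) lerD// uE clip_bound.
have H2 : (E f u - Em n f u) ^+ 2 <= (e / 2) ^+ 2.
  apply: le_trans Hn.
  apply: (@le_trans _ _ ((E f f - Em n f f) * (E u u - Em n u u))).
    rewrite mulrC; apply: discr_le0; last first.
      by rewrite subr_ge0; exact: energym_le_energy.
    move=> t; have := energym_le_energy pcf n (domF_lin pcf t Ff Fu).
    rewrite energy_sq// energym_sq// -subr_ge0; congr (_ <= _); ring.
  have h1 : 0 <= E f f - Em n f f by rewrite subr_ge0; exact: energym_le_energy.
  apply: ler_wpM2l => //; apply: (@le_trans _ _ (E u u)).
    by rewrite gerBl energym_ge0.
  apply: energy_le => // m; apply: le_trans (energym_le_energy pcf m Ff).
  by have [s s0 Hs] := energym_dform HS pcf m; rewrite !Hs; exact: le_dform.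
have e20 : 0 <= e / 2 by rewrite divr_ge0// ltW.
have : E f u - Em n f u <= e / 2.
  by rewrite leNgt; apply/negP => H; nra.
lra.
Unshelve. all: by end_near.
Qed.

(* The measure of the cell K_w under the energy measure of [f]; see [nu_cylinder]. *)
Definition ecell f (w : seq 'I_N) := (rw HS w)^-1 * (2 * E (f \on w) (f \on w)).

Lemma ecell_ge0 f w : F f -> 0 <= ecell f w.
Proof.
move=> Ff; rewrite mulr_ge0 ?invr_ge0 ?(ltW (rw_gt0 _ _))// mulr_ge0//.
by apply: energy_ge0 => //; exact: domF_cell.
Qed.

Lemma ecell_cat f n w : F f ->
  ecell f w = \sum_(v : n.-tuple 'I_N) ecell f (w ++ v).
Proof.
move=> Ff; rewrite /ecell (energy_cat pcf n (domF_cell pcf w Ff) (domF_cell pcf w Ff)).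
rewrite !big_distrr /=; apply: eq_bigr => v _.
rewrite rw_cat invfM (_ : (f \on w) \on v = f \on (w ++ v)); first by ring.
by apply/funext => x /=; rewrite psi_word_cat.
Qed.

Lemma ecell_nil f : ecell f [::] = 2 * E f f.
Proof. by rewrite /ecell /rw big_nil invr1 mul1r. Qed.

Lemma ecell_sum f n : F f -> 2 * E f f = \sum_(v : n.-tuple 'I_N) ecell f v.
Proof. by move=> Ff; rewrite -ecell_nil (ecell_cat n). Qed.

(* Points carry no energy: near [p], [f] coincides up to a constant with its
   truncation at a small height, whose mutual energy with [f] is small. *)
Lemma ecell_point_small f p e : F f -> 0 < e -> exists M, forall m, (M <= m)%N ->
  \sum_(u : m.-tuple 'I_N | `[< cell L u p >]) ecell f u <= e.
Proof.
move=> Ff e0; have [d d0 Hd] := energy_clip p Ff (divr_gt0 e0 (ltr0n _ 2)).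
have [Fu Eu] := Hd _ erefl; set u := fun x => _ in Fu Eu.
have [C C0 HC] := energy_osc_domF pcf K_compact hK K_connected N_ge2 HS_regular.
have [rho [rho0 rho1 Hrho]] := regular_ratio HS_regular.
have : (C * Num.sqrt (E f f) * rho ^+ k) @[k --> \oo] --> C * Num.sqrt (E f f) * 0.
  by apply: cvgM; [exact: cvg_cst|apply: cvg_expr; rewrite ger0_norm// ltW].
rewrite mulr0 => /cvgrPdist_le /(_ _ d0)[M _ HM]; exists M => m Mm.
have := HM m Mm; rewrite /= sub0r normrN => /(le_trans (ler_norm _)) He {HM}.
apply: (@le_trans _ _ (2 * E f u)); last by lra.
(* Cells that avoid [p] contribute nonnegatively because the truncation is monotone. On cells
   through [p] it is inactive, as [f] oscillates there by at most [d], and the mutual energy is the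
   full energy. *)
rewrite (energy_cat pcf m Ff Fu) big_distrr /= [leRHS](bigID (fun v : m.-tuple 'I_N =>
  `[< cell L v p >])) /=.
rewrite -[leLHS]addr0; apply: lerD; last first.
  apply: sumr_ge0 => v _; rewrite !mulr_ge0 ?invr_ge0 ?(ltW (rw_gt0 _ _))//.
  have := energy_cvg pcf (domF_cell pcf v Ff) (domF_cell pcf v Fu).
  move=> /cvgr_to_ge; apply; apply: nearW => k.
  have [s s0 ->] := energym_dform HS pcf k; apply: dform_ge0 => // x y /=.
  have [fxy|/ltW fxy] := lerP (f (psi_word L v x)) (f (psi_word L v y)).
    by rewrite mulr_le0 ?subr_le0// /u; apply: clip_le; rewrite lerB.
  by rewrite mulr_ge0 ?subr_ge0// /u; apply: clip_le; rewrite lerB.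
apply: ler_sum => v /asboolP[y _ Hy].
rewrite /ecell [leRHS]mulrCA ler_wpM2l ?invr_ge0 ?(ltW (rw_gt0 _ _))// ler_wpM2l//.
have Fv := domF_cell pcf v Ff.
have uE : u \on v = fun x => 1 * (f \on v) x + - f p.
  apply/funext => x /=; rewrite /u clip_id ?mul1r// -Hy.
  apply: (le_trans (HC _ Fv x y)); apply: le_trans He; rewrite -mulrA ler_wpM2l//.
  have -> : Num.sqrt (E f f) * rho ^+ m = Num.sqrt ((rho ^+ 2) ^+ m * E f f).
    have -> : (rho ^+ 2) ^+ m = (rho ^+ m) ^+ 2 by rewrite -!exprM mulnC.
    rewrite (sqrtrM _ (sqr_ge0 _)) sqrtr_sqr ger0_norm ?exprn_ge0 ?(ltW rho0)//.
    by rewrite mulrC.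
  rewrite ler_sqrt; last by rewrite mulr_ge0 ?energy_ge0// exprn_ge0// sqr_ge0.
  apply: energy_le => // k.
  have := @energym_le_cell _ _ _ _ HS pcf _ k f v erefl => /le_trans; apply.
  apply: ler_pM; rewrite ?(ltW (rw_gt0 _ _)) ?energym_ge0//.
    by have := Hrho v; rewrite size_tuple.
  exact: energym_le_energy.
rewrite uE [leRHS](energyC HS pcf).
have -> : E (fun x => 1 * (f \on v) x + - f p) (f \on v) =
    1 * E (f \on v) (f \on v) + E (fun=> - f p) (f \on v).
  exact: (energyDl pcf 1 Fv (domF_cst HS pcf (- f p)) Fv).
rewrite mul1r lerDl.
have := energy_CS pcf (domF_cst HS pcf (- f p)) Fv.
have -> : E (fun=> - f p) (fun=> - f p) = 0.
  rewrite /energy (_ : (fun m => _) = fun=> 0) ?lim_cst//.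
  apply/funext => k; have [s s0 ->] := energym_dform HS pcf k.
  by rewrite /dform big1// => t _; rewrite subrr !mulr0.
rewrite mul0r => H; suff /eqP -> : E (fun=> - f p) (f \on v) == 0 by [].
by rewrite -sqrf_eq0 eq_le H sqr_ge0.
Qed.

End PointMasses.

(** * Masses of cylinders *)

Section CellMeasures.
Variables (R : realType) (K : ptopologicalType) (N : nat) (L : selfSimilar K N).
Variable HS : harmonicStructure R L.
Variable nu : (K -> R) -> {finite_measure set (borel K) -> \bar R}.
Hypothesis pcf : post_critically_finite L.
Hypothesis K_compact : compact [set: K].
Hypothesis hK : hausdorff_space K.
Hypothesis K_connected : connected [set: K].
Hypothesis N_ge2 : (2 <= N)%N.
Hypothesis HS_regular : regular_harmonic HS.
Hypothesis nu_energy : energy_measures HS nu.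

Local Notation Em := (energym L (hD HS) (hr HS)).
Local Notation F := (domF HS).
Local Notation E := (energy HS).
Local Notation "u \on w" := (u \o psi_word L w) (at level 40).

Lemma cvg_energy_integral f phi : F f -> F phi ->
  2 * Em m (f \* phi) f - Em m phi (f \* f) @[m --> \oo] --> \int[nu f]_x phi x.
Proof.
move=> Ff Fp; rewrite nu_energy//.
have Ffp : F (f \* phi) by apply: domF_mul.
have Fff : F (f \* f) by apply: domF_mul.
apply: cvgB; last exact: energy_cvg.
by apply: cvgM; [exact: cvg_cst|exact: energy_cvg].
Qed.

Lemma nu_total f : F f -> fine (nu f setT) = 2 * E f f.
Proof.
move=> Ff; have F1 := domF_cst HS pcf 1.
have <- : \int[nu f]_x (fun=> 1) x = fine (nu f setT).
  by rewrite Rintegral_cst// mul1r.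
apply: (@cvg_unique _ (@Rhausdorff R) _ _ _ _ (cvg_energy_integral Ff F1)).
rewrite (_ : (fun m => _) = (fun m => 2 * Em m f f)).
  by apply: cvgM; [exact: cvg_cst|exact: energy_cvg].
apply/funext => m; have [s _ Hs] := energym_dform HS pcf m.
by rewrite !Hs -dcharge1.
Qed.

(** At levels beyond [m] the discrete charge splits over the cells of level [m]: at most the energy
    term where [S] holds, zero where [phi] vanishes. The bound passes to the limit. *)
Lemma integral_le_ecell f phi m (S : pred (m.-tuple 'I_N)) : F f -> F phi ->
  (forall x, phi x <= 1) ->
  (forall w : m.-tuple 'I_N, ~~ S w -> forall x, phi (psi_word L w x) = 0) ->
  \int[nu f]_x phi x <= \sum_(w : m.-tuple 'I_N | S w) ecell HS f w.
Proof.
move=> Ff Fp p1 pS; have := cvg_energy_integral Ff Fp.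
rewrite -(cvg_shiftn m) => /cvgr_to_le; apply; apply: nearW => k /=.
rewrite addnC !energym_cat// big_distrr -sumrB /= [leRHS]big_mkcond /=.
apply: ler_sum => w _.
have [s s0 Hs] := energym_dform HS pcf k; rewrite !Hs.
have -> : 2 * ((rw HS w)^-1 * dform s ((f \* phi) \on w) (f \on w)) -
    (rw HS w)^-1 * dform s (phi \on w) ((f \* f) \on w) =
    (rw HS w)^-1 * dcharge s (f \on w) (phi \on w).
  by rewrite /dcharge mulrBr; congr (_ - _); rewrite mulrCA.
have rw0 : 0 <= (rw HS w)^-1 by rewrite invr_ge0 ltW// rw_gt0.
case: ifPn => Sw.
  rewrite /ecell ler_wpM2l//; apply: (@le_trans _ _ (2 * Em k (f \on w) (f \on w))).
    by rewrite Hs; apply: dcharge_le => // x /=.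
  by rewrite ler_wpM2l//; apply: energym_le_energy => //; exact: domF_cell.
rewrite (_ : phi \on w = fun=> 0); last by apply/funext => x /=; exact: pS.
by rewrite dcharge0 mulr0.
Qed.

Lemma borel_closed_measurable (A : set K) : closed A -> measurable (A : set (borel K)).
Proof.
move=> cA; rewrite -(setCK A); apply: measurableC; apply: sub_sigma_algebra.
by rewrite /= openC.
Qed.

Lemma borel_finite_measurable (A : set K) : finite_set A -> measurable (A : set (borel K)).
Proof.
move=> fA; apply: borel_closed_measurable; apply: compact_closed => //.
exact: finite_compact.
Qed.

Lemma measurable_cell w : measurable (cell L w : set (borel K)).
Proof. by apply: borel_closed_measurable; exact: closed_cell. Qed.

Lemma nu_cell_le_integral f phi w : F phi -> (forall x, 0 <= phi x) ->
  (forall x, cell L w x -> phi x = 1) -> fine (nu f (cell L w)) <= \int[nu f]_x phi x.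
Proof.
move=> Fp p0 p1; have mw := measurable_cell w.
have <- : \int[nu f]_(x in (cell L w : set (borel K))) 1 = fine (nu f (cell L w)).
  by rewrite Rintegral_cst// mul1r.
rewrite Rintegral_mkcond; apply: le_Rintegral => //.
- rewrite -restrict_EFin; apply/integrable_restrict => //.
  rewrite setTI; exact: finite_measure_integrable_cst.
- apply: measurable_bounded_integrable => //.
  + by rewrite -ge0_fin_numE//; exact: fin_num_measure.
  + by apply: borel_continuous_measurable; case: Fp.
  + have [a Ha] := domF_bounded pcf K_compact hK K_connected N_ge2 HS_regular Fp.
    by exists a; split; [exact: num_real|move=> b ab x _; apply: (le_trans (Ha x));
    exact: ltW].
- move=> x _; rewrite patchE; case: ifPn => [|_]; last exact: p0.
  by rewrite inE => /p1 ->.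
Qed.

(* Test the energy measure against the harmonic interpolation, at a finer level, of
   the indicator of the cell: only cells around the points of psi_w(V_0) add to the
   energy of the cell itself. *)
Lemma nu_cell_le f w : F f -> fine (nu f (cell L w)) <= ecell HS f w.
Proof.
move=> Ff; apply/ler_addgt0Pr => e e0.
set n := size w.
pose sV : seq K := finmap.enum_fset (fset_set (V0 L)).
have mem_sV q : (q \in sV) = (q \in V0 L) by exact: in_fset_set (finite_V0 pcf) q.
(* The error [e] is shared among the points of V_0; the added 1 keeps the divisor positive. *)
pose c := (size sV)%:R + 1 : R.
have c0 : 0 < c by rewrite ltr_wpDl.
have /choice[M HM] q : exists M, forall m, (M <= m)%N ->
    \sum_(u : m.-tuple 'I_N | `[< cell L u (psi_word L w q) >]) ecell HS f u <= e / c.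
  apply: (ecell_point_small pcf K_compact hK K_connected N_ge2 HS_regular) => //.
  by rewrite divr_gt0.
pose m := (n + \max_(q <- sV) M q)%N.
have Mm q : q \in sV -> (M q <= m)%N.
  by move=> qs; apply: leq_trans (leq_addl _ _); rewrite (big_rem q)//= leq_maxl.
pose chi x : R := if `[< cell L w x >] then 1 else 0.
pose phi := interp pcf K_compact hK K_connected N_ge2 HS_regular m chi.
have Fphi : F phi by exact: domF_interp.
have phi01 x : 0 <= phi x <= 1.
  rewrite (code_prefixE L x m) /phi interp_psi_word ?size_code_prefix//.
  by apply: hext_bounds => q Vq /=; rewrite /chi; case: ifP; rewrite ?lexx ler01.
have phi1 x : cell L w x -> phi x = 1.
  move=> [y _ <-].
  rewrite {1}(code_prefixE L y (m - n)) -psi_word_cat /phi interp_psi_word; last first.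
    by rewrite size_cat size_code_prefix subnKC// leq_addr.
  apply/eqP; rewrite eq_le andbC; apply: hext_bounds => q Vq /=.
  rewrite /chi asboolT ?lexx// psi_word_cat;
  by exists (psi_word L (code_prefix L y (m - n)) q).
pose S (u : m.-tuple 'I_N) := `[< cell L u `&` cell L w !=set0 >].
have phiS (u : m.-tuple 'I_N) : ~~ S u -> forall x, phi (psi_word L u x) = 0.
  move=> /asboolPn nS x; rewrite /phi interp_psi_word ?size_tuple//.
  apply/eqP; rewrite eq_le andbC; apply: hext_bounds => q Vq /=.
  rewrite /chi asboolF ?lexx// => Cw; apply: nS.
  by exists (psi_word L u q); split => //; exists q.
apply: (@le_trans _ _ (\int[nu f]_x phi x)).
  by apply: nu_cell_le_integral => // x; case/andP: (phi01 x).
apply: (@le_trans _ _ (\sum_(u : m.-tuple 'I_N | S u) ecell HS f u)).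
  by apply: integral_le_ecell => // x; case/andP: (phi01 x).
rewrite (bigID (fun u : m.-tuple 'I_N => take n u == w)) /= lerD//.
  rewrite (ecell_cat pcf (\max_(q <- sV) M q) w Ff).
  pose G u := if take n u == w then ecell HS f u else 0.
  have G0 u : 0 <= G u by rewrite /G; case: ifP => // _; exact: ecell_ge0.
  apply: (@le_trans _ _ (\sum_(u : m.-tuple 'I_N) G u)).
    rewrite big_mkcond; apply: ler_sum => u _.
    case: ifPn => [/andP[_ tu]|_]; last exact: G0.
    by rewrite /G tu.
  rewrite /m (big_tuple_cat _ _ G) (bigD1 (in_tuple w))//= [X in _ + X]big1 ?addr0.
    by apply: ler_sum => v _; rewrite /G take_size_cat// eqxx.
  move=> w' nw'; rewrite big1// => v _; rewrite /G take_size_cat ?size_tuple//.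
  by rewrite ifN//; apply: contra nw' => /eqP H; apply/eqP/val_inj.
apply: (@le_trans _ _ (\sum_(q <- sV) \sum_(u : m.-tuple 'I_N |
    `[< cell L u (psi_word L w q) >]) ecell HS f u)).
  under [leRHS]eq_bigr do rewrite big_mkcond /=.
  rewrite exchange_big /= big_mkcond /=; apply: ler_sum => u _.
  have e0u : 0 <= ecell HS f u by exact: ecell_ge0.
  case: ifPn => [/andP[/asboolP[x [[z _ Hz] [y _ Hy]]] nw]|_]; last first.
    by apply: sumr_ge0 => q _; case: ifP.
  have Vy : V0 L y.
    have uE : u = take n u ++ drop n u :> seq _ by rewrite cat_take_drop.
    have sz : size w = size (take n u) by rewrite size_takel// size_tuple leq_addr.
    apply: (@cell_meet _ _ L w (take n u) y (psi_word L (drop n u) z)) => //.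
      by move=> H; rewrite -H eqxx in nw.
    by rewrite -psi_word_cat -uE Hy.
  have ys : y \in sV by rewrite mem_sV inE.
  rewrite (big_rem y)//= ifT; last by apply/asboolP; rewrite Hy -Hz; exists z.
  by rewrite lerDl; apply: sumr_ge0 => q _; case: ifP.
apply: (@le_trans _ _ (\sum_(q <- sV) e / c)).
  by rewrite !big_seq; apply: ler_sum => q qs; apply: HM; exact: Mm.
rewrite big_const_seq count_predT iter_addr_0 -mulr_natr mulrAC ler_pdivrMr//.
by rewrite ler_wpM2l ?(ltW e0)// lerDl.
Qed.

Local Notation cyl := (@cylinder _ (borel K) N (code L)).

Lemma cylinder_sub_cell w : cyl w `<=` cell L w.
Proof. by move=> x; rewrite /cylinder /= => H; rewrite -H; exact: cell_code_prefix. Qed.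

(** The code is an arbitrary selection, but it affects only finitely many points here: a cylinder is
    a closed cell minus a subset of psi_w(V_0). *)
Lemma measurable_code_cylinder w : measurable (cyl w : set (borel K)).
Proof.
have -> : cyl w = cell L w `\` (cell L w `&` ~` cyl w).
  rewrite setDIr setDv set0U setDE setCK; apply/esym/setIidPr.
  exact: cylinder_sub_cell.
apply: measurableD; first exact: measurable_cell.
apply: borel_finite_measurable.
apply: (@sub_finite_set _ _ (psi_word L w @` V0 L)); last first.
  by apply: finite_image; exact: finite_V0.
move=> x [[y _ <-]] /= nw; exists y => //.
apply: (@cell_meet _ _ L w (code_prefix L (psi_word L w y) (size w)) y
    (coding L (shift (size w) (code L (psi_word L w y))))).
- by rewrite size_code_prefix.
- by move=> H; apply: nw; exact: esym H.
- by rewrite -code_prefixE.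
Qed.

(** Each cylinder has at most the mass of its cell, hence at most [ecell]. Over the words of one
    length both quantities add up to 2 E(f), so no inequality can be strict. *)
Lemma nu_cylinder f w : F f -> nu f (cyl w) = (ecell HS f w)%:E.
Proof.
move=> Ff; set n := size w.
have fin A : measurable A -> nu f A = (fine (nu f A))%:E.
  by move=> mA; rewrite fineK// fin_num_measure.
have le1 (v : n.-tuple 'I_N) : fine (nu f (cyl v)) <= ecell HS f v.
  apply: le_trans (nu_cell_le v Ff); apply: fine_le.
  - by apply: fin_num_measure; exact: measurable_code_cylinder.
  - by apply: fin_num_measure; exact: measurable_cell.
  - apply: le_measure; rewrite ?inE; [exact: measurable_code_cylinder|exact:
    measurable_cell|].
    exact: cylinder_sub_cell.
have tot : \sum_(v : n.-tuple 'I_N) fine (nu f (cyl v)) =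
    \sum_(v : n.-tuple 'I_N) ecell HS f v.
  rewrite -ecell_sum// -nu_total//.
  have -> : [set: borel K] = \bigcup_(v in [set: n.-tuple 'I_N]) cyl v.
    apply/seteqP; split => // x _; exists [tuple of mkseq (code L x) n] => //.
    exact: mem_cylinder.
  have finT : finite_set [set: n.-tuple 'I_N] by exact: finite_finset.
  have mT (v : n.-tuple 'I_N) : [set: n.-tuple 'I_N] v -> measurable (cyl v).
    by move=> _; exact: measurable_code_cylinder.
  rewrite (measure_fin_bigcup (nu f) finT (@trivIset_cylinder _ (borel K) _ _ _ _) mT).
  have -> : [set: n.-tuple 'I_N] = [set` index_enum (n.-tuple 'I_N)].
    by apply/seteqP; split => // v _ /=; rewrite mem_index_enum.
  rewrite -fsbig_seq ?index_enum_uniq//=.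
  transitivity (fine (\sum_(v : n.-tuple 'I_N) (fine (nu f (cyl v)))%:E)%E).
    by rewrite sumEFin.
  congr fine; apply: eq_bigr => v _; rewrite -fin//.
  exact: measurable_code_cylinder.
rewrite fin; last exact: measurable_code_cylinder.
congr (_%:E); apply/eqP; rewrite eq_le (le1 (in_tuple w))/=.
rewrite leNgt; apply/negP => Hlt.
have : \sum_(v : n.-tuple 'I_N) fine (nu f (cyl v)) < \sum_(v : n.-tuple 'I_N) ecell HS f v.
  rewrite (bigD1 (in_tuple w))//= [ltRHS](bigD1 (in_tuple w))//=.
  by apply: ltr_leD => //; apply: ler_sum => v _; exact: le1.
by rewrite tot ltxx.
Qed.

End CellMeasures.

(** * Derivatives with respect to [g] *)

Lemma dominates_copp d (T : measurableType d) (R : realType)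
    (mu : {measure set T -> \bar R}) (kappa : {charge set T -> \bar R}) :
  kappa `<< mu -> copp kappa `<< mu.
Proof.
move=> km A nA B mB BA; have := km A nA B mB BA.
by rewrite /= /copp /= => ->; rewrite oppe0.
Qed.

Lemma Radon_Nikodym_copp d (T : measurableType d) (R : realType)
    (mu : {sigma_finite_measure set T -> \bar R}) (kappa : {charge set T -> \bar R}) :
  kappa `<< mu -> ae_eq mu setT (Radon_Nikodym (copp kappa) mu)
    (fun x => - Radon_Nikodym kappa mu x)%E.
Proof.
move=> km; have dm := dominates_copp km.
have ik := Radon_Nikodym_integrable km.
apply: integral_ae_eq => //.
- exact: (Radon_Nikodym_integrable dm).
- by apply: measurableT_comp => //; exact: measurable_int ik.
- move=> A _ mA; rewrite -Radon_Nikodym_integral// integralN.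
    by rewrite -Radon_Nikodym_integral.
  apply: integrable_add_def => //; exact: (integrableS measurableT mA (@subsetT _ A) ik).
Qed.

Section CellDerivatives.
Variables (R : realType) (K : ptopologicalType) (N : nat) (L : selfSimilar K N).
Variable HS : harmonicStructure R L.
Variable nu : (K -> R) -> {finite_measure set (borel K) -> \bar R}.
Variable g : K -> R.
Hypothesis pcf : post_critically_finite L.
Hypothesis K_compact : compact [set: K].
Hypothesis hK : hausdorff_space K.
Hypothesis K_connected : connected [set: K].
Hypothesis N_ge2 : (2 <= N)%N.
Hypothesis HS_regular : regular_harmonic HS.
Hypothesis nu_energy : energy_measures HS nu.
Hypothesis g_dom : domF_dom HS nu g.

Local Notation F := (domF HS).
Local Notation E := (energy HS).
Local Notation "u \on w" := (u \o psi_word L w) (at level 40).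
Local Notation cyl := (@cylinder _ (borel K) N (code L)).

(** An open set is the union of the closed cells it contains, hence F_sigma since words are
    countable; it also contains all late cells around each of its points. *)
Lemma code_cylinder_regular :
  @cylinder_regular _ (borel K) R N (code L).
Proof.
move=> lam A e mA e0.
have Fs (O : set K) : open O ->
    exists F : nat -> set K, (forall n, closed (F n)) /\ O = \bigcup_n F n.
  move=> oO; exists (fun n => if unpickle n is Some w then
      (if `[< cell L w `<=` O >] then cell L w else set0) else set0); split.
    move=> n; case: unpickle => [w|]; last exact: closed0.
    by case: ifP => _; [exact: closed_cell|exact: closed0].
  apply/seteqP; split => [x Ox|x [n _]].
    have [n Hn] := cell_code_prefix_sub L oO Ox.
    exists (pickle (code_prefix L x n)) => //; rewrite pickleK asboolT; last exact: Hn.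
    exact: cell_code_prefix.
  by case: unpickle => [w|//]; case: asboolP => // wO /wO.
have [U [oU AU lU]] := finite_measure_outer_regular lam Fs mA e0.
exists U; split => //; first exact: sub_sigma_algebra.
move=> x Ux; have [n0 Hn0] := cell_code_prefix_sub L oU Ux.
exists n0 => n n0n y /cylinder_sub_cell; exact: Hn0.
Qed.

Let Fg : F g. Proof. by case: g_dom. Qed.

Lemma nu_dominated f : F f -> nu f `<< nu g.
Proof. by case: g_dom => _ [H _]; exact: H. Qed.

(** For functions of the domain, the mass of the cylinder of [w] under nu_(f1,f2), by [bcell_polar]
    and [ecell_nu]. *)
Definition bcell f1 f2 (w : seq 'I_N) := (rw HS w)^-1 * (2 * E (f1 \on w) (f2 \on w)).

Lemma bcell_polar f1 f2 w : F f1 -> F f2 -> bcell f1 f2 w =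
  2^-1 * (ecell HS (f1 \+ f2) w - (ecell HS f1 w + ecell HS f2 w)).
Proof.
move=> F1 F2; rewrite /bcell /ecell.
have -> : (f1 \+ f2) \on w = fun x => 1 * (f1 \on w) x + (f2 \on w) x.
  by apply/funext => x /=; rewrite mul1r.
rewrite (energy_sq pcf 1 (domF_cell pcf w F1) (domF_cell pcf w F2)).
by field; rewrite gt_eqF// rw_gt0.
Qed.

Local Notation RN :=
  (fun f1 f2 => Radon_Nikodym (mutual_energy_measure nu f1 f2) (nu g)).

Lemma mutual_dominated f1 f2 : F f1 -> F f2 -> mutual_energy_measure nu f1 f2 `<< nu g.
Proof.
move=> F1 F2; apply: dominates_cscalel; apply: dominates_cadd.
  by apply: nu_dominated; exact: domFD.
apply: dominates_copp; apply: dominates_cadd; exact: nu_dominated.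
Qed.

Lemma ecell_nu f w : F f -> ecell HS f w = fine (nu f (cyl w)).
Proof. by move=> Ff; rewrite (nu_cylinder pcf K_compact hK K_connected N_ge2 HS_regular
  nu_energy w Ff). Qed.

Lemma cvg_ecell_ratio f : F f -> {ae nu g, forall x,
  ecell HS f (code_prefix L x n) / ecell HS g (code_prefix L x n) @[n --> \oo] -->
    fine (Radon_Nikodym (charge_of_finite_measure (nu f)) (nu g) x)}.
Proof.
move=> Ff; have mc w : measurable (cyl w) by exact: measurable_code_cylinder.
apply: filterS (cvg_cylinder_ratio mc code_cylinder_regular (nu_dominated Ff)) => x.
rewrite (_ : (fun n => _) = (fun n => ecell HS f (code_prefix L x n) /
   ecell HS g (code_prefix L x n)))//.
by apply/funext => n; rewrite !ecell_nu.
Qed.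

(** Differentiation is available for positive measures; polarization writes the cell quotient and,
    almost everywhere, the density as the same combination of three of them. *)
Lemma cvg_bcell_ratio f1 f2 : F f1 -> F f2 -> {ae nu g, forall x,
  bcell f1 f2 (code_prefix L x n) / ecell HS g (code_prefix L x n) @[n --> \oo] -->
    fine (RN f1 f2 x)}.
Proof.
move=> F1 F2; have F12 := domFD pcf F1 F2.
have D12 := nu_dominated F12; have D1 := nu_dominated F1; have D2 := nu_dominated F2.
pose c1 := charge_of_finite_measure (nu f1).
pose c2 := charge_of_finite_measure (nu f2).
pose c12 := charge_of_finite_measure (nu (f1 \+ f2)).
have Dc : cadd c1 c2 `<< nu g by exact: dominates_cadd.
have Dcc := dominates_copp Dc.
have S1 := Radon_Nikodym_cscale 2^-1 measurableT (dominates_cadd (D12 : c12 `<< nu g) Dcc).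
have S2 := Radon_Nikodym_cadd measurableT (D12 : c12 `<< nu g) Dcc.
have S3 := Radon_Nikodym_copp Dc.
have S4 := Radon_Nikodym_cadd measurableT (D1 : c1 `<< nu g) (D2 : c2 `<< nu g).
have C12 := cvg_ecell_ratio F12; have C1 := cvg_ecell_ratio F1.
have C2 := cvg_ecell_ratio F2.
have S : {ae nu g, forall x, RN f1 f2 x = (2^-1%:E *
    (Radon_Nikodym c12 (nu g) x - (Radon_Nikodym c1 (nu g) x + Radon_Nikodym c2 (nu g)
      x)))%E}.
  have S12 : {ae nu g, forall x, RN f1 f2 x = (2^-1%:E *
    (Radon_Nikodym c12 (nu g) x + Radon_Nikodym (copp (cadd c1 c2)) (nu g) x))%E}.
    by apply: filterS2 S1 S2 => x /(_ I) s1 /(_ I) s2; rewrite s1 s2.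
  apply: filterS3 S12 S3 S4 => x s12 /(_ I) s3 /(_ I) s4.
  by rewrite s12 s3 s4.
have C : {ae nu g, forall x, bcell f1 f2 (code_prefix L x n) /
      ecell HS g (code_prefix L x n) @[n --> \oo] -->
    2^-1 * (fine (Radon_Nikodym c12 (nu g) x) - (fine (Radon_Nikodym c1 (nu g) x) +
     fine (Radon_Nikodym c2 (nu g) x)))}.
  apply: (@filterS3 _ _ (ae_filter_ringOfSetsType (nu g)) _ _ _ _ _ C12 C1 C2) => x h12
    h1 h2.
  rewrite (_ : (fun n => _) = (fun n => 2^-1 *
    (ecell HS (f1 \+ f2) (code_prefix L x n) / ecell HS g (code_prefix L x n) -
      (ecell HS f1 (code_prefix L x n) / ecell HS g (code_prefix L x n) +
       ecell HS f2 (code_prefix L x n) / ecell HS g (code_prefix L x n))))); last first.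
    by apply/funext => n; rewrite bcell_polar//; ring.
  by apply: cvgM; [exact: cvg_cst|apply: cvgB => //; exact: cvgD].
apply: filterS2 S C => x ->; congr (_ --> _).
have fn (f : K -> R) : nu f `<< nu g ->
    Radon_Nikodym (charge_of_finite_measure (nu f)) (nu g) x \is a fin_num.
  by move=> D; exact: Radon_Nikodym_fin_num.
by rewrite fineM// ?fin_numB ?fin_numD ?fn// fineB ?fin_numD ?fn// fineD ?fn.
Qed.

End CellDerivatives.

(** * Existence and uniqueness of the derivative *)

Lemma osc_ge (R : realType) (T : Type) (h : T -> R) (B : set T) (c : R) y z :
  (forall x, `|h x| <= c) -> B y -> B z -> h y - h z <= osc h B.
Proof.
move=> hc By Bz; rewrite /osc; apply: lerB.
  apply: ub_le_sup; last by exists y.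
  by exists c => _ [x _ <-]; apply: le_trans (hc x); exact: ler_norm.
apply: ge_inf; last by exists z.
by exists (- c) => _ [x _ <-]; have := hc x; rewrite ler_norml => /andP[].
Qed.

Lemma osc_le (R : realType) (T : Type) (h : T -> R) (B : set T) (M : R) :
  B !=set0 -> (forall y z, B y -> B z -> h y - h z <= M) -> osc h B <= M.
Proof.
move=> [y0 By0] H; rewrite /osc lerBlDl; apply: ge_sup; first by exists (h y0), y0.
move=> _ [y By <-]; rewrite -lerBlDr; apply: lb_le_inf; first by exists (h y0), y0.
by move=> _ [z Bz <-]; have := H y z By Bz; lra.
Qed.

Section Derivatives.
Variables (R : realType) (K : ptopologicalType) (N : nat) (L : selfSimilar K N).
Variable HS : harmonicStructure R L.
Variable nu : (K -> R) -> {finite_measure set (borel K) -> \bar R}.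
Variable g : K -> R.
Hypothesis pcf : post_critically_finite L.
Hypothesis K_compact : compact [set: K].
Hypothesis hK : hausdorff_space K.
Hypothesis K_connected : connected [set: K].
Hypothesis N_ge2 : (2 <= N)%N.
Hypothesis HS_regular : regular_harmonic HS.
Hypothesis nu_energy : energy_measures HS nu.
Hypothesis g_dom : domF_dom HS nu g.
Hypothesis index1 : energy_index HS nu = 1%E.

Local Notation E0 := (energy0 L (hD HS)).
Local Notation F := (domF HS).
Local Notation E := (energy HS).
Local Notation "u \on w" := (u \o psi_word L w) (at level 40).
Local Notation cyl := (@cylinder _ (borel K) N (code L)).
Local Notation RN :=
  (fun f1 f2 => Radon_Nikodym (mutual_energy_measure nu f1 f2) (nu g)).
Local Notation pre := (code_prefix L).

Let Fg : F g. Proof. by case: g_dom. Qed.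

(** The index is an infimum in the extended reals; if no natural number below 2 were a bound, it
    would be at least 2. *)
Lemma index_bound_1 : index_bound HS nu 1.
Proof.
suff [p p1 Hp] : exists2 p, (p <= 1)%N & index_bound HS nu p.
  move=> lam ml M f Ff; apply: filterS (Hp lam ml M f Ff) => x /= h.
  exact: leq_trans h p1.
apply: contrapT => H.
have : (2%:R%:E <= energy_index HS nu)%E.
  apply/ereal_infP => _ [p /= Hp <-]; rewrite lee_fin ler_nat.
  by rewrite ltnNge; apply/negP => p1; apply: H; exists p.
by rewrite index1 lee_fin; lra.
Qed.

Lemma bcell_diag f : bcell HS f f = ecell HS f.
Proof. by []. Qed.

Lemma bcellC f1 f2 : bcell HS f1 f2 = bcell HS f2 f1.
Proof. by apply/funext => w; rewrite /bcell (energyC HS pcf). Qed.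

Lemma ae_ecell_gt0 : {ae nu g, forall x, forall n, 0 < ecell HS g (pre x n)}.
Proof.
have mc w : measurable (cyl w) by exact: measurable_code_cylinder.
apply: filterS (negligible_cylinder0 mc (nu g)) => x H n.
rewrite lt_def ecell_ge0// andbT.
have := H n; rewrite (nu_cylinder pcf K_compact hK K_connected N_ge2 HS_regular nu_energy
  _ Fg).
by rewrite eqe.
Qed.

Lemma rank1_minor (A : 'M[R]_2) : (\rank A <= 1)%N ->
  A ord0 ord0 * A ord_max ord_max = A ord0 ord_max * A ord_max ord0.
Proof.
move=> rA; apply/eqP; rewrite -subr_eq0.
have -> : A ord0 ord0 * A ord_max ord_max - A ord0 ord_max * A ord_max ord0 = \det A.
  rewrite (expand_det_row _ ord0) !big_ord_recl big_ord0 addr0 /cofactor !det_mx11.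
  rewrite !mxE /= expr0 mul1r expr1 mulN1r mulrN.
  by congr (_ * _ - _ * _); congr (A _ _); exact: val_inj.
apply/negPn/negP => dA.
have : A \in unitmx by rewrite unitmxE unitfE.
by move=> /mxrank_unit rk; rewrite rk in rA.
Qed.

(** The 2 by 2 minor vanishes. The remaining entries are identified as limits of cell quotients,
    which are constantly 1 for the pair g, g and symmetric in f and g. *)
Lemma RN_identity f : F f -> {ae nu g, forall x,
  fine (RN g g x) = 1 /\ fine (RN f f x) = fine (RN f g x) ^+ 2}.
Proof.
move=> Ff.
pose f_ (i : 'I_2) := if i == ord0 then f else g.
have F_ i : F (f_ i) by rewrite /f_; case: ifP.
have [_ mg] := g_dom; have := index_bound_1 mg F_ => Hrank.
have Cgg := cvg_bcell_ratio pcf K_compact hK K_connected N_ge2 HS_regular nu_energy g_dom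
  Fg Fg.
have Cfg := cvg_bcell_ratio pcf K_compact hK K_connected N_ge2 HS_regular nu_energy g_dom
  Ff Fg.
have Cgf := cvg_bcell_ratio pcf K_compact hK K_connected N_ge2 HS_regular nu_energy g_dom
  Fg Ff.
have aF := ae_filter_ringOfSetsType (nu g).
have H1 : {ae nu g, forall x, fine (RN g g x) = 1}.
  apply: (@filterS2 _ _ aF _ _ _ _ ae_ecell_gt0 Cgg) => x gt0.
  rewrite (_ : (fun n => _) = fun=> 1); last first.
    by apply/funext => n; rewrite bcell_diag divff// gt_eqF.
  by move=> H; apply: (@cvg_unique _ (@Rhausdorff R) _ _ _ _ H); exact: cvg_cst.
have H2 : {ae nu g, forall x, fine (RN g f x) = fine (RN f g x)}.
  apply: (@filterS2 _ _ aF _ _ _ _ Cfg Cgf) => x; rewrite bcellC => h1 h2.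
  exact: (@cvg_unique _ (@Rhausdorff R) _ _ _ _ h2 h1).
apply: (@filterS3 _ _ aF _ _ _ _ _ Hrank H1 H2) => x /rank1_minor;
rewrite !mxE /f_ /= => h h1 h2.
split => //; move: h; rewrite h1 h2 mulr1 => ->; by rewrite expr2.
Qed.

Lemma cvg_remainder_energy f : F f -> {ae nu g, forall x,
  ecell HS (fun y => - fine (RN f g x) * g y + f y) (pre x n) / ecell HS g (pre x n)
    @[n --> \oo] --> (0 : R)}.
Proof.
move=> Ff; have aF := ae_filter_ringOfSetsType (nu g).
have Cff := cvg_bcell_ratio pcf K_compact hK K_connected N_ge2 HS_regular nu_energy g_dom
  Ff Ff.
have Cfg := cvg_bcell_ratio pcf K_compact hK K_connected N_ge2 HS_regular nu_energy g_dom
  Ff Fg.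
have C2 := @filterS2 _ _ aF _ _ _ (fun x => @conj _ _) Cff Cfg.
apply: (@filterS3 _ _ aF _ _ _ _ _ (RN_identity Ff) ae_ecell_gt0 C2) => x [_ idx] gt0
  [cff cfg].
set a := fine (RN f g x) in idx cfg *.
rewrite (_ : (fun n => _) = (fun n => a ^+ 2 - 2 * a * (bcell HS f g (pre x n) / ecell HS
  g (pre x n)) +
   bcell HS f f (pre x n) / ecell HS g (pre x n))); last first.
  apply/funext => n; have gn := gt0 n.
  have gn0 : E (g \on pre x n) (g \on pre x n) != 0.
    by apply: contraTneq gn => h; rewrite /ecell h !mulr0 ltxx.
  have rn0 : rw HS (pre x n) != 0 by rewrite gt_eqF// rw_gt0.
  rewrite /ecell /bcell.
  rewrite [E ((fun y => _) \on _) _](energy_sq pcf (- a) (domF_cell pcf (pre x n) Fg)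
    (domF_cell pcf (pre x n) Ff)).
  rewrite (energyC HS pcf (f \on _)); field.
  by rewrite rn0 gn0.
(* The last density is a^2, so the three limits cancel. *)
have -> : 0 = a ^+ 2 - 2 * a * a + fine (RN f f x).
  by rewrite idx; ring.
apply: cvgD => //; apply: cvgB; first exact: cvg_cst.
by apply: cvgM => //; exact: cvg_cst.
Qed.

(* Along the cells around [x], the boundary values of [g] carry a fixed proportion
   of its energy, which makes the oscillation of [g] comparable to the square root
   of its energy. *)
Definition good_along (n : nat -> nat) (x : K) := exists2 kappa : R, 0 < kappa &
  \forall k \near \oo, kappa * E (g \on pre x (n k)) (g \on pre x (n k)) <=
    E0 (g \on pre x (n k)) (g \on pre x (n k)).

(** With u = f - a g, the remainder on K_w is at most a constant times the root of E(u o psi_w), and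
    on good cells osc g is at least a constant times the root of E(g o psi_w). The factors r_w
    cancel in the quotient, which is thus bounded by the root of a constant times the ratio of the
    cell energies. *)
Lemma is_derivative_along_cvg f n x a : F f -> n k @[k --> \oo] --> \oo ->
  (forall n, 0 < ecell HS g (pre x n)) ->
  ecell HS (fun y => - a * g y + f y) (pre x n) / ecell HS g (pre x n)
    @[n --> \oo] --> (0 : R) ->
  good_along n x -> unique (is_derivative_along L g f n x) a.
Proof.
move=> Ff noo gt0 cv [kappa kappa0 good].
set u := (fun y => - a * g y + f y) in cv.
have Fu : F u by exact: domF_lin.
have [C C0 HC] := energy_osc_domF pcf K_compact hK K_connected N_ge2 HS_regular.
have [C' C'0 HC'] := energy0_ub HS pcf.
have [bg Hbg] := domF_bounded pcf K_compact hK K_connected N_ge2 HS_regular Fg.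
pose B m := cell L (pre x m).
have Bx m : B m x by exact: cell_code_prefix.
have remE b y : remainder g f x b y = (f y - b * g y) - (f x - b * g x).
  by rewrite /remainder; ring.
(* Boundedness makes the suprema in [remainder_ratio] genuine. *)
have rem_bnd b : exists M, forall y, `|remainder g f x b y| <= M.
  have Fb : F (fun y => - b * g y + f y) by exact: domF_lin.
  have [M HM] := domF_bounded pcf K_compact hK K_connected N_ge2 HS_regular Fb.
  exists (M + M) => y; rewrite remE; apply: le_trans (ler_normB _ _) _.
  by apply: lerD; [have := HM y|have := HM x]; rewrite mulNr addrC.
have osc_pos m : kappa * E (g \on pre x m) (g \on pre x m) <=
    E0 (g \on pre x m) (g \on pre x m) ->
    0 < osc g (B m) /\ kappa * E (g \on pre x m) (g \on pre x m) <= (C' + 1) * osc g (B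
      m) ^+ 2.
  move=> Hm.
  have osc0 : 0 <= osc g (B m) by rewrite -(subrr (g x)); apply: (osc_ge Hbg).
  have H1 : E0 (g \on pre x m) (g \on pre x m) <= C' * osc g (B m) ^+ 2.
    apply: HC' => // p q _ _ /=; rewrite ler_norml; apply/andP; split.
      by rewrite lerNl opprB; apply: (osc_ge Hbg); [exists q|exists p].
    by apply: (osc_ge Hbg); [exists p|exists q].
  have Epos : 0 < E (g \on pre x m) (g \on pre x m).
    have := gt0 m; rewrite /ecell pmulr_rgt0 ?pmulr_rgt0 ?invr_gt0 ?rw_gt0//.
  have H2 : 0 < kappa * E (g \on pre x m) (g \on pre x m) by rewrite mulr_gt0.
  split; last by apply: (le_trans Hm); apply: (le_trans H1);
  rewrite ler_wpM2r ?sqr_ge0// lerDl.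
  rewrite lt_def osc0 andbT; apply/eqP => o0; move: H1; rewrite o0 expr0n mulr0 => H1.
  lra.
have sup_ge b m y : B m y -> `|remainder g f x b y| <= sup [set `|remainder g f x b y| |
  y in B m].
  move=> By; apply: ub_le_sup; last by exists y.
  by have [M HM] := rem_bnd b; exists M => _ [z _ <-].
have Ha : is_derivative_along L g f n x a.
  rewrite /is_derivative_along.
  pose q m := ecell HS u (pre x m) / ecell HS g (pre x m).
  have cq : (Num.sqrt ((C ^+ 2 * (C' + 1) / kappa) * q (n k))) @[k --> \oo] --> (0 : R).
    have cc : (C ^+ 2 * (C' + 1) / kappa) * q (n k) @[k --> \oo] --> (C ^+ 2 * (C' + 1) /
      kappa) * 0.
      by apply: cvgM; [exact: cvg_cst|exact: (@cvg_comp _ _ _ n q _ _ _ noo cv)].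
    rewrite mulr0 in cc.
    have := @continuous_cvg _ _ _ _ _ _ Num.sqrt _ (@sqrt_continuous R 0) cc.
    by rewrite sqrtr0 => cs; exact: cs.
  apply: (@squeeze_cvgr _ _ _ _ (fun=> 0) (fun k => Num.sqrt ((C ^+ 2 * (C' + 1) / kappa)
    * q (n k)))) => //.
    apply: filterS good => k Hk; have [op ole] := osc_pos _ Hk.
    rewrite /remainder_ratio -/(B (n k)); apply/andP; split.
      by rewrite divr_ge0 ?(ltW op)//; apply: le_trans (sup_ge a _ _ (Bx _)).
    rewrite ler_pdivrMr//.
    apply: (@le_trans _ _ (C * Num.sqrt (E (u \on pre x (n k)) (u \on pre x (n k))))).
      apply: ge_sup; first by exists `|remainder g f x a x|, x.
      move=> _ [_ [y _ <-] <-].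
      have -> : remainder g f x a (psi_word L (pre x (n k)) y) =
          (u \on pre x (n k)) y - (u \on pre x (n k)) (coding L (shift (n k) (code L x))).
        by rewrite /= -(code_prefixE L x) remE /u; ring.
      by apply: HC; exact: domF_cell.
    have Ep : 0 < E (g \on pre x (n k)) (g \on pre x (n k)).
      by have := gt0 (n k); rewrite /ecell pmulr_rgt0 ?pmulr_rgt0 ?invr_gt0 ?rw_gt0.
    have Eu : 0 <= E (u \on pre x (n k)) (u \on pre x (n k)).
      by apply: energy_ge0 => //; exact: domF_cell.
    have -> : q (n k) = E (u \on pre x (n k)) (u \on pre x (n k)) / E (g \on pre x (n k))
      (g \on pre x (n k)).
      rewrite /q /ecell; field.
      by rewrite gt_eqF//= gt_eqF// rw_gt0.
    move: Ep Eu ole; set Eg := E (g \on _) _; set Eu_ := E (u \on _) _ => Ep Eu ole.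
    have X0 : 0 <= C ^+ 2 * (C' + 1) / kappa * (Eu_ / Eg).
      by rewrite !(mulr_ge0, divr_ge0, invr_ge0, addr_ge0) ?sqr_ge0 ?(ltW kappa0) ?(ltW Ep).
    have -> : C * Num.sqrt Eu_ = Num.sqrt (C ^+ 2 * Eu_).
      by rewrite (sqrtrM _ (sqr_ge0 _)) sqrtr_sqr ger0_norm.
    have -> : Num.sqrt (C ^+ 2 * (C' + 1) / kappa * (Eu_ / Eg)) * osc g (B (n k)) =
        Num.sqrt (C ^+ 2 * (C' + 1) / kappa * (Eu_ / Eg) * osc g (B (n k)) ^+ 2).
      by rewrite [in RHS](sqrtrM _ X0) sqrtr_sqr ger0_norm// ltW.
    apply: ler_wsqrtr.
    have -> : C ^+ 2 * (C' + 1) / kappa * (Eu_ / Eg) * osc g (B (n k)) ^+ 2 =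
       C ^+ 2 * Eu_ * (((C' + 1) * osc g (B (n k)) ^+ 2) / (kappa * Eg)).
      by field; rewrite !gt_eqF.
    by rewrite ler_peMr ?mulr_ge0 ?sqr_ge0// ler_pdivlMr ?mulr_gt0// mul1r.
  exact: cvg_cst.
(* The remainders for [a] and [a'] differ at y by (a - a') (g(y) - g(x)), so |a - a'| osc g is at
   most twice the sum of the two suprema; osc g is positive on good cells. *)
split => // a' Ha'; apply/eqP/negPn/negP => aa'.
have d0 : 0 < `|a - a'| by rewrite normr_gt0 subr_eq0.
have : 2 * (remainder_ratio L g f x a (n k) + remainder_ratio L g f x a' (n k))
    @[k --> \oo] --> 2 * (0 + 0 : R).
  by apply: cvgM; [exact: cvg_cst|exact: cvgD].
rewrite addr0 mulr0 => /cvgr_to_ge - /(_ `|a - a'|) H.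
suff : `|a - a'| <= 0 by rewrite leNgt d0.
apply: H; apply: filterS good => k Hk; have [op _] := osc_pos _ Hk.
rewrite /remainder_ratio -/(B (n k)) -mulrDl mulrA ler_pdivlMr// mulrC -ler_pdivlMr//.
apply: osc_le; first by exists x.
move=> y z By Bz; rewrite ler_pdivlMr//.
have h1 := sup_ge a _ _ By; have h2 := sup_ge a' _ _ By.
have h3 := sup_ge a _ _ Bz; have h4 := sup_ge a' _ _ Bz.
apply: (@le_trans _ _ (`|remainder g f x a y| + `|remainder g f x a' y| +
    (`|remainder g f x a z| + `|remainder g f x a' z|))); last by lra.
apply: (@le_trans _ _ `|(g y - g z) * (a - a')|).
  by rewrite normrM ler_wpM2r// ler_norm.
have -> : (g y - g z) * (a - a') =
    (remainder g f x a' y - remainder g f x a y) - (remainder g f x a' z - remainder g f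
      x a z).
  by rewrite /remainder; ring.
apply: le_trans (ler_normB _ _) _; apply: lerD; rewrite [leRHS]addrC; exact: ler_normB.
Qed.

End Derivatives.

(** Nonnegativity and the subsequence tending to 0 force every tail infimum to be 0. *)
Lemma limn_einf_subseq0 (R : realType) (u : nat -> R) (n : nat -> nat) :
  (forall m, 0 <= u m) -> n k @[k --> \oo] --> \oo -> u (n k) @[k --> \oo] --> (0 : R) ->
  limn_einf (fun m => (u m)%:E) = 0%E.
Proof.
move=> u0 noo un; rewrite limn_einf_lim; apply/cvg_lim => //.
have einf0 m : einfs (fun m => (u m)%:E) m = 0%E.
  apply/eqP; rewrite eq_le; apply/andP; split.
    apply/lee_addgt0Pr => e e0; rewrite add0e.
    have /cvgrPdist_le /(_ _ e0) He := un.
    have Hm : \forall k \near \oo, (m <= n k)%N := noo _ (nbhs_infty_ge m).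
    near \oo => k.
    apply: (@le_trans _ _ (u (n k))%:E).
      apply: ereal_inf_lbound; exists (n k) => //=; by near: k.
    rewrite lee_fin; have : `|0 - u (n k)| <= e by near: k.
    by rewrite sub0r normrN; apply: le_trans; exact: ler_norm.
  by apply/ereal_infP => _ [k _ <-]; rewrite lee_fin.
have -> : einfs (fun m => (u m)%:E) = cst 0%E by apply/funext => m; exact: einf0.
exact: cvg_cst.
Unshelve. all: by end_near.
Qed.

(** * Cells in which boundary values carry the energy *)

Section Main.
Variables (R : realType) (K : ptopologicalType) (N : nat) (L : selfSimilar K N).
Variable HS : harmonicStructure R L.
Variable nu : (K -> R) -> {finite_measure set (borel K) -> \bar R}.
Variable g : K -> R.
Hypothesis pcf : post_critically_finite L.
Hypothesis K_compact : compact [set: K].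
Hypothesis hK : hausdorff_space K.
Hypothesis K_connected : connected [set: K].
Hypothesis N_ge2 : (2 <= N)%N.
Hypothesis HS_regular : regular_harmonic HS.
Hypothesis nu_energy : energy_measures HS nu.
Hypothesis g_dom : domF_dom HS nu g.

Local Notation E0 := (energy0 L (hD HS)).
Local Notation Em := (energym L (hD HS) (hr HS)).
Local Notation F := (domF HS).
Local Notation E := (energy HS).
Local Notation "u \on w" := (u \o psi_word L w) (at level 40).
Local Notation cyl := (@cylinder _ (borel K) N (code L)).
Local Notation pre := (code_prefix L).
Local Notation interp := (interp pcf K_compact hK K_connected N_ge2 HS_regular).

Let Fg : F g. Proof. by case: g_dom. Qed.

(** A minimizer does no worse than the constructed extension of its boundary values, whose energy is
    E_0; the converse is monotonicity in the level. *)
Lemma harmonic_energy0 h : Defs.harmonic HS h -> F h /\ E h h = E0 h h.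
Proof.
move=> [u [Fh hu Hmin]]; split => //; apply/eqP; rewrite eq_le; apply/andP; split.
  have -> : E0 h h = E0 u u by exact: eq_energy0.
  rewrite -(energym0 HS u u) -(energy_interp pcf K_compact hK K_connected N_ge2 HS_regular).
  apply: Hmin; first exact: domF_interp.
  move=> q Vq; apply: interp_V; exists [::] => //; by exists q.
by rewrite -(energym0 HS); exact: energym_le_energy.
Qed.

Lemma energy0_le_energy u : F u -> E0 u u <= E u u.
Proof. by move=> Fu; rewrite -(energym0 HS); exact: energym_le_energy. Qed.

(** Excess energy in one cell would make E_m(h, h) smaller than E(h, h) = E_0(h, h), against
    monotonicity in m. *)
Lemma harmonic_cell_energy h w : F h -> E h h = E0 h h ->
  E (h \on w) (h \on w) = E0 (h \on w) (h \on w).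
Proof.
move=> Fh Eh; have Fw v := domF_cell pcf v Fh.
apply/eqP; rewrite eq_le (energy0_le_energy (Fw w)) andbT leNgt; apply/negP => Hlt.
have : Em (size w) h h < E h h.
  rewrite (energy_cat pcf (size w) Fh Fh) /energym.
  rewrite (bigD1 (in_tuple w))//= [ltRHS](bigD1 (in_tuple w))//=.
  apply: ltr_leD; first by rewrite ltr_pM2l// invr_gt0 rw_gt0.
  apply: ler_sum => v _; rewrite ler_wpM2l ?invr_ge0 ?(ltW (rw_gt0 _ _))//.
  exact: energy0_le_energy.
rewrite ltNge Eh -(energym0 HS) => /negP; apply.
exact: energym_homo.
Qed.

(** From the level of harmonicity on, the boundary values carry the whole energy of [g] in each
    cell, so [kappa = 1] serves at every point. *)
Lemma harmonic_star_good x : harmonic_star HS g -> good_along HS g id x.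
Proof.
move=> [m _ [_ Hm]]; exists 1 => //; exists m => // n /= mn; rewrite mul1r.
have pE : pre x n = pre x m ++ drop m (pre x n).
  rewrite -[LHS](cat_take_drop m); congr (_ ++ _).
  by rewrite /code_prefix take_mkseq.
have [Fh Eh] := harmonic_energy0 (Hm _ (size_code_prefix L x m)).
have := harmonic_cell_energy (drop m (pre x n)) Fh Eh.
have -> : (g \on pre x m) \on drop m (pre x n) = g \on pre x n.
  by rewrite [in RHS]pE; apply/funext => y /=; rewrite psi_word_cat.
by move=> ->.
Qed.

(** The explicit interpolant [interp n f] shows that [xget] does not return its default value. *)
Lemma harmonic_interpP n f : harmonicm HS n (harmonic_interp HS n f) /\
  forall q, V L n q -> harmonic_interp HS n f q = f q.
Proof.
rewrite /harmonic_interp; case: xgetP => [h _ //|H]; exfalso.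
apply: (H (interp n f)); split; last by move=> q Vq; exact: interp_V.
split; first exact: domF_interp.
move=> w sw; rewrite (interp_cell pcf K_compact hK K_connected N_ge2 HS_regular f sw).
exists (f \on w).
have -> : hext pcf K_compact hK K_connected N_ge2 HS_regular (f \on w) =
    interp 0 (f \on w).
  by apply/funext => x; rewrite -[x in RHS]/(psi_word L [::] x) interp_psi_word.
split; first exact: domF_interp.
  move=> q Vq; apply: interp_V; exists [::] => //; by exists q.
move=> u Fu uf; rewrite energy_interp energym0.
have -> : E0 (f \on w) (f \on w) = E0 u u by apply: eq_energy0 => // q Vq; rewrite uf.
exact: energy0_le_energy.
Qed.

Lemma cell_interp_energy n f w : size w = n ->
  E (harmonic_interp HS n f \on w) (harmonic_interp HS n f \on w) =
  E0 (f \on w) (f \on w).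
Proof.
move=> sw; have [[Fh Hh] hf] := harmonic_interpP n f.
have [_ ->] := harmonic_energy0 (Hh w sw).
apply: eq_energy0 => // q Vq /=; apply: hf; exists w => //; by exists q.
Qed.

(* A cell that is not good is charged by the energy of [g - H_n g] at least a
   quarter as much as by that of [g]; Borel-Cantelli applies. *)
Lemma ae_good_along (n : nat -> nat) :
  cvgn (series (fun k : nat => let e := g \- harmonic_interp HS (n k) g in
       Num.sqrt (E e e))) ->
  {ae nu g, forall x, good_along HS g n x}.
Proof.
pose h k := harmonic_interp HS (n k) g.
have Fh k : F (h k) by have [[]] := harmonic_interpP (n k) g.
pose e k := g \- h k.
have Fe k : F (e k) by exact: domFB.
move=> /= cs; change (cvgn (series (fun k => Num.sqrt (E (e k) (e k))))) in cs.
(* With the factor 4, the root of the energy of [e k] in a cell that is not bad is at most half of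
   that of [g], so at least half is left for the interpolant [h k]. *)
pose bad k (w : seq 'I_N) := ecell HS g w < 4 * ecell HS (e k) w.
pose B k := \bigcup_(w in [set w : (n k).-tuple 'I_N | bad k w]) cyl w.
have mB k : measurable (B k : set (borel K)).
  apply: fin_bigcup_measurable; first exact: finite_finset.
  by move=> w _; exact: measurable_code_cylinder.
have nuB k : (nu g (B k) <= (8 * E (e k) (e k))%:E)%E.
  have finT : finite_set [set w : (n k).-tuple 'I_N | bad k w] by exact: finite_finset.
  have mT (v : (n k).-tuple 'I_N) : [set w : (n k).-tuple 'I_N | bad k w] v -> measurable
    (cyl v).
    by move=> _; exact: measurable_code_cylinder.
  have -> : nu g (B k) = (\sum_(w \in [set w : (n k).-tuple 'I_N | bad k w]) nu g (cyl
    w))%E.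
    exact: (measure_fin_bigcup (nu g) finT (@trivIset_cylinder _ (borel K) _ _ _ _) mT).
  rewrite fsbig_mkcond (_ : [set: _] = [set` index_enum ((n k).-tuple 'I_N)]); last first.
    by apply/seteqP; split => // v _ /=; rewrite mem_index_enum.
  rewrite -fsbig_seq ?index_enum_uniq//=.
  have -> : 8 * E (e k) (e k) = \sum_(w : (n k).-tuple 'I_N) 4 * ecell HS (e k) w.
    by rewrite -big_distrr /= -ecell_sum//; ring.
  rewrite -sumEFin; apply: lee_sum => w _.
  have ew0 : 0 <= ecell HS (e k) w by exact: ecell_ge0.
  rewrite patchE; case: ifPn => [|_]; last by rewrite lee_fin mulr_ge0.
  rewrite inE /= /bad (nu_cylinder pcf K_compact hK K_connected N_ge2 HS_regular
    nu_energy _ Fg) lee_fin.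
  exact: ltW.
have E0e k : 0 <= E (e k) (e k) by exact: energy_ge0.
have sumfin : (\sum_(k <oo) nu g (B k) < +oo)%E.
  (* The terms of the convergent series are bounded, so each energy is at most [M] times its root
     and the energies are summable too. *)
  have [M HM] : exists M, forall k, Num.sqrt (E (e k) (e k)) <= M.
    have := cvg_series_cvg_0 cs => /cvgrPdist_le /(_ 1 ltr01)[k0 _ Hk0].
    exists (1 + \sum_(k < k0) Num.sqrt (E (e k) (e k))) => k.
    have S0 : 0 <= \sum_(k < k0) Num.sqrt (E (e k) (e k)) by apply: sumr_ge0.
    have [kk0|kk0] := leqP k0 k.
      have := Hk0 k kk0; rewrite /= sub0r normrN => /(le_trans (ler_norm _)) H.
      by apply: (le_trans H); rewrite lerDl.
    rewrite (bigD1 (Ordinal kk0))//= addrCA lerDl addr_ge0//.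
    exact: sumr_ge0.
  have [M0 M1] : 0 <= M /\ forall k, E (e k) (e k) <= M * Num.sqrt (E (e k) (e k)).
    split; first by apply: le_trans (HM 0%N); exact: sqrtr_ge0.
    by move=> k; rewrite -{1}[E _ _]sqr_sqrtr// expr2 ler_wpM2r.
  apply: (@le_lt_trans _ _ (\sum_(k <oo) (8 * M * Num.sqrt (E (e k) (e k)))%:E)%E).
    apply: lee_nneseries => // k _; apply: (le_trans (nuB k)).
    by rewrite lee_fin -mulrA ler_wpM2l.
  set s := fun k => Num.sqrt (E (e k) (e k)) in cs.
  have cv : (\sum_(0 <= k < m) (8 * M * s k)%:E)%E @[m --> \oo] -->
      (8 * M * limn (series s))%:E.
    rewrite (_ : (fun m => _) = EFin \o (fun m => 8 * M * series s m)); last first.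
      by apply/funext => m; rewrite /= sumEFin /series /= big_distrr.
    apply/fine_cvgP; split; first exact: nearW.
    by apply: cvgM; [exact: cvg_cst|exact: cs].
  by rewrite (cvg_lim _ cv)// ltry.
have nul := lim_sup_set_cvg0 mB sumfin.
have mlim : measurable (lim_sup_set B : set (borel K)).
  by apply: bigcapT_measurable => k; apply: bigcup_measurable.
have ngl : (nu g).-negligible (lim_sup_set B).
  by exists (lim_sup_set B); split; [exact: mlim|exact: nul|].
apply: negligibleS ngl => x /= ngood.
apply: contrapT => nlim; apply: ngood.
have [k0 Hk0] : exists k0, forall k, (k0 <= k)%N -> ~ B k x.
  apply: contrapT => /forallNP H; apply: nlim => k _.
  by have /existsNP[j /not_implyP[kj /contrapT Bj]] := H k; exists j.
(* Half of the root of the energy is a quarter of the energy. *)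
exists (1 / 4) => //; exists k0 => // k /= /Hk0 nB.
set w := pre x (n k); have sw : size w = n k by rewrite size_code_prefix.
have nbad : ~ bad k w.
  by move=> b; apply: nB; exists [tuple of w] => //; exact: mem_cylinder.
move: nbad => /negP; rewrite -leNgt /ecell => nbad.
have rw0 : 0 < (rw HS w)^-1 by rewrite invr_gt0 rw_gt0.
have Ele : 4 * E (e k \on w) (e k \on w) <= E (g \on w) (g \on w).
  have : (rw HS w)^-1 * (2 * (4 * E (e k \on w) (e k \on w))) <=
      (rw HS w)^-1 * (2 * E (g \on w) (g \on w)).
    by apply: le_trans nbad; rewrite le_eqVlt; apply/orP; left; apply/eqP; ring.
  by rewrite ler_pM2l// ler_pM2l.
have := sqrt_energyB pcf (domF_cell pcf w Fg) (domF_cell pcf w (Fh k)).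
rewrite cell_interp_energy// -[(g \on w) \- (h k \on w)]/(e k \on w).
have Fgw := domF_cell pcf w Fg; have Few := domF_cell pcf w (Fe k).
have Eg0 := energy_ge0 pcf Fgw; have Ee0 := energy_ge0 pcf Few.
have s2 : 2 * Num.sqrt (E (e k \on w) (e k \on w)) <= Num.sqrt (E (g \on w) (g \on w)).
  rewrite -[2 in leLHS](ger0_norm (ler0n R 2)) -sqrtr_sqr -sqrtrM ?sqr_ge0//.
  apply: ler_wsqrtr; apply: le_trans Ele; rewrite le_eqVlt; apply/orP; left.
  by apply/eqP; ring.
have E00 : 0 <= E0 (g \on w) (g \on w) by rewrite -(energym0 HS); exact: energym_ge0.
move=> H; have H1 : Num.sqrt (E (g \on w) (g \on w)) <= 2 * Num.sqrt (E0 (g \on w) (g \on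
  w)) by lra.
have : Num.sqrt (E (g \on w) (g \on w)) ^+ 2 <= (2 * Num.sqrt (E0 (g \on w) (g \on w)))
  ^+ 2.
  by apply: lerXn2r; rewrite ?nnegrE ?mulr_ge0 ?sqrtr_ge0.
by rewrite exprMn !sqr_sqrtr//; lra.
Qed.

End Main.

Lemma remainder_ratio_ge0 (R : realType) (K : topologicalType) (N : nat)
    (L : selfSimilar K N) (g f : K -> R) (c : R) x a m :
  (forall y, `|g y| <= c) -> 0 <= remainder_ratio L g f x a m.
Proof.
move=> gc; have Bx := cell_code_prefix L x m; apply: divr_ge0.
  set S := [set _ | _ in _].
  (* For arbitrary [f] the set may be unbounded; [sup] then takes its default value 0. *)
  have [hS|nS] := pselect (has_sup S); last by rewrite sup_out.
  apply: (@le_trans _ _ `|remainder g f x a x|) => //.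
  by apply: ub_le_sup; [case: hS|exists x].
by rewrite -(subrr (g x)); exact: (osc_ge gc).
Qed.

(** * The energy formula and the derivative as an element of L^2 *)

Section Integral.
Variables (R : realType) (K : ptopologicalType) (N : nat) (L : selfSimilar K N).
Variable HS : harmonicStructure R L.
Variable nu : (K -> R) -> {finite_measure set (borel K) -> \bar R}.
Variable g : K -> R.
Hypothesis pcf : post_critically_finite L.
Hypothesis K_compact : compact [set: K].
Hypothesis hK : hausdorff_space K.
Hypothesis K_connected : connected [set: K].
Hypothesis N_ge2 : (2 <= N)%N.
Hypothesis HS_regular : regular_harmonic HS.
Hypothesis nu_energy : energy_measures HS nu.
Hypothesis g_dom : domF_dom HS nu g.
Hypothesis index1 : energy_index HS nu = 1%E.

Local Notation F := (domF HS).
Local Notation E := (energy HS).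
Local Notation RN :=
  (fun f1 f2 => Radon_Nikodym (mutual_energy_measure nu f1 f2) (nu g)).
Local Notation rho := (fun f x => fine (RN f g x)).

Let Fg : F g. Proof. by case: g_dom. Qed.

Lemma mutual_total f : F f -> mutual_energy_measure nu f f setT = (2 * E f f)%:E.
Proof.
move=> Ff; have Fff := domFD pcf Ff Ff.
have tot h : F h -> nu h setT = (2 * E h h)%:E.
  move=> Fh; rewrite -(nu_total pcf K_compact hK K_connected N_ge2 HS_regular nu_energy Fh).
  by rewrite fineK// fin_num_measure.
have -> : mutual_energy_measure nu f f setT =
    ((2^-1)%:E * (nu (f \+ f)%R setT + - (nu f setT + nu f setT)))%E by [].
rewrite !tot//.
rewrite -[X in (_ - X)%E]EFinD -EFinB -EFinM; congr (_%:E).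
have -> : (f \+ f = (fun x => 1 * f x + f x) :> (K -> R))%R.
  by apply/funext => x; rewrite mul1r.
by rewrite energy_sq//; field.
Qed.

Lemma rho_measurable f : F f -> measurable_fun setT (rho f : borel K -> R).
Proof.
move=> Ff; apply: measurableT_comp => //.
apply: measurable_int; apply: Radon_Nikodym_integrable.
exact: (mutual_dominated pcf g_dom Ff Fg).
Qed.

(** The squared derivative is almost everywhere the density of nu_(f,f), whose total mass is 2 E(f)
    in the chosen normalization. *)
Lemma integral_rho_sq f : F f ->
  (\int[nu g]_x ((rho f x) ^+ 2)%:E = (2 * E f f)%:E)%E.
Proof.
move=> Ff; rewrite -mutual_total//.
have D := mutual_dominated pcf g_dom Ff Ff.
rewrite (Radon_Nikodym_integral D)//.
apply: ae_eq_integral => //.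
- apply/measurable_EFinP; apply: measurable_funX; exact: rho_measurable.
- apply: filterS (RN_identity pcf K_compact hK K_connected N_ge2 HS_regular nu_energy
  g_dom index1 Ff).
  by move=> x [_ idx] _; rewrite -idx fineK// Radon_Nikodym_fin_num.
Qed.

(** The cell quotients are linear in the first function, hence so are their almost sure limits. *)
Lemma rho_linear a f h : F f -> F h ->
  {ae nu g, forall x, rho (fun y => a * f y + h y) x = a * rho f x + rho h x}.
Proof.
move=> Ff Fh; have Ffh := domF_lin pcf a Ff Fh.
have aF := ae_filter_ringOfSetsType (nu g).
have C1 := cvg_bcell_ratio pcf K_compact hK K_connected N_ge2 HS_regular nu_energy g_dom
  Ffh Fg.
have C2 := cvg_bcell_ratio pcf K_compact hK K_connected N_ge2 HS_regular nu_energy g_dom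
  Ff Fg.
have C3 := cvg_bcell_ratio pcf K_compact hK K_connected N_ge2 HS_regular nu_energy g_dom
  Fh Fg.
apply: (@filterS3 _ _ aF _ _ _ _ _ C1 C2 C3) => x c1 c2 c3.
apply: (@cvg_unique _ (@Rhausdorff R) _ _ _ _ c1).
rewrite (_ : (fun n => _) = (fun n =>
    a * (bcell HS f g (code_prefix L x n) / ecell HS g (code_prefix L x n)) +
    bcell HS h g (code_prefix L x n) / ecell HS g (code_prefix L x n))).
  by apply: cvgD => //; apply: cvgM => //; exact: cvg_cst.
apply/funext => n; rewrite /bcell.
rewrite [energy HS _ _](energyDl pcf a (domF_cell pcf (code_prefix L x n) Ff) (domF_cell
  pcf (code_prefix L x n) Fh) (domF_cell pcf (code_prefix L x n) Fg)).
by ring.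
Qed.

Lemma Lnorm_rho f : F f ->
  ('N[nu g]_(2%:E)[EFin \o (rho f : borel K -> R)] = (Num.sqrt (2 * E f f))%:E)%E.
Proof.
move=> Ff; rewrite unlock /=.
under eq_integral => x _ do rewrite /= powR_mulrn// real_normK ?num_real//.
by rewrite integral_rho_sq// poweR_EFin powR12_sqrt// mulr_ge0// energy_ge0.
Qed.

Lemma rho_Lfun f : F f -> (rho f : borel K -> R) \in Lfun (nu g) 2%:E.
Proof.
move=> Ff; rewrite inE; apply/andP; split; rewrite inE /=.
  exact: rho_measurable.
by rewrite /finite_norm Lnorm_rho// ltry.
Qed.

End Integral.

Theorem theorem5p4 (R : realType) (K : ptopologicalType) (N : nat)
    (L : selfSimilar K N) (HS : harmonicStructure R L)
    (mu : probability (borel K) R)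
    (nu : (K -> R) -> {finite_measure set (borel K) -> \bar R})
    (g : K -> R) (n : nat -> nat)
    (K_compact : compact [set: K]) (K_metrizable : metrizable R K)
    (K_connected : connected [set: K])
    (N_ge2 : (2 <= N)%N) (K_pcf : post_critically_finite L)
    (HS_regular : regular_harmonic HS)
    (mu_full : full_support mu)
    (nu_energy : energy_measures HS nu)
    (index1 : energy_index HS nu = 1%E)
    (g_dom : domF_dom HS nu g)
    (n_incr : {homo n : i j / (i <= j)%N}) (n_oo : n k @[k --> \oo] --> \oo)
    (n_summable : cvgn (series (fun k : nat =>
       let e := g \- harmonic_interp HS (n k) g in
       Num.sqrt (energy HS e e)))) :
  exists dfdg : (K -> R) -> K -> R,
    [/\ forall f, domF HS f ->
          {ae nu g, forall x,
             unique (is_derivative_along L g f n x) (dfdg f x) /\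
             limn_einf (fun m => (remainder_ratio L g f x (dfdg f x) m)%:E)
               = 0%E},
        forall f, domF HS f ->
          energy HS f f = 2^-1 * \int[nu g]_x (dfdg f x) ^+ 2,
        bounded_linear_L2 (domF HS) (normF HS mu) (nu g) dfdg &
        harmonic_star HS g ->
          forall f, domF HS f ->
            {ae nu g, forall x,
               unique (is_derivative_along L g f id x) (dfdg f x)}].
Proof.
have pcf := K_pcf.
have hK := metrizable_hausdorff K_metrizable.
have [Fg _] := g_dom.
pose dfdg f x := fine (Radon_Nikodym (mutual_energy_measure nu f g) (nu g) x).
have aF := ae_filter_ringOfSetsType (nu g).
have gt0 := ae_ecell_gt0 pcf K_compact hK K_connected N_ge2 HS_regular nu_energy g_dom.
have cvr f (Ff : domF HS f) := cvg_remainder_energy pcf K_compact hK K_connected N_ge2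
  HS_regular nu_energy g_dom index1 Ff.
exists dfdg; split.
- move=> f Ff.
  have good := ae_good_along pcf K_compact hK K_connected N_ge2 HS_regular nu_energy
    g_dom n_summable.
  apply: (@filterS3 _ _ aF _ _ _ _ _ gt0 (cvr f Ff) good) => x x0 xc xg.
  have U := is_derivative_along_cvg pcf K_compact hK K_connected N_ge2 HS_regular g_dom
    Ff n_oo x0 xc xg.
  split => //; have [Ha _] := U.
  apply: (limn_einf_subseq0 _ n_oo Ha) => m.
  have [c Hc] := domF_bounded pcf K_compact hK K_connected N_ge2 HS_regular Fg.
  exact: remainder_ratio_ge0 Hc.
- move=> f Ff; rewrite /Rintegral (integral_rho_sq pcf K_compact hK K_connected N_ge2
  HS_regular nu_energy g_dom index1 Ff)/=.
  by rewrite mulKf.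
- split.
  + move=> f Ff; exact: (rho_Lfun pcf K_compact hK K_connected N_ge2 HS_regular nu_energy
    g_dom index1 Ff).
  + move=> a f h Ff Fh; exact: (rho_linear pcf K_compact hK K_connected N_ge2 HS_regular
    nu_energy g_dom a Ff Fh).
  (* The L^2 norm of the derivative is the root of 2 E(f), and [normF] adds a nonnegative term to
     E(f). *)
  + exists (Num.sqrt 2) => f Ff.
    rewrite (Lnorm_rho pcf K_compact hK K_connected N_ge2 HS_regular nu_energy g_dom
      index1 Ff) lee_fin.
    rewrite sqrtrM// ler_wpM2l// ler_wsqrtr// lerDl.
    by apply: Rintegral_ge0 => x _; exact: sqr_ge0.
(* The definition of [dfdg] does not involve [n], so the same function serves along all levels. *)
- move=> gstar f Ff.
  apply: (@filterS2 _ _ aF _ _ _ _ gt0 (cvr f Ff)) => x x0 xc.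
  apply: (is_derivative_along_cvg pcf K_compact hK K_connected N_ge2 HS_regular g_dom Ff
    _ x0 xc) => //.
  exact: harmonic_star_good.
Qed.
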